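(* Consider the Cauchy problem $$\partial_t u+\nu(-\Delta)^{\alpha/2}u+\nabla\cdot(u\,\nabla K*u)=0,\qquad u(x,0)=u_0(x),\qquad x\in\mathbb{R}^d,\ t\ge 0,$$ where $K(x)=k(|x|)$ for $x\in\mathbb{R}^d$ with $k$ a locally Lipschitz continuous function. Consider a nonnegative and integrable initial condition $u_0\not\equiv 0$ which is even, $u_0(x)=u_0(-x)$ for $x\in\mathbb{R}^d$, and satisfies $M_1:=\int_{\mathbb{R}^d}|x|\,u_0(x)\,dx<\infty$, and put $M:=\int_{\mathbb{R}^d}u_0(x)\,dx$. Assume that $\nu>0$, $0<\alpha<1$, and that $k$ fulfills either (H1) or (H2). If $M$ is sufficiently large and $M_1$ is sufficiently small, then the solution $u$ to the Cauchy problem ceases to exist in a finite time.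
   Context: Conditions on $k$: (H1): there is $K_0>0$ such that $-K_0\le k'\le 0$ and $\kappa_R:=-\sup_{(0,R)}k'>0$ for each $R>0$. (H2): $k'(r)=-k_1'(r)+k_2'(r)$ for $r>0$, for some functions $k_1,k_2$, and there are $K_0>0$, $K_1>0$, $K_2\ge 0$ and $\delta\in[0,1)$ such that for all $r>0$ $$|k'(r)|\le K_0(1+r^\delta),\qquad K_1\le k_1'(r),\qquad k_2'(r)\le K_2\,r^\delta .$$ The operator $(-\Delta)^{\alpha/2}$ is defined in the Fourier variables by $\mathcal{F}((-\Delta)^{\alpha/2}u)(\xi)=|\xi|^\alpha\widehat u(\xi)$. Solutions are understood to be nonnegative regular solutions which are even in $x$ (as implied by evenness of $u_0$, radial symmetry of $K$ and uniqueness) and conserve the total mass: $\int_{\mathbb{R}^d}u(x,t)\,dx=M$. Local existence, positivity and mass conservation are taken for granted.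
   Formalization: In (H2) with δ=0, K_2<K_1 is added: otherwise k=0 is admitted (k_1=k_2=r), giving the linear equation with global solutions. Solutions must keep the integral of (ess sup of |k'| on (0,2|x|)) u(x,t) locally bounded in t, so that ∇K*u converges absolutely. *)

(* Defs.v *)
From HB Require Import structures.
From mathcomp Require Import all_boot all_order all_algebra.
From mathcomp Require Import all_classical all_reals all_analysis.
From mathcomp Require Import ess_sup_inf complex.

Set Implicit Arguments.
Unset Strict Implicit.
Unset Printing Implicit Defensive.

Import Order.TTheory GRing.Theory Num.Theory.
Import numFieldNormedType.Exports.

Local Open Scope classical_set_scope.
Local Open Scope ring_scope.

(* The library has no measurable structure on row vectors: as for n.-tuple, we
   take the sigma-algebra generated by the coordinates. *)
Definition rV_display : measure_display -> measure_display.
Proof. exact. Qed.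

Section measurable_rV.
Context {d} {T : sigmaRingType d}.
Variable n : nat.

Let coors : 'I_n -> 'rV[T]_n -> T := fun i x => x ord0 i.

Let rV_set0 : g_sigma_preimage coors set0.
Proof. exact: sigma_algebra0. Qed.

Let rV_setC A : g_sigma_preimage coors A -> g_sigma_preimage coors (~` A).
Proof. exact: sigma_algebraC. Qed.

Let rV_bigcup (F : _^nat) : (forall i, g_sigma_preimage coors (F i)) ->
  g_sigma_preimage coors (\bigcup_i (F i)).
Proof. exact: sigma_algebra_bigcup. Qed.

HB.instance Definition _ := @isMeasurable.Build (rV_display d)
  'rV[T]_n (g_sigma_preimage coors) rV_set0 rV_setC rV_bigcup.

End measurable_rV.

Lemma measurable_coord_rV d (T : sigmaRingType d) n (i : 'I_n) :
  measurable_fun [set: 'rV[T]_n] (fun x : 'rV[T]_n => x ord0 i).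
Proof.
move=> _ Y mY; rewrite setTI; apply: sub_sigma_algebra => /=.
rewrite -bigcup_seq/=; exists i => /=; first by rewrite mem_index_enum.
by exists Y => //; rewrite setTI.
Qed.

Lemma measurable_fun_rV d1 d2 (T1 : measurableType d1) (T2 : measurableType d2)
    n (f : T1 -> 'rV[T2]_n) :
  (forall i, measurable_fun [set: T1] (fun x => f x ord0 i)) ->
  measurable_fun [set: T1] f.
Proof.
move=> mf _ Y mY; rewrite setTI.
suff H : measurable `<=` image_set_system setT f measurable.
  by have := H _ mY; rewrite /image_set_system/= setTI.
apply: smallest_sub.
  exact/sigma_algebra_image/sigma_algebra_measurable.
move=> A; rewrite -bigcup_seq/= => -[i _ [B mB <-]].
rewrite /image_set_system /= !setTI -[X in measurable X]setTI.
exact: mf.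
Qed.

Section lebesgue_rV.
Context {R : realType}.

Definition cons_rV n (p : R * 'rV[R]_n) : 'rV[R]_n.+1 :=
  row_mx (const_mx p.1 : 'rV_1) p.2.

Lemma cons_rV0 n (p : R * 'rV[R]_n) : cons_rV p ord0 ord0 = p.1.
Proof.
by rewrite mxE; case: splitP => // j _; rewrite mxE.
Qed.

Lemma cons_rVS n (p : R * 'rV[R]_n) i :
  cons_rV p ord0 (lift ord0 i) = p.2 ord0 i.
Proof.
have -> : lift ord0 i = rshift 1 i :> 'I_(1 + n) by apply: val_inj.
exact: row_mxEr.
Qed.

Lemma measurable_cons_rV n : measurable_fun setT (@cons_rV n).
Proof.
apply: measurable_fun_rV => i; have [j ->|->] := unliftP ord0 i.
  under eq_fun do rewrite cons_rVS.
  exact: (measurableT_comp (measurable_coord_rV j) measurable_snd).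
under eq_fun do rewrite cons_rV0.
exact: measurable_fst.
Qed.

Section step.
Variables (n : nat) (m : {sigma_finite_measure set 'rV[R]_n -> \bar R}).

Definition lebesgue_rV_step : set 'rV[R]_n.+1 -> \bar R :=
  pushforward (lebesgue_measure \x m)%E (@cons_rV n).

Let step0 : lebesgue_rV_step set0 = 0%E.
Proof. by rewrite /lebesgue_rV_step /pushforward preimage_set0 measure0. Qed.

Let step_ge0 A : (0 <= lebesgue_rV_step A)%E.
Proof. by rewrite /lebesgue_rV_step /pushforward; exact: measure_ge0. Qed.

Let step_sigma_additive : semi_sigma_additive lebesgue_rV_step.
Proof.
have mpre A : measurable A -> measurable (@cons_rV n @^-1` A).
  by move=> mA; rewrite -[X in measurable X]setTI; exact: measurable_cons_rV.
move=> F mF tF mUF; rewrite /lebesgue_rV_step /pushforward preimage_bigcup.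
apply: measure_semi_sigma_additive.
- by move=> i; exact: mpre.
- apply/trivIsetP => /= i j _ _ ij; rewrite -preimage_setI.
  by move/trivIsetP : tF => /(_ _ _ _ _ ij) ->//; rewrite preimage_set0.
- by rewrite -preimage_bigcup; exact: mpre.
Qed.

HB.instance Definition _ := isMeasure.Build _ _ _ lebesgue_rV_step
  step0 step_ge0 step_sigma_additive.

Let step_sigma_finite : sigma_finite setT lebesgue_rV_step.
Proof.
have /sigma_finiteP[F [FT ndF Foo]] := sigma_finiteT (@lebesgue_measure R).
have /sigma_finiteP[G [GT ndG Goo]] := sigma_finiteT m.
pose g (x : 'rV[R]_n.+1) := (x ord0 ord0, \row_j x ord0 (lift ord0 j)).
have mg : measurable_fun setT g.
  apply/measurable_fun_pairP; split.
    exact: measurable_coord_rV.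
  apply: measurable_fun_rV => i; rewrite /comp /=.
  under eq_fun do rewrite mxE.
  exact: measurable_coord_rV.
have gK : cancel (@cons_rV n) g.
  move=> [a v]; rewrite /g cons_rV0; congr pair.
  by apply/rowP => j; rewrite mxE cons_rVS.
exists (fun i => g @^-1` (F i `*` G i)).
  rewrite -preimage_bigcup; apply/esym/seteqP; split => // x _ /=.
  have [i _ Fi] : (\bigcup_i F i) (g x).1 by rewrite -FT.
  have [j _ Gj] : (\bigcup_i G i) (g x).2 by rewrite -GT.
  exists (maxn i j) => //; split.
  - by move: Fi; exact/subsetPset/ndF/leq_maxl.
  - by move: Gj; exact/subsetPset/ndG/leq_maxr.
move=> i; have [mF Fi] := Foo i; have [mG Gi] := Goo i; split.
  by rewrite -[X in measurable X]setTI; apply: mg => //; exact: measurableX.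
rewrite /lebesgue_rV_step /pushforward -comp_preimage.
rewrite (_ : g \o _ = id) ?preimage_id; last exact/funext.
by rewrite product_measure1E// lte_mul_pinfty// ge0_fin_numE.
Qed.

HB.instance Definition _ :=
  @Measure_isSigmaFinite.Build _ _ _ lebesgue_rV_step step_sigma_finite.

End step.

Fixpoint lebesgue_rV n : {sigma_finite_measure set 'rV[R]_n -> \bar R} :=
  match n with
  | 0 => dirac (0 : 'rV[R]_0)
  | n.+1 => lebesgue_rV_step (lebesgue_rV n)
  end.

End lebesgue_rV.

Lemma lebesgue_rV_box (R : realType) n (A : 'I_n -> set R) :
  (forall i, measurable (A i)) ->
  (lebesgue_rV n [set x : 'rV[R]_n | forall i, A i (x ord0 i)] =
   \prod_(i < n) lebesgue_measure (A i))%E.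
Proof.
elim: n A => [|n IH] A mA.
  by rewrite big_ord0 /= diracE mem_set// => -[].
rewrite big_ord_recl -IH//= /lebesgue_rV_step /pushforward.
have mcube : measurable [set x : 'rV[R]_n | forall i, A (lift ord0 i) (x ord0 i)].
  rewrite (_ : mkset _ = \bigcap_(i in setT) [set x : 'rV[R]_n |
      A (lift ord0 i) (x ord0 i)]); last first.
    by apply/seteqP; split => [x + i _|x + i]; exact.
  apply: fin_bigcap_measurable => // i _; rewrite -[X in measurable X]setTI.
  exact: (measurable_coord_rV i).
rewrite -product_measure1E//; last exact: (mA ord0).
have -> : @cons_rV R n @^-1` [set x | forall i, A i (x ord0 i)] = A ord0 `*`
    [set x : 'rV[R]_n | forall i, A (lift ord0 i) (x ord0 i)]; last by [].
apply/seteqP; split => [[a v] /= H|[a v] /= [H0 HS] i].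
  split; first by have := H ord0; rewrite cons_rV0.
  by move=> i; have := H (lift ord0 i); rewrite cons_rVS.
by have [j ->|->] := unliftP ord0 i; rewrite ?cons_rVS ?cons_rV0.
Qed.

Section definitions.
Context {R : realType} {d : nat}.
Local Notation V := 'rV[R]_d.
Local Notation leb := (@lebesgue_measure R).
Local Notation mu := (@lebesgue_rV R d).
Implicit Types (x y xi : V) (f g : V -> R) (F : V -> V) (k : R -> R).

(* The library norm on row vectors is the sup norm. *)
Definition dotp x y : R := \sum_i x ord0 i * y ord0 i.
Definition enorm x : R := Num.sqrt (dotp x x).

Definition L1 f : Prop := mu.-integrable setT (EFin \o f).

Definition partial (i : 'I_d) f x : R := 'D_(delta_mx ord0 i) f x.

(* \hat f(xi) = \int f(x) e^{- i x.xi} dx *)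
Definition fourier f xi : R[i] :=
  ((\int[mu]_x (f x * cos (dotp x xi))) -i*
   (\int[mu]_x (f x * sin (dotp x xi))))%C.

(* g = (-Delta)^(alpha/2) f in L^1 *)
Definition is_fraclap (alpha : R) f g : Prop :=
  L1 g /\ forall xi,
    fourier g xi = ((enorm xi `^ alpha)%:C * fourier f xi)%C.

Definition test_function (phi : V -> R) : Prop :=
  [/\ continuous phi,
      forall i x, derivable phi x (delta_mx ord0 i),
      forall i, continuous (partial i phi) &
      exists A : R, forall x, A < enorm x -> phi x = 0].

(* g is the divergence of the L^1 vector field F, in the sense of
   distributions. *)
Definition is_divergence F g : Prop :=
  [/\ forall i, L1 (fun x => F x ord0 i),
      L1 g &
      forall phi, test_function phi ->
        \int[mu]_x (phi x * g x) =
        - \int[mu]_x \sum_i (partial i phi x * F x ord0 i)].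

Definition radial k x : R := k (enorm x).

(* (\nabla K * f)(x) *)
Definition velocity k f x : V :=
  \row_i \int[mu]_y (partial i (radial k) (x - y) * f y).

Definition flux k f x : V := f x *: velocity k f x.

(* A locally Lipschitz function on [0, +oo[ has a derivative only almost
   everywhere: the bounds on k' are required almost everywhere and its suprema
   are essential suprema. *)
Definition ess_sup_on (A : set R) (h : R -> R) : \bar R :=
  ess_sup leb (fun r => if r \in A then (h r)%:E else -oo%E).

Definition locally_lipschitz k : Prop :=
  forall rho : R, [lipschitz k r | r in [set` `[0, rho]]].

Definition cond_H1 k : Prop :=
  (exists2 K0 : R, 0 < K0 &
     {ae leb, forall r, 0 < r -> derivable k r 1 /\ - K0 <= derive1 k r <= 0}) /\
  (forall rho : R, 0 < rho ->
     (0 < - ess_sup_on [set r | 0 < r < rho]%R (derive1 k))%E).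

(* The condition K2 < K1 when delta = 0 does not restrict the case 0 < delta.
   Without it, delta = 0 and K2 >= K1 would put no sign condition at all on k',
   so that k = 0 would be admitted (k1 = k2 = id), for which the equation is
   the linear fractional heat equation and has global solutions. *)
Definition cond_H2 k : Prop :=
  exists (k1 k2 : R -> R) (K0 K1 K2 delta : R),
    [/\ 0 < K0 /\ 0 < K1, 0 <= K2, 0 <= delta < 1, delta = 0 -> K2 < K1 &
        {ae leb, forall r, 0 < r ->
          [/\ [/\ derivable k r 1, derivable k1 r 1 & derivable k2 r 1],
              derive1 k r = - derive1 k1 r + derive1 k2 r,
              `|derive1 k r| <= K0 * (1 + r `^ delta),
              K1 <= derive1 k1 r &
              derive1 k2 r <= K2 * r `^ delta]}].

(* ess sup of |k'| over ]0, r[ *)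
Definition kmax k (r : R) : \bar R :=
  ess_sup leb (fun s => (\1_[set s | 0 < s < r] s * `|derive1 k s|)%:E).

Definition L1dist f g : R := \int[mu]_x `|f x - g x|.

Record solution (nu alpha : R) k (u0 : V -> R) (T : R) (u : R -> V -> R)
    : Prop := Solution {
  sol_L1 : forall t, 0 <= t < T -> L1 (u t);
  sol_ge0 : forall t x, 0 <= t < T -> 0 <= u t x;
  sol_even : forall t x, 0 <= t < T -> u t (- x) = u t x;
  sol_mass : forall t, 0 <= t < T -> \int[mu]_x u t x = \int[mu]_x u0 x;
  (* Since |x - y| <= max(2|x|, 2|y|), this makes \nabla K * u an absolutely
     convergent integral and u (\nabla K * u) integrable.  If k' is bounded,
     it follows from sol_mass. *)
  sol_velocity : forall s, 0 <= s < T -> exists C : R, forall t, 0 <= t <= s ->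
    (\int[mu]_x (kmax k (2 * enorm x)%R * (u t x)%:E) <= C%:E)%E;
  sol_init : u 0 = u0;
  sol_continuous : forall t, 0 <= t < T ->
    L1dist (u s) (u t) @[s --> within [set` `[0, T[] (nbhs t)] --> 0;
  sol_equation : forall t, 0 < t < T -> exists dtu lap div : V -> R,
    [/\ L1 dtu /\
        L1dist (fun x => h^-1 * (u (t + h) x - u t x)) dtu @[h --> 0^'] --> 0,
        is_fraclap alpha (u t) lap,
        is_divergence (flux k (u t)) div &
        {ae mu, forall x, dtu x + nu * lap x + div x = 0}] }.

End definitions.

(* Main.v *)
Require Import Defs.
From HB Require Import structures.
From mathcomp Require Import all_boot all_order all_algebra.
From mathcomp Require Import all_classical all_reals all_analysis.
From mathcomp Require Import ess_sup_inf measurable_realfun complex ring lra.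

Import Order.TTheory GRing.Theory Num.Theory.
Import numFieldNormedType.Exports.

Local Open Scope classical_set_scope.
Local Open Scope ring_scope.

Set Implicit Arguments.
Unset Strict Implicit.
Unset Printing Implicit Defensive.

(** For an attractive kernel and a large concentrated mass, a suitable moment of
    the solution would become negative in finite time. Since [alpha < 1], a
    solution has in general no finite first moment at positive times, and the
    velocity may grow like [|x|^delta], so the moments must be truncated.

    The building block is [min(|x_i|, a)], in one coordinate. Its fractional
    Laplacian is explicit: [min(|s|, a)] is a superposition of the products
    [(1 - cos (s t)) * (1 - cos (a t))], so that the definition of the operator
    by the Fourier transform suffices ([int_fraclap_min]), and the dissipation
    raises the moment at a rate at most [nu * gamma * a^(1 - alpha) * M]. The
    divergence is defined with C^1 compactly supported test functions, which
    approach [min(|x_i|, a)] ([int_divergence_min]). Hence the truncated moments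
    are differentiable in time, with an explicit derivative
    ([is_derive_moment]).

    Near the origin the kernel satisfies [k' <= - kap], under either hypothesis
    ([exists_kernel_bounds]). By evenness, the interaction of [x] with [y] may be
    averaged with that of [x] with [-y], and then the drift lowers the sum of the
    truncated moments at a rate at least a multiple of the squared mass in a small
    cube, up to an error in the mass outside the cube, weighted by
    [h (2 |x|)], where [h r] is the essential supremum of [|k'|] on [(0, r)]
    ([sum_drift_le]).

    That error is controlled by a functional with all scales: let [rho j] grow
    geometrically and [c j] be about [h (rho j) / rho j], which is summable since
    [delta < 1]. The functional [w], the sum over [j] of [c j] times the moments
    truncated at [rho j], bounds the error ([outside_reach_le]). If
    [c j * rho j ^ (1 - alpha)] is summable, the dissipation raises [w] at a rate
    linear in [M], the drift lowers it at a rate quadratic in [M] as long as [w] is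
    small compared with [M], and a barrier argument leads to a contradiction in
    finite time ([blowup_of_summable]).

    If that series diverges, no solution exists on any interval. The jumps of the
    diffusion send a mass at least of order [r^(-alpha)] to distances of order [r],
    as seen by testing with the tent-shaped combinations of truncated coordinates
    supported in [r < |x_i| < 4 r] ([tent_moment_ge]). Then the divergence of the
    series means that the integral of [h (2 |x|) u] is infinite, whereas it is
    finite for every solution ([summable_of_solution]). *)

(** * Real-valued integrals *)

Section integrals.
Context {d1} {T : measurableType d1} {R : realType}.
Variable m : {measure set T -> \bar R}.
Implicit Types f g h : T -> R.

Lemma integrable_measurable f :
  m.-integrable setT (EFin \o f) -> measurable_fun setT f.
Proof. by move/measurable_int/measurable_EFinP. Qed.

Lemma integrable_le f g : measurable_fun setT f ->
  m.-integrable setT (EFin \o g) -> (forall x, `|f x| <= g x) ->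
  m.-integrable setT (EFin \o f).
Proof.
move=> mf ig fg; apply: le_integrable ig => //.
  exact/measurable_EFinP.
by move=> x _ /=; rewrite lee_fin (le_trans (fg x))// ler_norm.
Qed.

Lemma integrableZ f (c : R) : m.-integrable setT (EFin \o f) ->
  m.-integrable setT (EFin \o (fun x => c * f x)).
Proof. move=> fi; exact: (integrableZl measurableT c fi). Qed.

Lemma integrable_bdMl f g (C : R) : measurable_fun setT f ->
  (forall x, `|f x| <= C) -> m.-integrable setT (EFin \o g) ->
  m.-integrable setT (EFin \o (fun x => f x * g x)).
Proof.
move=> mf fC ig.
have ig' : m.-integrable setT (EFin \o (fun x => C * `|g x|)).
  exact: (integrableZ (f := fun x => `|g x|) C (integrable_norm ig)).
apply: integrable_le ig' _; first exact: measurable_funM (integrable_measurable ig).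
by move=> x; rewrite normrM ler_wpM2r.
Qed.

Lemma integrable_add f g : m.-integrable setT (EFin \o f) ->
  m.-integrable setT (EFin \o g) ->
  m.-integrable setT (EFin \o (fun x => f x + g x)).
Proof. by move=> fi; apply: (integrableD measurableT fi). Qed.

Lemma integrable_sub f g : m.-integrable setT (EFin \o f) ->
  m.-integrable setT (EFin \o g) ->
  m.-integrable setT (EFin \o (fun x => f x - g x)).
Proof. by move=> fi; apply: (integrableB measurableT fi). Qed.

Lemma integrable_big (I : Type) (s : seq I) (h : I -> T -> R) :
  (forall i, m.-integrable setT (EFin \o h i)) ->
  m.-integrable setT (EFin \o (fun x => \sum_(i <- s) h i x)).
Proof.
move=> ih; rewrite (_ : EFin \o _ = (fun x => \sum_(i <- s) (h i x)%:E)%E).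
  by apply: integrable_sum => // i _; exact: ih.
by apply/funext => x; rewrite /= sumEFin.
Qed.

Lemma int_sum (I : Type) (s : seq I) (h : I -> T -> R) :
  (forall i, m.-integrable setT (EFin \o h i)) ->
  \int[m]_x (\sum_(i <- s) h i x) = \sum_(i <- s) \int[m]_x h i x.
Proof.
move=> ih; elim: s => [|i s IHs].
  under eq_Rintegral do rewrite big_nil.
  by rewrite big_nil /Rintegral integral0.
rewrite big_cons -IHs -RintegralD//; last exact: integrable_big.
by apply: eq_Rintegral => x _; rewrite big_cons.
Qed.

Lemma int_fin f : m.-integrable setT (EFin \o f) ->
  (\int[m]_x (f x)%:E)%E = (\int[m]_x f x)%:E.
Proof. by move=> fi; rewrite /Rintegral fineK//; exact: integrable_fin_num. Qed.

Lemma int_le f g : m.-integrable setT (EFin \o f) ->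
  m.-integrable setT (EFin \o g) -> (forall x, f x <= g x) ->
  \int[m]_x f x <= \int[m]_x g x.
Proof. by move=> fi gi fg; apply: le_Rintegral. Qed.

Lemma int_norm_le f g : measurable_fun setT f ->
  m.-integrable setT (EFin \o g) -> (forall x, `|f x| <= g x) ->
  `|\int[m]_x f x| <= \int[m]_x g x.
Proof.
move=> mf ig fg; have fi := integrable_le mf ig fg.
apply: (le_trans (le_normr_Rintegral measurableT fi)).
by apply: int_le => //; exact: integrable_norm.
Qed.

Import HBNNSimple.

(** The integral of a nonnegative function is a supremum over the simple
    functions below it, hence monotone for all functions; so measurability is
    needed on one side only. This matters for integrands such as the partial
    derivatives of the kernel, whose values on a null set are arbitrary. *)
Let ae_eq_ge0 (f g : T -> \bar R) : measurable_fun setT f ->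
  (forall x, 0 <= f x)%E -> (forall x, 0 <= g x)%E ->
  {ae m, forall x, f x = g x} -> (\int[m]_x g x = \int[m]_x f x)%E.
Proof.
move=> mf f0 g0 fg; apply/eqP; rewrite eq_le; apply/andP; split.
  rewrite [X in (X <= _)%E]ge0_integralTE//; apply: ge_ereal_sup => _ /= [h hg <-].
  rewrite -integralT_nnsfun; apply: ae_ge0_le_integral => //.
  - by move=> x _; rewrite lee_fin; exact: fun_ge0.
  - exact/measurable_EFinP.
  - by apply: filterS fg => x fgx _; rewrite fgx hg.
have [N [mN N0 fgN]] := fg.
pose f' x := if x \in N then 0%E else f x.
have mf' : measurable_fun setT f'.
  apply: measurable_fun_ifT => //.
  by apply: (measurable_fun_bool true); rewrite setTI preimage_mem_true.
rewrite (_ : \int[m]_x f x = \int[m]_x f' x)%E; last first.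
  apply: ge0_ae_eq_integral => //.
    by move=> x _; rewrite /f'; case: ifP.
  exists N; split => // x /=; apply: contra_notP => xN.
  by rewrite /f' memNset.
rewrite !ge0_integralTE//; last by move=> x; rewrite /f'; case: ifP.
apply: ereal_sup_le => _ /= [h hf <-]; exists h => // x.
apply: le_trans (hf x) _; rewrite /f'; case: ifPn => // xN.
rewrite le_eqVlt; apply/orP; left; apply/eqP; apply: contrapT => fgx.
by move: xN; rewrite mem_set//; exact: fgN.
Qed.

Lemma int_ae_eq f g : measurable_fun setT f ->
  {ae m, forall x, f x = g x} -> \int[m]_x g x = \int[m]_x f x.
Proof.
move=> mf fg; rewrite /Rintegral; congr fine.
rewrite [LHS]integralE [RHS]integralE; congr (_ - _)%E; apply: ae_eq_ge0 => //.
- exact/measurable_funepos/measurable_EFinP.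
- by apply: filterS fg => x fgx; rewrite !funeposE /= fgx.
- exact/measurable_funeneg/measurable_EFinP.
- by apply: filterS fg => x fgx; rewrite !funenegE /= fgx.
Qed.

Lemma int_dominated_cvg (f_ : nat -> T -> R) f g :
  (forall n, measurable_fun setT (f_ n)) ->
  (forall x, f_ n x @[n --> \oo] --> f x) ->
  m.-integrable setT (EFin \o g) -> (forall n x, `|f_ n x| <= g x) ->
  m.-integrable setT (EFin \o f) /\
  \int[m]_x f_ n x @[n --> \oo] --> \int[m]_x f x.
Proof.
move=> mf_ f_f ig f_g.
have mf : measurable_fun setT f.
  by apply: (measurable_fun_cvg (h := f_)) => // x _; exact: f_f.
have [||||fi _ cvi] := @dominated_convergence _ _ _ m setT measurableT
   (fun n => EFin \o f_ n) (EFin \o f) (EFin \o g) _ _ _ ig.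
- by move=> n; exact/measurable_EFinP.
- exact/measurable_EFinP.
- by apply: aeW => x _; apply/fine_cvgP; split; [exact: nearW|exact: f_f].
- by apply: aeW => x n _; rewrite lee_fin.
split => //; apply: fine_cvg; move: cvi; rewrite -int_fin//; exact.
Qed.

End integrals.

Section Rfubini.
Context {d1 d2} {T1 : measurableType d1} {T2 : measurableType d2} {R : realType}.
Variable m1 : {sigma_finite_measure set T1 -> \bar R}.
Variable m2 : {sigma_finite_measure set T2 -> \bar R}.

Lemma Rintegral_prod1 (F : T1 * T2 -> R) :
  (m1 \x m2)%E.-integrable setT (EFin \o F) ->
  \int[m1]_x \int[m2]_y F (x, y) = \int[(m1 \x m2)%E]_z F z.
Proof.
move=> iF; rewrite [RHS]/Rintegral -(integral12_prod_meas1 iF) /Rintegral.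
congr fine; apply: ae_eq_integral => //.
- apply/measurable_EFinP; apply: measurableT_comp => //.
  exact: measurable_fubini_F iF.
- exact: measurable_fubini_F iF.
have := ae_integrable1 iF.
by apply: filterS => x H _ /=; rewrite fineK//; exact: integrable_fin_num.
Qed.

Lemma Rintegral_prod2 (F : T1 * T2 -> R) :
  (m1 \x m2)%E.-integrable setT (EFin \o F) ->
  \int[m2]_y \int[m1]_x F (x, y) = \int[(m1 \x m2)%E]_z F z.
Proof.
move=> iF; rewrite [RHS]/Rintegral -(integral21_prod_meas1 iF) /Rintegral.
congr fine; apply: ae_eq_integral => //.
- apply/measurable_EFinP; apply: measurableT_comp => //.
  exact: measurable_fubini_G iF.
- exact: measurable_fubini_G iF.
have := ae_integrable2 iF.
by apply: filterS => x H _ /=; rewrite fineK//; exact: integrable_fin_num.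
Qed.

Lemma Rintegral_swap (F : T1 * T2 -> R) :
  (m1 \x m2)%E.-integrable setT (EFin \o F) ->
  \int[m1]_x \int[m2]_y F (x, y) = \int[m2]_y \int[m1]_x F (x, y).
Proof. by move=> iF; rewrite Rintegral_prod1// Rintegral_prod2. Qed.

Lemma integrable_tensor (f : T1 -> R) (g : T2 -> R) :
  m1.-integrable setT (EFin \o f) -> m2.-integrable setT (EFin \o g) ->
  (m1 \x m2)%E.-integrable setT (EFin \o (fun z => f z.1 * g z.2)).
Proof.
move=> fi gi; apply/integrable12ltyP.
  apply/measurable_EFinP; apply: measurable_funM.
    exact: (measurableT_comp (integrable_measurable fi) measurable_fst).
  exact: (measurableT_comp (integrable_measurable gi) measurable_snd).
under eq_integral => x _.
  under eq_integral => y _ do rewrite /= normrM EFinM.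
  rewrite ge0_integralZl//; last first.
  - by apply/measurable_EFinP; apply: measurableT_comp (integrable_measurable gi).
  over.
have /integrableP[_ goo] := gi.
have gE : (\int[m2]_y `|g y|%:E = (\int[m2]_y `|g y|)%:E)%E.
  by rewrite int_fin//; exact: (integrable_norm gi).
under eq_integral => x _ do rewrite gE.
rewrite ge0_integralZr//; first last.
- by rewrite lee_fin; apply: Rintegral_ge0.
- by apply/measurable_EFinP; apply: measurableT_comp (integrable_measurable fi).
by rewrite int_fin ?ltry//; exact: (integrable_norm fi).
Qed.

End Rfubini.

(** * Affine changes of variables for Lebesgue measure *)

Section affine_measure.
Context {R : realType}.
Local Notation leb := (@lebesgue_measure R).
Local Open Scope ereal_scope.

Let aff (c b : R) : measurableTypeR R -> measurableTypeR R :=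
  fun t => (c * t + b)%R.

Let maff c b : measurable_fun setT (aff c b).
Proof. by apply: measurable_funD => //; exact: measurable_funM. Qed.

(** The scaled pushforward agrees with Lebesgue measure on intervals, which
    characterizes Lebesgue measure. *)
Lemma lebesgue_measure_affine (c b : R) (A : set (measurableTypeR R)) :
  (c != 0)%R -> measurable A ->
  leb ((fun t => c * t + b)%R @^-1` A) = (`|c|^-1)%:E * leb A.
Proof.
move=> c0 mA.
have c1 : (0 <= `|c|)%R by [].
pose nu' : {measure set (measurableTypeR R) -> \bar R} :=
  mscale (NngNum c1) (pushforward leb (aff c b)).
pose nu := nu' (maff c b).
suff <- : nu A = leb A.
  by rewrite /nu /nu' /mscale/= muleA -EFinM mulVf ?normr_eq0// mul1e.
apply/esym/lebesgue_measure_unique => // _ [[x y]] _ <-.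
change (leb `]x, y] = `|c|%:E * leb (aff c b @^-1` `]x, y])).
rewrite (_ : aff c b @^-1` `]x, y]%classic = if (0 < c)%R then [set` `]((x - b) / c)%R, ((y - b) / c)%R]]
    else [set` `[((y - b) / c)%R, ((x - b) / c)%R[]); last first.
  apply/seteqP; split => t /=; rewrite /aff; case: ltrP => cp /=;
    rewrite !in_itv/=.
  - by rewrite ltr_pdivrMr// ler_pdivlMr// ltrBlDr lerBrDr mulrC.
  - have cn : (c < 0)%R by rewrite lt_neqAle c0.
    by rewrite ler_ndivrMr// ltr_ndivlMr// ltrBlDr lerBrDr [(c * _)%R]mulrC andbC.
  - by rewrite ltr_pdivrMr// ler_pdivlMr// ltrBlDr lerBrDr mulrC.
  - have cn : (c < 0)%R by rewrite lt_neqAle c0.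
    by rewrite ler_ndivrMr// ltr_ndivlMr// ltrBlDr lerBrDr [(c * _)%R]mulrC andbC.
case: ltrP => cp.
  rewrite !lebesgue_measure_itv/= !lte_fin ltr_pM2r ?invr_gt0// ltrD2r.
  case: ifP => _; last by rewrite mule0.
  by rewrite -!EFinB -EFinM gtr0_norm//; congr EFin; field.
have cn : (c < 0)%R by rewrite lt_neqAle c0.
rewrite !lebesgue_measure_itv/= !lte_fin ltr_nM2r ?invr_lt0// ltrD2r.
case: ifP => _; last by rewrite mule0.
by rewrite -!EFinB -EFinM ltr0_norm//; congr EFin; field.
Qed.

Lemma ge0_integral_affine (c b : R) (f : R -> \bar R) :
  (c != 0)%R -> measurable_fun setT f -> (forall x, 0 <= f x) ->
  \int[leb]_t f (c * t + b)%R = (`|c|^-1)%:E * \int[leb]_t f t.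
Proof.
move=> c0 mf f0.
rewrite -[LHS](@ge0_integral_pushforward _ _ _ _ R (aff c b) (maff c b) leb setT f)//.
have c1 : (0 <= `|c|^-1)%R by rewrite invr_ge0.
rewrite -(@ge0_integral_mscale _ _ R leb setT measurableT (NngNum c1))//.
apply: eq_measure_integral => A mA _.
by rewrite /mscale/= /pushforward lebesgue_measure_affine.
Qed.

Local Notation V n := 'rV[R]_n.

Lemma measurable_rV_affine n (c : R) (b : V n) :
  measurable_fun setT (fun x : V n => c *: x + b)%R.
Proof.
apply: measurable_fun_rV => i; under eq_fun do rewrite !mxE.
by apply: measurable_funD => //; apply: measurable_funM => //; exact: measurable_coord_rV.
Qed.

(** By induction on the dimension, peeling off the first coordinate. *)
Lemma lebesgue_rV_affine n (c : R) (b : V n) (A : set (V n)) :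
  (c != 0)%R -> measurable A ->
  lebesgue_rV n ((fun x => c *: x + b)%R @^-1` A) =
  ((`|c|^-1) ^+ n)%:E * lebesgue_rV n A.
Proof.
move=> c0; elim: n b A => [|n IH] b A mA.
  rewrite expr0 mul1e; congr (lebesgue_rV 0 _).
  have E (x y : V 0) : x = y by rewrite [x]thinmx0 [y]thinmx0.
  by apply/seteqP; split => x /=; rewrite (E (c *: x + b)%R x).
have mA' : measurable (@cons_rV R n @^-1` A).
  by rewrite -[X in measurable X]setTI; exact: measurable_cons_rV.
rewrite /= /lebesgue_rV_step /pushforward /product_measure1 /=.
pose b' : V n := \row_j b ord0 (lift ord0 j).
have consE a v : (c *: cons_rV (a, v) + b)%R =
    cons_rV ((c * a + b ord0 ord0)%R, (c *: v + b')%R).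
  apply/rowP => j; have [k ->|->] := unliftP ord0 j.
    by rewrite mxE [X in (X + _)%R]mxE !cons_rVS /= !mxE.
  by rewrite mxE [X in (X + _)%R]mxE !cons_rV0.
pose F a := lebesgue_rV n (xsection (@cons_rV R n @^-1` A) a).
transitivity (\int[leb]_a (((`|c|^-1) ^+ n)%:E * F (c * a + b ord0 ord0)%R)).
  apply: eq_integral => a _; rewrite /F -(IH b'); last exact: measurable_xsection.
  congr (lebesgue_rV n _); apply/seteqP; split => v;
    by rewrite /xsection /= !inE /= consE.
have mF : measurable_fun setT F by exact: measurable_fun_xsection.
rewrite ge0_integralZl//=; first last.
  by apply: (measurableT_comp mF); exact: maff.
rewrite (ge0_integral_affine (b ord0 ord0) c0 mF); last by move=> x; exact: measure_ge0.
by rewrite muleA -EFinM -exprSr.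
Qed.

Lemma negligible_rV_affine n (c : R) (b : V n) (P : V n -> Prop) : (c != 0)%R ->
  {ae lebesgue_rV n, forall x, P x} ->
  {ae lebesgue_rV n, forall x, P (c *: x + b)%R}.
Proof.
move=> c0 [N [mN N0 PN]]; exists ((fun x => c *: x + b)%R @^-1` N); split.
- by rewrite -[X in measurable X]setTI; exact: measurable_rV_affine.
- by apply: eq_trans (lebesgue_rV_affine b c0 mN) _; rewrite N0 mule0.
- by move=> x /= Px; apply: PN.
Qed.

Lemma ge0_integral_rV_opp n (f : V n -> \bar R) :
  measurable_fun setT f -> (forall x, 0 <= f x) ->
  \int[lebesgue_rV n]_x f (- x)%R = \int[lebesgue_rV n]_x f x.
Proof.
move=> mf f0; pose phi (x : V n) := (-1 *: x + 0)%R.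
have mphi : measurable_fun setT phi by exact: measurable_rV_affine.
transitivity (\int[lebesgue_rV n]_(x in setT) (f \o phi) x).
  by apply: eq_integral => x _; rewrite /= /phi scaleN1r addr0.
rewrite -[LHS](@ge0_integral_pushforward _ _ _ _ R phi mphi _ setT f)//.
apply: eq_measure_integral => A mA _; rewrite /pushforward.
apply: eq_trans (lebesgue_rV_affine 0 _ mA) _; first by rewrite oppr_eq0 oner_eq0.
by rewrite normrN1 invr1 expr1n mul1e.
Qed.

Lemma Rintegral_rV_opp n (f : V n -> R) : measurable_fun setT f ->
  (\int[lebesgue_rV n]_x f (- x) = \int[lebesgue_rV n]_x f x)%R.
Proof.
move=> mf; rewrite /Rintegral; congr fine.
rewrite [LHS]integralE [RHS]integralE; congr (_ - _).
- rewrite -[RHS]ge0_integral_rV_opp//; last exact/measurable_funepos/measurable_EFinP.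
  by apply: eq_integral => x _; rewrite !funeposE.
- rewrite -[RHS]ge0_integral_rV_opp//; last exact/measurable_funeneg/measurable_EFinP.
  by apply: eq_integral => x _; rewrite !funenegE.
Qed.

End affine_measure.

(** * The Euclidean norm and radial null sets *)

Section euclid.
Context {R : realType} {n : nat}.
Local Notation V := 'rV[R]_n.
Implicit Types x y z : V.

Lemma dotp_ge0 x : 0 <= dotp x x.
Proof. by apply: sumr_ge0 => i _; rewrite -expr2 sqr_ge0. Qed.

Lemma enorm_ge0 x : 0 <= enorm x.
Proof. exact: sqrtr_ge0. Qed.

Lemma enorm_sqr x : enorm x ^+ 2 = dotp x x.
Proof. by rewrite sqr_sqrtr// dotp_ge0. Qed.

Lemma enormZ (c : R) x : enorm (c *: x) = `|c| * enorm x.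
Proof.
rewrite /enorm (_ : dotp _ _ = c ^+ 2 * dotp x x); last first.
  by rewrite /dotp mulr_sumr; apply: eq_bigr => i _; rewrite !mxE; ring.
by rewrite sqrtrM ?sqr_ge0// sqrtr_sqr.
Qed.

Lemma enormN x : enorm (- x) = enorm x.
Proof. by rewrite -scaleN1r enormZ normrN1 mul1r. Qed.

Lemma enorm0 : enorm (0 : V) = 0.
Proof. by rewrite -(scale0r 0) enormZ normr0 mul0r. Qed.

Lemma coord_le_enorm x i : `|x ord0 i| <= enorm x.
Proof.
rewrite -sqrtr_sqr ler_sqrt ?dotp_ge0// /dotp (bigD1 i)//= -expr2 lerDl.
by apply: sumr_ge0 => j _; rewrite -expr2 sqr_ge0.
Qed.

Lemma enorm_eq0 x : enorm x = 0 -> x = 0.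
Proof.
move=> x0; apply/rowP => i; rewrite mxE; apply/eqP.
by rewrite -normr_eq0 eq_le normr_ge0 andbT -x0 coord_le_enorm.
Qed.

Lemma enorm_gt0 x : x != 0 -> 0 < enorm x.
Proof.
by move=> x0; rewrite lt_neqAle enorm_ge0 andbT eq_sym; apply: contra_neq x0; exact: enorm_eq0.
Qed.

Lemma enorm_le_sum x : enorm x <= \sum_i `|x ord0 i|.
Proof.
have S0 : 0 <= \sum_i `|x ord0 i| by exact: sumr_ge0.
rewrite -(ger0_norm S0) -sqrtr_sqr ler_sqrt ?sqr_ge0// expr2 mulr_suml.
apply: ler_sum => i _; rewrite (le_trans (ler_norm _))// normrM ler_wpM2l//.
by rewrite (bigD1 i)//= lerDl sumr_ge0.
Qed.

Lemma cauchy_schwarz x y : dotp x y <= enorm x * enorm y.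
Proof.
have [->|x0] := eqVneq x 0.
  by rewrite enorm0 mul0r /dotp big1// => i _; rewrite mxE mul0r.
have ex := enorm_gt0 x0.
have : 0 <= dotp (dotp x y *: x - dotp x x *: y) (dotp x y *: x - dotp x x *: y).
  exact: dotp_ge0.
have -> : dotp (dotp x y *: x - dotp x x *: y) (dotp x y *: x - dotp x x *: y) =
    dotp x x * (dotp x x * dotp y y - dotp x y ^+ 2).
  have H (a b : R) : dotp (a *: x - b *: y) (a *: x - b *: y) =
      a ^+ 2 * dotp x x - a * b * dotp x y *+ 2 + b ^+ 2 * dotp y y.
    rewrite /dotp !mulr_sumr -sumrMnl -sumrB -big_split/=.
    by apply: eq_bigr => i _; rewrite !mxE; ring.
  by rewrite H; ring.
rewrite -!enorm_sqr pmulr_rge0 ?exprn_gt0// subr_ge0 -exprMn => h.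
rewrite (le_trans (ler_norm _))// -ler_sqr ?nnegrE ?mulr_ge0 ?enorm_ge0//.
by rewrite real_normK ?num_real.
Qed.

Lemma enorm_triangle x y : enorm (x + y) <= enorm x + enorm y.
Proof.
have h : 0 <= enorm x + enorm y by rewrite addr_ge0 ?enorm_ge0.
rewrite -(ger0_norm h) -sqrtr_sqr ler_sqrt ?sqr_ge0// sqrrD !enorm_sqr.
have -> : dotp (x + y) (x + y) = dotp x x + dotp x y *+ 2 + dotp y y.
  rewrite /dotp -sumrMnl -!big_split/=.
  by apply: eq_bigr => i _; rewrite !mxE; ring.
by rewrite lerD2r lerD2l lerMn2r/= cauchy_schwarz.
Qed.

Lemma measurable_enorm d (T : measurableType d) (f : T -> V) :
  (forall i, measurable_fun setT (fun t => f t ord0 i)) ->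
  measurable_fun setT (fun t => enorm (f t)).
Proof.
move=> mf; have ms : measurable_fun setT (@Num.sqrt R).
  by apply: continuous_measurable_fun; exact: sqrt_continuous.
apply: (measurableT_comp ms).
by apply: measurable_sum => i; exact: measurable_funM.
Qed.

(** Polar coordinates are avoided by averaging over dilations: for fixed
    [z <> 0] the set of [t] in [[1, 2]] with [t |z|] in a null set [N] is null, so
    by Fubini almost every dilate of [{z : |z| in N}] is null; as all dilates
    have comparable measure, the set itself is null. *)
Lemma ae_enorm (P : R -> Prop) :
  {ae lebesgue_measure, forall r : R, 0 < r -> P r} ->
  {ae lebesgue_rV n, forall z : V, z != 0 -> P (enorm z)}.
Proof.
move=> [N0 [mN0 N00 PN0]].
pose N := N0 `&` `]0, +oo[%classic.
have mN : measurable N by exact: measurableI.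
have N00' : lebesgue_measure N = 0%E.
  by apply: (subset_measure0 mN mN0 _ N00); exact: subIsetl.
have me d (T : measurableType d) (f : T -> V) :
    (forall i, measurable_fun setT (fun t => f t ord0 i)) ->
    measurable ((fun t => enorm (f t)) @^-1` N).
  by move=> mf; rewrite -[X in measurable X]setTI; exact: measurable_enorm.
pose B := (fun z : V => enorm z) @^-1` N.
have mB : measurable B by apply: me => i; exact: measurable_coord_rV.
suff B0 : lebesgue_rV n B = 0%E.
  exists B; split => // z /= /not_implyP[z0 nP]; split.
    by apply: PN0 => /= H; apply: nP; apply: H; exact: enorm_gt0.
  by rewrite /= in_itv/= enorm_gt0.
pose E := [set p : R * V | 1 <= p.1 <= 2 /\ N (p.1 * enorm p.2)].
have mE : measurable E.
  rewrite (_ : E = (fst @^-1` `[1, 2]%classic) `&`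
      ((fun p : R * V => p.1 * enorm p.2) @^-1` N)); last first.
    by apply/seteqP; split => [p []|p []] /=; rewrite in_itv.
  have mf : measurable_fun setT (fun p : R * V => p.1 * enorm p.2).
    apply: measurable_funM; first exact: measurable_fst.
    apply: measurable_enorm => i.
    exact: (measurableT_comp (measurable_coord_rV i) measurable_snd).
  apply: measurableI; rewrite -[X in measurable X]setTI; last exact: mf.
  exact: (@measurable_fst _ _ R V).
have := @indic_fubini_tonelli _ _ _ _ R lebesgue_measure (lebesgue_rV n) E mE.
rewrite indic_fubini_tonelli_FE// indic_fubini_tonelli_GE//.
rewrite [RHS]integral0_eq => [|z _ /=]; last first.
  have [->|z0] := eqVneq z 0.
    rewrite (_ : ysection _ _ = set0) ?measure0//.
    by apply/seteqP; split => // t; rewrite /ysection/= inE /E/= enorm0 mulr0 => -[_ [_]];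
      rewrite /= in_itv/= ltxx.
  have z0' : enorm z != 0 by rewrite gt_eqF// enorm_gt0.
  have mpre : measurable ((fun t => enorm z * t + 0) @^-1` N).
    have maff : measurable_fun setT (fun t : R => enorm z * t + 0).
      by apply: measurable_funD => //; exact: measurable_funM.
    by rewrite -[X in measurable X]setTI; exact: maff.
  have z1 := lebesgue_measure_affine 0 z0' mN; rewrite N00' mule0 in z1.
  apply/eqP; rewrite eq_le measure_ge0 andbT -z1; apply: le_measure; rewrite ?inE//.
    exact: measurable_ysection.
  by move=> t; rewrite /ysection/= inE /E/= addr0 mulrC => -[].
move=> F0; apply/eqP; rewrite eq_le measure_ge0 andbT; apply/lee_addgt0Pr => e e0.
rewrite add0e; apply: le_trans (_ : 0 <= _)%E; last by rewrite lee_fin ltW.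
have : ((2^-1 ^+ n)%:E * lebesgue_rV n B <= 0)%E.
  rewrite -F0.
  apply: (@le_trans _ _ (\int[lebesgue_measure]_(t in `[1%R, 2%R])
     (lebesgue_rV n \o xsection E) t)%E); last first.
    apply: ge0_subset_integral => //; first by apply: measurable_fun_xsection.
  apply: (@le_trans _ _ (\int[lebesgue_measure]_(t in `[1%R, 2%R])
     (cst ((2^-1 ^+ n)%:E * lebesgue_rV n B) t))%E); last first.
    apply: ge0_le_integral => //.
    - by move=> t _; rewrite mule_ge0// lee_fin exprn_ge0.
    - apply: measurable_funTS; exact: measurable_fun_xsection.
    move=> t /=; rewrite in_itv/= => /andP[t1 t2].
    have t0 : 0 < t by exact: lt_le_trans t1.
    rewrite (_ : xsection E t = ((fun x => t *: x + 0) @^-1` B)); last first.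
      apply/seteqP; split => z; rewrite /xsection/= inE /E /B/= addr0 enormZ gtr0_norm//.
        by case.
      by rewrite t1 t2.
    rewrite lebesgue_rV_affine ?gt_eqF//.
    apply: lee_wpmul2r => //; rewrite lee_fin lerXn2r ?nnegrE ?invr_ge0//.
    by rewrite gtr0_norm// lef_pV2 ?posrE.
  rewrite integral_cst//= lebesgue_measure_itv/= lte_fin ltr1n/= -EFinB.
  by rewrite (_ : 2 - 1 = 1 :> R) ?mule1//; lra.
by rewrite pmule_rle0 ?lte_fin ?exprn_gt0 ?invr_gt0.
Qed.

End euclid.

(** * Cosine integrals *)

Section cosine_integrals.
Context {R : realType}.
Local Notation leb := (@lebesgue_measure R).

(** The one-dimensional Levy density of order [b], for which [cos_moment b] is a
    multiple of [|s|^b]. *)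
Definition frac_weight (b t : R) : R := if 0 < t then t `^ (- (1 + b)) else 0.

Definition cos_moment (b s : R) : R :=
  \int[leb]_t ((1 - cos (s * t)) * frac_weight b t).

Lemma frac_weight_ge0 b t : 0 <= frac_weight b t.
Proof. by rewrite /frac_weight; case: ifP => // _; exact: powR_ge0. Qed.

Lemma measurable_frac_weight b : measurable_fun setT (frac_weight b).
Proof.
apply: measurable_fun_ifT => //; exact: measurable_fun_ltr.
Qed.

Lemma measurable_cosM (s : R) : measurable_fun setT (fun t : R => cos (s * t)).
Proof.
have mc : measurable_fun setT (@cos R).
  by apply: continuous_measurable_fun; exact: continuous_cos.
by apply: (measurableT_comp mc); exact: measurable_funM.
Qed.

Lemma one_sub_cos_ge0 (x : R) : 0 <= 1 - cos x.
Proof. by rewrite subr_ge0 cos_le1. Qed.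

Lemma one_sub_cos_le2 (x : R) : 1 - cos x <= 2.
Proof. by have := cos_geN1 x; lra. Qed.

Lemma normr_sin_le (x : R) : `|sin x| <= `|x|.
Proof.
wlog x0 : x / 0 <= x.
  move=> H; have [/H//|/ltW xn] := leP 0 x.
  by rewrite -normrN -sinN -[leRHS]normrN H// oppr_ge0.
have [|c _] := @MVT_segment R (@sin R) (@cos R) 0 x x0.
  by apply: continuous_subspaceT; exact: continuous_sin.
rewrite sin0 !subr0 => ->.
by rewrite normrM ler_piMl// cos_max.
Qed.

Lemma one_sub_cos_le_sqr (x : R) : 1 - cos x <= x ^+ 2.
Proof.
have -> : x = (x / 2) *+ 2 by rewrite -mulr_natr divfK.
set y := x / 2.
have := normr_sin_le y; rewrite -ler_sqr ?nnegrE// !real_normK ?num_real// => h.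
rewrite cos_mulr2n cos2sin2 -[y *+ 2]mulr_natr exprMn.
have : 0 <= y ^+ 2 by rewrite sqr_ge0.
by move: h; rewrite !mulr2n; lra.
Qed.

Lemma cvgy_powRN (b : R) : 0 < b -> (1 + t) `^ (- b) @[t --> +oo] --> (0 : R).
Proof.
move=> b0; apply/cvgrPdist_le => e e0; near=> t.
have t1 : e `^ (- b^-1) <= 1 + t.
  by rewrite (@le_trans _ _ t) ?lerDr//; near: t; apply: nbhs_pinfty_ge; rewrite num_real.
have e1 : 0 < e `^ (- b^-1) by rewrite powR_gt0.
have t0 : 0 < 1 + t by exact: lt_le_trans t1.
rewrite sub0r normrN ger0_norm ?powR_ge0//.
have := ge0_ler_powR (ltW b0) (ltW e1 : _ \in Num.nneg) (ltW t0 : _ \in Num.nneg) t1.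
rewrite -powRrM mulNr mulVf ?gt_eqF// powR_inv1 ?(ltW e0)//.
move=> h; rewrite [leLHS]powRN -[leRHS]invrK lef_pV2 ?posrE ?invr_gt0//.
by rewrite powR_gt0.
Unshelve. all: by end_near. Qed.

(** A dominating function for the tails at infinity which is bounded at the
    origin; it has an explicit primitive. *)
Lemma integrable_shifted_powR (b : R) : 0 < b ->
  leb.-integrable setT (EFin \o (fun t => if 0 < t then (1 + t) `^ (- (1 + b)) else 0)).
Proof.
move=> b0; pose F t : R := - b^-1 * (1 + t) `^ (- b).
have dp (c t : R) : 0 <= t ->
    is_derive t 1 (fun t => (1 + t) `^ c) (c * (1 + t) `^ (c - 1) * 1).
  move=> t0; have t1 : 0 < 1 + t by lra.
  have h1 : is_derive t (1 : R) (fun t => 1 + t) 1.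
    rewrite -[X in is_derive _ _ _ X]add0r.
    exact: (is_deriveD (is_derive_cst (1 : R) t 1) (is_derive_id t 1)).
  have h2 := @is_derive1_powR R c (1 + t) t1.
  exact: (@is_derive1_comp R (fun u : R => u `^ c) (fun t : R => 1 + t) t _ _ h2 h1).
have dF (t : R) : 0 <= t -> is_derive t 1 F ((1 + t) `^ (- (1 + b))).
  move=> t0; have h3 := is_deriveZ (- b^-1) (dp (- b) _ t0).
  have -> : (1 + t) `^ (- (1 + b)) =
      - b^-1 *: (- b * (1 + t) `^ (- b - 1) * 1).
    rewrite mulr1 /GRing.scale/= mulrA mulrNN mulVf ?gt_eqF// mul1r.
    by congr (_ `^ _); ring.
  exact: h3.
have cF t : 0 <= t -> {for t, continuous F}.
  by move=> t0; apply/differentiable_continuous/derivable1_diffP; have [] := dF _ t0.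
have cf t : 0 <= t -> {for t, continuous (fun t : R => (1 + t) `^ (- (1 + b)))}.
  by move=> t0; apply/differentiable_continuous/derivable1_diffP; have [] := dp (- (1 + b)) _ t0.
have E : (\int[leb]_(t in `[0%R, +oo[) ((1 + t) `^ (- (1 + b)))%:E =
    (- b^-1 * 0)%:E - (F 0)%:E)%E.
  apply: ge0_continuous_FTC2y.
  - by move=> *; exact: powR_ge0.
  - apply/continuous_within_itvcyP; split.
      by move=> x; rewrite in_itv/= andbT => /ltW; exact: cf.
    by apply: cvg_at_right_filter; exact: cf.
  - by apply: cvgM; [exact: cvg_cst|exact: cvgy_powRN].
  - by move=> x /ltW x0; have [] := dF _ x0.
  - by apply: cvg_at_right_filter; exact: cF.
  - by move=> x; rewrite in_itv/= andbT => /ltW x0; rewrite derive1E; have [_] := dF _ x0.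
apply/integrableP; split.
  apply/measurable_EFinP; apply: measurable_fun_ifT => //.
    exact: measurable_fun_ltr.
  have mp : measurable_fun setT (fun u : R => u `^ (- (1 + b))) by exact: measurable_powR.
  by apply: (measurableT_comp mp); exact: measurable_funD.
apply: (@le_lt_trans _ _ (\int[leb]_(x in `[0%R, +oo[) ((1 + x) `^ (- (1 + b)))%:E)%E); last first.
  by rewrite E ltry.
rewrite [leRHS]integral_mkcond; apply: ge0_le_integral => //.
- apply/measurable_EFinP; apply: measurableT_comp => //.
  apply: measurable_fun_ifT => //; first exact: measurable_fun_ltr.
  have mp : measurable_fun setT (fun u : R => u `^ (- (1 + b))) by exact: measurable_powR.
  by apply: (measurableT_comp mp); exact: measurable_funD.
- apply/(measurable_restrictT _ _).1 => //; apply: measurable_funTS.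
  apply/measurable_EFinP.
  have mp : measurable_fun setT (fun u : R => u `^ (- (1 + b))) by exact: measurable_powR.
  by apply: (measurableT_comp mp); exact: measurable_funD.
move=> t _ /=; rewrite patchE; case: (boolP (t \in _)) => [_|].
  by case: ifP => _ /=; rewrite lee_fin ?normr0 ?powR_ge0// ger0_norm ?powR_ge0.
rewrite notin_setE/= in_itv/= andbT => /negP; rewrite -ltNge => t0.
by rewrite ltNge (ltW t0)/= normr0.
Qed.

(** Near the origin [1 - cos (s t) <= s^2 t^2] compensates the singularity of
    the weight, away from it [1 - cos <= 2]. *)
Lemma integrable_cos_moment b s : 0 < b <= 1 ->
  leb.-integrable setT (EFin \o (fun t => (1 - cos (s * t)) * frac_weight b t)).
Proof.
move=> /andP[b0 b1].
have ig := integrableZ (2 `^ (1 + b) * (2 + s ^+ 2)) (integrable_shifted_powR b0).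
apply: (integrable_le _ ig).
  apply: measurable_funM; last exact: measurable_frac_weight.
  by apply: measurable_funB => //; exact: measurable_cosM.
move=> t; rewrite /frac_weight; case: ifPn => t0; last by rewrite !mulr0 normr0.
rewrite ger0_norm ?mulr_ge0 ?one_sub_cos_ge0 ?powR_ge0//.
have t1 : 0 < 1 + t by lra.
have p2 : (2 : R) `^ (1 + b) * (1 + t) `^ (- (1 + b)) = ((1 + t) / 2) `^ (- (1 + b)).
  rewrite powRM ?invr_ge0// ?(ltW t1)// mulrC; congr (_ * _).
  by rewrite -(@powR_inv1 R 2)// -powRrM mulN1r opprK.
rewrite [leRHS](_ : _ = ((1 + t) / 2) `^ (- (1 + b)) * (2 + s ^+ 2)); last first.
  by rewrite -p2 /=; ring.
rewrite [leLHS]mulrC.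
have nn (x : R) : 0 < x -> x \in Num.nneg by move=> /ltW.
have h2 : 0 < (1 + t) / 2 by rewrite divr_gt0.
have Npow (x y : R) : 0 < x -> x <= y -> y `^ (- (1 + b)) <= x `^ (- (1 + b)).
  move=> x0 xy; have y0 := lt_le_trans x0 xy.
  rewrite !powRN lef_pV2 ?posrE ?powR_gt0//.
  by apply: ge0_ler_powR => //; [lra|exact: nn|exact: nn].
have [tle|tgt] := leP t 1; last first.
  apply: ler_pM; rewrite ?powR_ge0 ?one_sub_cos_ge0//.
    by apply: Npow => //; lra.
  by rewrite (le_trans (one_sub_cos_le2 _))// lerDl sqr_ge0.
apply: (@le_trans _ _ (s ^+ 2)).
  apply: (@le_trans _ _ (t `^ (- (1 + b)) * (s ^+ 2 * t ^+ 2))).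
    by rewrite ler_wpM2l ?powR_ge0// -exprMn one_sub_cos_le_sqr.
  rewrite mulrCA ler_piMr ?sqr_ge0// -powR_mulrn ?(ltW t0)// -powRD ?(gt_eqF t0) ?implybT//.
  rewrite -[leRHS](@powRr0 R t); apply: ger_powR; first by rewrite t0.
  by lra.
rewrite -[leLHS]mul1r; apply: ler_pM => //; rewrite ?sqr_ge0//; last by lra.
apply: (@le_trans _ _ (1 `^ (- (1 + b)))); first by rewrite powR1.
by apply: Npow => //; lra.
Qed.

Lemma cos_moment0 b : cos_moment b 0 = 0.
Proof.
rewrite /cos_moment /Rintegral integral0_eq// => t _.
by rewrite mul0r cos0 subrr mul0r.
Qed.

Lemma cos_momentN b s : cos_moment b (- s) = cos_moment b s.
Proof. by apply: eq_Rintegral => t _; rewrite mulNr cosN. Qed.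

(** Homogeneity, by the substitution [t -> s t]. *)
Lemma cos_momentE b s : 0 < b <= 1 -> cos_moment b s = cos_moment b 1 * `|s| `^ b.
Proof.
move=> /andP[b0 b1].
have [->|s0] := eqVneq s 0.
  by rewrite cos_moment0 normr0 powR0 ?gt_eqF// mulr0.
wlog sp : s s0 / 0 < s.
  move=> H; have [|sn] := ltP 0 s; first exact: H.
  by rewrite -cos_momentN -normrN H ?oppr_eq0// oppr_gt0 lt_neqAle s0.
rewrite gtr0_norm//.
pose f (t : R) : \bar R := ((1 - cos (1 * t)) * frac_weight b t)%:E.
have mf : measurable_fun setT f.
  apply/measurable_EFinP/measurable_funM; last exact: measurable_frac_weight.
  by apply: measurable_funB => //; exact: measurable_cosM.
have f0 t : (0 <= f t)%E.
  by rewrite lee_fin mulr_ge0 ?one_sub_cos_ge0 ?frac_weight_ge0.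
have h := ge0_integral_affine 0 s0 mf f0.
have E t : f (s * t + 0) = ((s `^ (- (1 + b)))%:E * ((1 - cos (s * t)) * frac_weight b t)%:E)%E.
  rewrite /f addr0 mul1r -EFinM /frac_weight pmulr_rgt0//; congr EFin.
  by case: ifPn => t0; rewrite ?mulr0// powRM ?(ltW sp) ?(ltW t0)//; ring.
have h1 : cos_moment b s * s `^ (- (1 + b)) = s^-1 * cos_moment b 1.
  have i1 := integrable_cos_moment 1 (introT andP (conj b0 b1)).
  have is_ := integrable_cos_moment s (introT andP (conj b0 b1)).
  apply: EFin_inj; rewrite EFinM [in RHS]EFinM /cos_moment -!int_fin//.
  rewrite -[in s^-1](gtr0_norm sp) -h muleC -ge0_integralZl_EFin ?powR_ge0//.
  - by apply: eq_integral => t _; rewrite E.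
  - by move=> t _; rewrite lee_fin mulr_ge0 ?one_sub_cos_ge0 ?frac_weight_ge0.
  - exact: measurable_int is_.
have : cos_moment b s * s `^ (- (1 + b)) * s `^ (1 + b) = s^-1 * cos_moment b 1 * s `^ (1 + b).
  by rewrite h1.
rewrite -mulrA -powRD ?(gt_eqF sp) ?implybT// addNr powRr0 mulr1 => ->.
rewrite powRD ?(gt_eqF sp) ?implybT// powRr1 ?ltW//.
by field; rewrite gt_eqF.
Qed.

(** The integrand is positive on [(0, 1)]. *)
Lemma cos_moment_gt0 b : 0 < b <= 1 -> 0 < cos_moment b 1.
Proof.
move=> b01; have ib := integrable_cos_moment 1 b01.
rewrite lt_neqAle; apply/andP; split; last first.
  by apply: Rintegral_ge0 => t _; rewrite mulr_ge0 ?one_sub_cos_ge0 ?frac_weight_ge0.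
apply/negP => /eqP E.
have : (\int[leb]_t `|((1 - cos (1 * t)) * frac_weight b t)%:E| = 0)%E.
  rewrite -[RHS]/((0:R)%:E) E -int_fin//; apply: eq_integral => t _.
  by rewrite gee0_abs// lee_fin mulr_ge0 ?one_sub_cos_ge0 ?frac_weight_ge0.
move/ae_eq_integral_abs => /(_ measurableT (measurable_int _ ib)).
case=> N [mN N0 sub].
suff : (1%:E <= leb N)%E by rewrite N0 lee_fin ler10.
have -> : 1%:E = leb (`]0%R, 1%R[%classic : set R).
  by rewrite lebesgue_measure_itv/= lte_fin ltr01 -EFinB subr0.
apply: le_measure; rewrite ?inE// => t /=; rewrite in_itv/= => /andP[t0 t1].
apply: sub => /= /(_ I) []; apply/eqP.
rewrite mulf_eq0 /frac_weight t0 (gt_eqF (powR_gt0 _ t0)) orbF mul1r subr_eq0; apply/negP => /eqP c1.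
have := cos2Dsin2 t; rewrite -c1 expr1n => /eqP; rewrite -subr_eq0 addrC addKr sqrf_eq0.
by rewrite gt_eqF// sin2_gt0// t0/=; lra.
Qed.

Let cos_prod (A B : R) : (1 - cos A) * (1 - cos B) =
  (1 - cos A) + (1 - cos B) - 2^-1 * (1 - cos (A + B)) - 2^-1 * (1 - cos (A - B)).
Proof. by rewrite cosD cosB; field. Qed.

Lemma integrable_cos_prod b s a : 0 < b <= 1 -> leb.-integrable setT
  (EFin \o (fun t => (1 - cos (s * t)) * ((1 - cos (a * t)) * frac_weight b t))).
Proof.
move=> b01; apply: (integrable_bdMl (C := 2)).
- by apply: measurable_funB => //; exact: measurable_cosM.
- by move=> t; rewrite ger0_norm ?one_sub_cos_ge0 ?one_sub_cos_le2.
- exact: integrable_cos_moment.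
Qed.

(** Expanding the product of the two cosines into cosines of sum and
    difference leaves only integrals of the form [cos_moment]. *)
Lemma int_cos_prod b s a : 0 < b <= 1 ->
  \int[leb]_t ((1 - cos (s * t)) * ((1 - cos (a * t)) * frac_weight b t)) =
  cos_moment b 1 *
  (`|s| `^ b + `|a| `^ b - 2^-1 * `|s + a| `^ b - 2^-1 * `|s - a| `^ b).
Proof.
move=> b01; have ib r := integrable_cos_moment r b01.
transitivity (\int[leb]_t (((1 - cos (s * t)) * frac_weight b t
  + (1 - cos (a * t)) * frac_weight b t)
  - (2^-1 * ((1 - cos ((s + a) * t)) * frac_weight b t)
  + 2^-1 * ((1 - cos ((s - a) * t)) * frac_weight b t)))).
  by apply: eq_Rintegral => t _; rewrite mulrA cos_prod [(s + a) * t]mulrDl [(s - a) * t]mulrBl; field.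
rewrite RintegralB//; last 2 first.
- exact: integrable_add.
- by apply: integrable_add; exact: integrableZ.
rewrite !RintegralD//; try exact: integrableZ.
rewrite !RintegralZl// -!/(cos_moment b _).
rewrite (cos_momentE s b01) (cos_momentE a b01) (cos_momentE (s + a) b01) (cos_momentE (s - a) b01).
by ring.
Qed.

(** The case [b = 1] represents [min(|s|, a)], up to a constant, as an
    absolutely convergent superposition of the functions [1 - cos (s t)]: these
    are what a fractional Laplacian known only through its Fourier transform can
    be tested against. *)
Lemma int_cos_prod1 s a : 0 < a ->
  \int[leb]_t ((1 - cos (s * t)) * ((1 - cos (a * t)) * frac_weight 1 t)) =
  cos_moment 1 1 * Num.min `|s| a.
Proof.
move=> a0; rewrite int_cos_prod ?ltr01 ?lexx// !powRr1//; congr (_ * _).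
rewrite (gtr0_norm a0).
by case: (ler0P s) => ?; case: (ler0P (s + a)) => ?; case: (ler0P (s - a)) => ?;
  rewrite /Num.min; case: ifPn; lra.
Qed.

Lemma int_cos_one_sub_cos b s a : 0 < b <= 1 -> 
  \int[leb]_t (cos (s * t) * ((1 - cos (a * t)) * frac_weight b t)) =
  cos_moment b 1 *
  (2^-1 * `|s + a| `^ b + 2^-1 * `|s - a| `^ b - `|s| `^ b).
Proof.
move=> b01.
transitivity (\int[leb]_t ((1 - cos (a * t)) * frac_weight b t -
  (1 - cos (s * t)) * ((1 - cos (a * t)) * frac_weight b t))).
  by apply: eq_Rintegral => t _; ring.
rewrite RintegralB//; [|exact: integrable_cos_moment|exact: integrable_cos_prod].
rewrite int_cos_prod// -/(cos_moment b a) (cos_momentE a b01); ring.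
Qed.

End cosine_integrals.

(** * The fractional Laplacian against a truncated coordinate *)

Section fractional_laplacian.
Context {R : realType} {d : nat}.
Local Notation V := 'rV[R]_d.
Local Notation leb := (@lebesgue_measure R).
Local Notation mu := (@lebesgue_rV R d).
Variable alpha : R.
Hypothesis alpha01 : 0 < alpha < 1.

Let b01 : 0 < 1 - alpha <= 1.
Proof. by case/andP: alpha01 => *; lra. Qed.

Let one01 : 0 < (1 : R) <= 1.
Proof. by rewrite ltr01 lexx. Qed.

(** The Fourier multiplier turns the weight [t^(-2)] of [min(|s|, a)] into
    [t^(alpha - 2)], that is, exponent [1] into exponent [1 - alpha]. *)
Definition frac_const : R := cos_moment (1 - alpha) 1 / @cos_moment R 1 1.

(** [- (-Delta)^(alpha/2)] of [s |-> min(|s|, a)]. *)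
Definition frac_min (a s : R) : R := frac_const *
  (2^-1 * `|s + a| `^ (1 - alpha) + 2^-1 * `|s - a| `^ (1 - alpha)
   - `|s| `^ (1 - alpha)).

Lemma frac_const_gt0 : 0 < frac_const.
Proof. by rewrite divr_gt0// cos_moment_gt0. Qed.

Lemma frac_minE a s : @cos_moment R 1 1 * frac_min a s =
  \int[leb]_t (cos (s * t) * ((1 - cos (a * t)) * frac_weight (1 - alpha) t)).
Proof.
rewrite int_cos_one_sub_cos// /frac_min /frac_const mulrA [_ * (_ / _)]mulrC divfK//.
by rewrite gt_eqF// cos_moment_gt0.
Qed.

Lemma measurable_frac_min a : measurable_fun setT (frac_min a).
Proof.
have mp : measurable_fun setT (fun u : R => `|u| `^ (1 - alpha)).
  by apply: (measurableT_comp (measurable_powR (1 - alpha))); exact: normr_measurable.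
apply: measurable_funM => //; apply: measurable_funB => //.
apply: measurable_funD; apply: measurable_funM => //; apply: (measurableT_comp mp).
  exact: measurable_funD.
exact: measurable_funB.
Qed.

(** In the integral representation [cos (s t)] is bounded by [1], its value at
    [s = 0]: the largest value is taken at the origin. *)
Lemma normr_frac_min_le a s : 0 < a ->
  `|frac_min a s| <= frac_const * a `^ (1 - alpha).
Proof.
move=> a0; have c0 := cos_moment_gt0 one01.
rewrite -(ler_pM2l c0) -{1}(gtr0_norm c0) -normrM frac_minE.
rewrite mulrA [X in X * _](_ : _ = cos_moment (1 - alpha) 1); last first.
  by rewrite /frac_const mulrCA mulfV ?mulr1// gt_eqF.
rewrite -{2}(gtr0_norm a0) -(cos_momentE _ b01).
apply: int_norm_le.
- apply: measurable_funM; first exact: measurable_cosM.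
  apply: measurable_funM; last exact: measurable_frac_weight.
  by apply: measurable_funB => //; exact: measurable_cosM.
- exact: integrable_cos_moment.
move=> t; rewrite normrM [X in _ * X]ger0_norm; last first.
  by rewrite mulr_ge0 ?one_sub_cos_ge0 ?frac_weight_ge0.
by rewrite ler_piMl ?cos_max// mulr_ge0 ?one_sub_cos_ge0 ?frac_weight_ge0.
Qed.

(** The Fourier transform along the [i]-th axis. *)
Lemma fraclap_coord f g (i : 'I_d) (t : R) : is_fraclap alpha f g ->
  \int[mu]_x (g x * cos (x ord0 i * t)) =
  `|t| `^ alpha * \int[mu]_x (f x * cos (x ord0 i * t)).
Proof.
move=> [_ /(_ (t *: delta_mx ord0 i))]; rewrite /fourier.
have dE (x : V) : dotp x (t *: delta_mx ord0 i) = x ord0 i * t.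
  rewrite /dotp (bigD1 i)//= big1 ?addr0 => [|j ji]; first by rewrite !mxE !eqxx mulr1.
  by rewrite !mxE (negbTE ji) andbF !mulr0.
have -> : enorm (t *: delta_mx ord0 i : V) = `|t|.
  by rewrite /enorm dE !mxE !eqxx mulr1 -expr2 sqrtr_sqr.
have E h (c : R -> R) : \int[mu]_x (h x * c (dotp x (t *: delta_mx ord0 i))) =
    \int[mu]_x (h x * c (x ord0 i * t)).
  by apply: eq_Rintegral => x _; rewrite dE.
rewrite !(E _ (@cos R)) !(E _ (@sin R)).
by move=> [+ _]; rewrite mul0r subr0.
Qed.

(** Self-adjointness of the fractional Laplacian, tested on the non-smooth and
    non-decaying function [min(|x_i|, a)]: represent it by cosines, exchange the
    integrals, and apply the multiplier frequency by frequency. *)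
Lemma int_fraclap_min f g (i : 'I_d) (a : R) : L1 f -> is_fraclap alpha f g ->
  0 < a ->
  \int[mu]_x (Num.min `|x ord0 i| a * g x) =
  - \int[mu]_x (frac_min a (x ord0 i) * f x).
Proof.
move=> Lf fg a0; have [Lg _] := fg.
have c0 := cos_moment_gt0 one01.
have [alpha0 alpha1] := andP alpha01.
pose N b t := (1 - cos (a * t)) * frac_weight b t.
have iN b : 0 < b <= 1 -> leb.-integrable setT (EFin \o N b).
  by move=> b01'; exact: integrable_cos_moment.
have mx : measurable_fun setT (fun z : V * R => z.1 ord0 i * z.2).
  apply: measurable_funM; last exact: measurable_snd.
  exact: (measurableT_comp (measurable_coord_rV i) measurable_fst).
have mcos : measurable_fun setT (fun z : V * R => cos (z.1 ord0 i * z.2)).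
  have mc : measurable_fun setT (@cos R).
    by apply: continuous_measurable_fun; exact: continuous_cos.
  exact: (measurableT_comp mc mx).
have int_g0 : \int[mu]_x g x = 0.
  have := fraclap_coord i 0 fg; rewrite normr0 powR0 ?gt_eqF// mul0r => <-.
  by apply: eq_Rintegral => x _; rewrite mulr0 cos0 mulr1.
have icos t : mu.-integrable setT (EFin \o (fun x : V => g x * cos (x ord0 i * t))).
  rewrite (_ : (fun x => _) = (fun x : V => cos (x ord0 i * t) * g x)); last first.
    by apply/funext => x; rewrite mulrC.
  apply: (integrable_bdMl (C := 1)) => // [|x]; last exact: cos_max.
  have mc : measurable_fun setT (@cos R).
    by apply: continuous_measurable_fun; exact: continuous_cos.
  apply: (measurableT_comp mc); apply: measurable_funM => //.
  exact: measurable_coord_rV.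
have S1 : @cos_moment R 1 1 * \int[mu]_x (Num.min `|x ord0 i| a * g x) =
    \int[mu]_x \int[leb]_t ((1 - cos (x ord0 i * t)) * (g x * N 1 t)).
  rewrite -RintegralZl//; last first.
    apply: (integrable_bdMl (C := a)) => // [|x].
      apply: measurable_minr => //.
      by apply: measurableT_comp => //; exact: measurable_coord_rV.
    by rewrite ger0_norm ?ge_min ?lexx ?orbT// le_min normr_ge0 ltW.
  apply: eq_Rintegral => x _.
  rewrite mulrA -int_cos_prod1// mulrC -RintegralZl//; last exact: integrable_cos_prod.
  by apply: eq_Rintegral => t _; rewrite mulrCA.
have Lf' : L1 (fun x => - f x).
  rewrite (_ : (fun x => - f x) = (fun x => -1 * f x)); first exact: integrableZ.
  by apply/funext => x; rewrite mulN1r.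
have S2 : @cos_moment R 1 1 * (- \int[mu]_x (frac_min a (x ord0 i) * f x)) =
    \int[mu]_x \int[leb]_t (cos (x ord0 i * t) * (- f x * N (1 - alpha) t)).
  have im : L1 (fun x : V => frac_min a (x ord0 i) * f x).
    apply: (integrable_bdMl (C := frac_const * a `^ (1 - alpha))) => // [|x].
      apply: (measurableT_comp (measurable_frac_min a)); exact: measurable_coord_rV.
    exact: normr_frac_min_le.
  rewrite mulrN -mulNr -(RintegralZl _ measurableT im).
  apply: eq_Rintegral => x _.
  transitivity (- f x * (@cos_moment R 1 1 * frac_min a (x ord0 i))); first by ring.
  rewrite frac_minE -RintegralZl//; last first.
    apply: (integrable_bdMl (C := 1)); [exact: measurable_cosM| |exact: iN].
    by move=> t; exact: cos_max.
  by apply: eq_Rintegral => t _; rewrite mulrCA.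
have cn : @cos_moment R 1 1 != 0 by rewrite gt_eqF.
apply: (mulfI cn); rewrite S1 S2.
rewrite (Rintegral_swap (m1 := mu) (m2 := leb)
  (F := fun z => (1 - cos (z.1 ord0 i * z.2)) * (g z.1 * N 1 z.2))); last first.
  apply: (integrable_bdMl (C := 2)).
  - exact: measurable_funB.
  - by move=> z; rewrite ger0_norm ?one_sub_cos_ge0 ?one_sub_cos_le2.
  - exact: (integrable_tensor (m1 := mu) (m2 := leb) Lg (iN _ one01)).
rewrite (Rintegral_swap (m1 := mu) (m2 := leb)
  (F := fun z => cos (z.1 ord0 i * z.2) * (- f z.1 * N (1 - alpha) z.2))); last first.
  apply: (integrable_bdMl (C := 1)) => //.
  - by move=> z; exact: cos_max.
  - exact: (integrable_tensor (m1 := mu) (m2 := leb) Lf' (iN _ b01)).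
apply: eq_Rintegral => t _.
transitivity (N 1 t * (\int[mu]_x (g x - g x * cos (x ord0 i * t)))).
  rewrite -RintegralZl//; last exact: integrable_sub.
  by apply: eq_Rintegral => x _ /=; ring.
rewrite RintegralB// int_g0 sub0r (fraclap_coord i t fg).
have -> : N 1 t * - (`|t| `^ alpha * \int[mu]_x (f x * cos (x ord0 i * t))) =
    - (N (1 - alpha) t * \int[mu]_x (f x * cos (x ord0 i * t))).
  rewrite mulrN mulrA; congr (- (_ * _)); rewrite /N /frac_weight.
  case: ifPn => t0; last by rewrite !mulr0 mul0r.
  rewrite gtr0_norm// -mulrA -powRD ?(gt_eqF t0) ?implybT//.
  by congr (_ * _ `^ _); ring.
rewrite -mulNr -RintegralZl//; last first.
  rewrite (_ : (fun x => _) = (fun x : V => cos (x ord0 i * t) * f x)); last first.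
    by apply/funext => x; rewrite mulrC.
  apply: (integrable_bdMl (C := 1)) => // [|x]; last exact: cos_max.
  have mc : measurable_fun setT (@cos R).
    by apply: continuous_measurable_fun; exact: continuous_cos.
  apply: (measurableT_comp mc); apply: measurable_funM => //.
  exact: measurable_coord_rV.
by apply: eq_Rintegral => x _ /=; ring.
Qed.

End fractional_laplacian.

(** * C^1 approximation of the positive part *)

Section ramps.
Context {R : realType}.

Definition pos_part (s : R) : R := Num.max s 0.

(** A quadratic remainder is a convenient way to differentiate functions given
    by cases. *)
Lemma is_derive_quadratic (V : normedModType R) (f : V -> R) (x v : V) (df C : R) :
  (forall h, `|h| <= 1 -> `|f (h *: v + x) - f x - h * df| <= C * h ^+ 2) ->
  is_derive x v f df.
Proof.
move=> H; suff cv : h^-1 *: ((f \o shift x) (h *: v) - f x) @[h --> 0^'] --> df.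
  by split; [apply/cvg_ex; exists df|exact: cvg_lim cv].
have C0 : 0 <= C.
  by have := H 1; rewrite normr1 lexx => /(_ isT); rewrite expr1n mulr1; apply: le_trans.
apply/cvgrPdist_le => e e0; near=> h.
have h0 : h != 0 by near: h; exact: nbhs_dnbhs_neq.
have h1 : `|h| <= 1.
  near: h; apply: nbhs_dnbhs; apply/nbhs_normP; exists 1 => //= y /=.
  by rewrite sub0r normrN => /ltW.
have h2 : `|h| <= e / (C + 1).
  near: h; apply: nbhs_dnbhs; apply/nbhs_normP; exists (e / (C + 1)) => /=.
    by rewrite divr_gt0// ltr_wpDl.
  by move=> y /=; rewrite sub0r normrN => /ltW.
have hp : 0 < `|h| by rewrite normr_gt0.
rewrite /= /GRing.scale/= -(ler_pM2l hp) -normrM mulrBr mulrA mulfV// mul1r distrC.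
apply: le_trans (H h h1) _.
rewrite -real_normK ?num_real// expr2 mulrCA ler_wpM2l//.
have C1 : 0 < C + 1 by rewrite ltr_wpDl.
apply: (@le_trans _ _ (C * (e / (C + 1)))); first exact: ler_wpM2l.
rewrite mulrA ler_pdivrMr// mulrC ler_wpM2l ?(ltW e0)//; lra.
Unshelve. all: by end_near. Qed.

Lemma pos_part_sqr_quadratic (s h : R) :
  `|pos_part (s + h) ^+ 2 - pos_part s ^+ 2 - h * (2 * pos_part s)| <= h ^+ 2.
Proof.
rewrite ler_norml /pos_part !/Num.max.
by case: (ltP (s + h) 0) => ?; case: (ltP s 0) => ?; apply/andP; split; nra.
Qed.

Lemma continuous_pos_part : continuous pos_part.
Proof.
move=> s; rewrite /pos_part; apply: continuous_max; [exact: cvg_id|exact: cvg_cst].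
Qed.

Section approximation.
Variable n : nat.
Local Notation N := (n.+1%:R : R).

(** The squared positive part is C^1, and [ramp] is its rescaled difference
    quotient: a C^1 function close to the positive part whose derivative [ramp']
    increases from [0] to [1] on [[0, 1/N]]. *)
Definition ramp (s : R) : R :=
  N / 2 * (pos_part s ^+ 2 - pos_part (s - N^-1) ^+ 2).

Definition ramp' (s : R) : R := N * (pos_part s - pos_part (s - N^-1)).

Let N0 : 0 < N. Proof. exact: ltr0Sn. Qed.

Lemma ramp_quadratic s h : `|ramp (s + h) - ramp s - h * ramp' s| <= N * h ^+ 2.
Proof.
have h1 := pos_part_sqr_quadratic s h.
have h2 := pos_part_sqr_quadratic (s - N^-1) h.
rewrite (_ : _ - _ = N / 2 * ((pos_part (s + h) ^+ 2 - pos_part s ^+ 2 - h * (2 * pos_part s)) -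
  (pos_part (s - N^-1 + h) ^+ 2 - pos_part (s - N^-1) ^+ 2 - h * (2 * pos_part (s - N^-1))))).
  have N2 : 0 < N / 2 by rewrite divr_gt0.
  rewrite normrM (gtr0_norm N2) (_ : N * h ^+ 2 = N / 2 * (2 * h ^+ 2)); last by field.
  rewrite (ler_pM2l N2).
  have := ler_normB (pos_part (s + h) ^+ 2 - pos_part s ^+ 2 - h * (2 * pos_part s))
    (pos_part (s - N^-1 + h) ^+ 2 - pos_part (s - N^-1) ^+ 2 - h * (2 * pos_part (s - N^-1))).
  by lra.
by rewrite /ramp /ramp' [s + h - _]addrAC; field.
Qed.

Lemma ramp_near s : `|ramp s - pos_part s| <= (2 * N)^-1.
Proof.
have Ni : 0 < N^-1 by rewrite invr_gt0.
rewrite invfM /ramp /pos_part /Num.max; set m := N^-1 in Ni *.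
have NM : N * m = 1 by rewrite mulfV// gt_eqF.
case: (ltP s 0) => s0; case: (ltP (s - m) 0) => sm; rewrite ler_norml.
- by apply/andP; split; nra.
- by exfalso; lra.
- have -> : N / 2 * (s ^+ 2 - 0 ^+ 2) - s = 2^-1 * ((N * s) * s) - s by field.
  have : 0 <= N * s <= 1.
    have : N * s <= N * m by rewrite ler_pM2l//; lra.
    by rewrite NM mulr_ge0 ?(ltW N0).
  by move=> /andP[? ?]; apply/andP; split; nra.
- have -> : N / 2 * (s ^+ 2 - (s - m) ^+ 2) - s = (N * m) * s - 2^-1 * (N * m) * m - s by field.
  by rewrite NM; apply/andP; split; lra.
Qed.

Lemma ramp'_bound s : 0 <= ramp' s <= 1.
Proof.
have Ni : 0 < N^-1 by rewrite invr_gt0.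
rewrite /ramp' /pos_part /Num.max; set m := N^-1 in Ni *.
have NM : N * m = 1 by rewrite mulfV// gt_eqF.
by case: (ltP s 0) => s0; case: (ltP (s - m) 0) => sm; apply/andP; split; nra.
Qed.

Lemma continuous_ramp : continuous ramp.
Proof.
have cq : continuous (fun s => pos_part s ^+ 2).
  move=> s; apply: (@continuous_comp _ _ _ pos_part (fun u => u ^+ 2)).
    exact: continuous_pos_part.
  exact: exprn_continuous.
move=> s; apply: cvgM; first exact: cvg_cst.
apply: cvgB; first exact: cq.
apply: (@continuous_comp _ _ _ (fun s => s - N^-1) (fun s => pos_part s ^+ 2)).
  by apply: cvgB; [exact: cvg_id|exact: cvg_cst].
exact: cq.
Qed.

Lemma continuous_ramp' : continuous ramp'.
Proof.
move=> s; apply: cvgM; first exact: cvg_cst.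
apply: cvgB; first exact: continuous_pos_part.
apply: (@continuous_comp _ _ _ (fun s => s - N^-1) pos_part).
  by apply: cvgB; [exact: cvg_id|exact: cvg_cst].
exact: continuous_pos_part.
Qed.

End approximation.

Lemma cvg_ramp s : ramp n s @[n --> \oo] --> pos_part s.
Proof.
apply/cvgrPdist_le => e e0; near=> n.
rewrite distrC (le_trans (ramp_near n s))// (@le_trans _ _ (n.+1%:R^-1))//.
  rewrite invfM ler_piMl ?invr_ge0// invf_le1//; lra.
by apply: ltW; near: n; exact: (near_infty_natSinv_lt (PosNum e0)).
Unshelve. all: by end_near. Qed.

(** The approximation is one-sided so that the limit vanishes at [s = 0]; then
    [min_slope] below is exactly odd. *)
Lemma cvg_ramp' s : ramp' n s @[n --> \oo] --> ((0 < s)%R%:R : R).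
Proof.
apply: cvg_near_cst; have [s0|s0] := ltP 0 s; last first.
  apply: nearW => n; rewrite /ramp' /pos_part !max_r ?subrr ?mulr0//.
  by rewrite subr_le0 (le_trans s0)// invr_ge0.
near=> n; have ns : n.+1%:R^-1 < s by near: n; exact: (near_infty_natSinv_lt (PosNum s0)).
rewrite /ramp' /pos_part !max_l ?subr_ge0 ?(ltW ns) ?(ltW s0)//.
by rewrite opprB addrCA subrr addr0 mulfV.
Unshelve. all: by end_near. Qed.

End ramps.

(** * Test functions approaching a truncated coordinate *)

Section tent_test_functions.
Context {R : realType} {d : nat}.
Local Notation V := 'rV[R]_d.
Local Notation mu := (@lebesgue_rV R d).

(** Derivative of [s |-> min(|s|, a)], as the pointwise limit of the
    derivatives of its C^1 approximations [smooth_min]. *)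
Definition min_slope (a s : R) : R :=
  (0 < s)%R%:R - (0 < - s)%R%:R - (0 < s - a)%R%:R + (0 < - s - a)%R%:R.

Definition smooth_min (n : nat) (a s : R) : R :=
  ramp n s + ramp n (- s) - ramp n (s - a) - ramp n (- s - a).

Definition smooth_min_slope (n : nat) (a s : R) : R :=
  ramp' n s - ramp' n (- s) - ramp' n (s - a) + ramp' n (- s - a).

(** The graph of [min(|s|, a)] is piecewise affine with kinks at [0], [a] and
    [-a], one for each positive part. *)
Lemma min_pos_part (a s : R) : 0 < a -> Num.min `|s| a =
  pos_part s + pos_part (- s) - pos_part (s - a) - pos_part (- s - a).
Proof.
move=> a0; rewrite /pos_part /Num.max /Num.min.
by case: (ler0P s) => s0; case: (ltP s 0) => ?; case: (ltP (- s) 0) => ?;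
  case: (ltP (s - a) 0) => ?; case: (ltP (- s - a) 0) => ?; case: ltP => ?; lra.
Qed.

Lemma min_slopeE (a s : R) : 0 < a ->
  min_slope a s = if `|s| <= a then Num.sg s else 0.
Proof.
move=> a0; rewrite /min_slope; have [s0|s0|->] := ltgtP s 0.
- rewrite ltr0_norm// ltr0_sg//.
  by case: (ltP 0 (- s)) => ?; case: (ltP 0 (s - a)) => ?;
    case: (ltP 0 (- s - a)) => ?; case: leP => ? /=; lra.
- rewrite gtr0_norm// gtr0_sg//.
  by case: (ltP 0 (- s)) => ?; case: (ltP 0 (s - a)) => ?;
    case: (ltP 0 (- s - a)) => ?; case: leP => ? /=; lra.
- rewrite normr0 sgr0 oppr0 !sub0r ltxx oppr_gt0 (ltNge a) (ltW a0)/=.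
  by lra.
Qed.

Lemma normr_min_slope_le1 (a s : R) : 0 < a -> `|min_slope a s| <= 1.
Proof.
move=> a0; rewrite min_slopeE//; case: ifP => _; last by rewrite normr0.
by rewrite normr_sg lern1; case: eqP.
Qed.

Lemma measurable_min_slope a : measurable_fun setT (min_slope a).
Proof.
have mb (f : R -> R) : measurable_fun setT f ->
    measurable_fun setT (fun s => ((0 < f s)%R%:R : R)).
  move=> mf; rewrite (_ : (fun _ => _) = (fun s => if 0 < f s then 1 else 0)); last first.
    by apply/funext => s; case: ifP.
  by apply: measurable_fun_ifT => //; exact: measurable_fun_ltr.
apply: measurable_funD.
  apply: measurable_funB; last by apply: mb; exact: measurable_funB.
  apply: measurable_funB; first by apply: mb.
  exact: mb.
by apply: mb; apply: measurable_funB.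
Qed.

Lemma smooth_min_quadratic n a s h :
  `|smooth_min n a (s + h) - smooth_min n a s - h * smooth_min_slope n a s|
  <= 4 * n.+1%:R * h ^+ 2.
Proof.
have := ramp_quadratic n (- s - a) (- h); have := ramp_quadratic n (s - a) h.
have := ramp_quadratic n (- s) (- h); have := ramp_quadratic n s h.
rewrite sqrrN (_ : s - a + h = s + h - a); last ring.
rewrite (_ : - s - a - h = - (s + h) - a); last ring.
rewrite (_ : - s - h = - (s + h)); last ring.
by rewrite /smooth_min /smooth_min_slope !ler_norml => /andP[? ?] /andP[? ?] /andP[? ?] /andP[? ?];
  apply/andP; split; lra.
Qed.

Lemma smooth_min_near n a s : 0 < a ->
  `|smooth_min n a s - Num.min `|s| a| <= 2.
Proof.
move=> a0.
have r1 (u : R) : `|ramp n u - pos_part u| <= 2^-1.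
  by rewrite (le_trans (ramp_near n u))// lef_pV2 ?posrE ?mulr_gt0// ler_pMr// ler1n.
have := r1 (- s - a); have := r1 (s - a); have := r1 (- s); have := r1 s.
by rewrite min_pos_part// /smooth_min !ler_norml => /andP[? ?] /andP[? ?] /andP[? ?] /andP[? ?];
  apply/andP; split; lra.
Qed.

Lemma cvg_smooth_min a s : 0 < a ->
  smooth_min n a s @[n --> \oo] --> Num.min `|s| a.
Proof.
move=> a0; rewrite min_pos_part//.
by apply: cvgB; [apply: cvgB; [apply: cvgD|]|]; exact: cvg_ramp.
Qed.

Lemma normr_smooth_min_slope n a s : `|smooth_min_slope n a s| <= 2.
Proof.
have := ramp'_bound n (- s - a); have := ramp'_bound n (s - a).
have := ramp'_bound n (- s); have := ramp'_bound n s.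
by rewrite /smooth_min_slope !ler_norml => /andP[? ?] /andP[? ?] /andP[? ?] /andP[? ?];
  apply/andP; split; lra.
Qed.

Lemma cvg_smooth_min_slope a s :
  smooth_min_slope n a s @[n --> \oo] --> min_slope a s.
Proof.
by apply: cvgD; [apply: cvgB; [apply: cvgB|]|]; exact: cvg_ramp'.
Qed.

Lemma continuous_smooth_min n a : continuous (smooth_min n a).
Proof.
have cc (f : R -> R) : continuous f -> continuous (fun s => ramp n (f s)).
  move=> cf s; apply: (@continuous_comp _ _ _ f (ramp n)); first exact: cf.
  exact: continuous_ramp.
have c1 : continuous (fun s : R => s) by move=> u; exact: cvg_id.
have c2 : continuous (fun s : R => - s) by move=> u; apply: cvgN; exact: cvg_id.
have c3 : continuous (fun s : R => s - a) by move=> u; apply: cvgB; [exact: cvg_id|exact: cvg_cst].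
have c4 : continuous (fun s : R => - s - a) by move=> u; apply: cvgB; [exact: c2|exact: cvg_cst].
move=> s; apply: cvgB; [apply: cvgB; [apply: cvgD|]|].
- exact: (cc _ c1).
- exact: (cc _ c2).
- exact: (cc _ c3).
- exact: (cc _ c4).
Qed.

Lemma continuous_smooth_min_slope n a : continuous (smooth_min_slope n a).
Proof.
have cc (f : R -> R) : continuous f -> continuous (fun s => ramp' n (f s)).
  move=> cf s; apply: (@continuous_comp _ _ _ f (ramp' n)); first exact: cf.
  exact: continuous_ramp'.
have c1 : continuous (fun s : R => s) by move=> u; exact: cvg_id.
have c2 : continuous (fun s : R => - s) by move=> u; apply: cvgN; exact: cvg_id.
have c3 : continuous (fun s : R => s - a) by move=> u; apply: cvgB; [exact: cvg_id|exact: cvg_cst].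
have c4 : continuous (fun s : R => - s - a) by move=> u; apply: cvgB; [exact: c2|exact: cvg_cst].
move=> s; apply: cvgD; [apply: cvgB; [apply: cvgB|]|].
- exact: (cc _ c1).
- exact: (cc _ c2).
- exact: (cc _ c3).
- exact: (cc _ c4).
Qed.

Lemma continuous_dotp : continuous (fun x : V => dotp x x).
Proof.
have add2 : continuous (fun z : R * R => z.1 + z.2) by exact: add_continuous.
have cx (i : 'I_d) : continuous (fun x : V => x ord0 i * x ord0 i).
  have ci : continuous (fun x : V => x ord0 i) by exact: coord_continuous.
  by move=> x; exact: (continuousM (ci x) (ci x)).
move=> x; apply: (continuous_big add2) => i _; exact: cx.
Qed.

(** The squared positive part again gives a C^1 function, equal to [1] in the
    limit and supported in the ball of radius [n + 1]. *)
Definition cutoff_arg (n : nat) (x : V) : R := pos_part (1 - dotp x x / n.+1%:R ^+ 2).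

Definition cutoff (n : nat) (x : V) : R := cutoff_arg n x ^+ 2.

Definition cutoff_slope (n : nat) (x : V) (j : 'I_d) : R :=
  - (4 / n.+1%:R ^+ 2) * x ord0 j * cutoff_arg n x.

Lemma is_derive_cutoff n x j :
  is_derive x (delta_mx ord0 j) (cutoff n) (cutoff_slope n x j).
Proof.
set N : R := n.+1%:R; have N0 : 0 < N by exact: ltr0Sn.
pose k h := - (2 * h * x ord0 j + h ^+ 2) / N ^+ 2.
apply: (@is_derive_quadratic _ _ _ _ _ _
  (((2 * `|x ord0 j| + 1) / N ^+ 2) ^+ 2 + 2 * cutoff_arg n x / N ^+ 2)) => h h1.
have dE : dotp (h *: delta_mx ord0 j + x) (h *: delta_mx ord0 j + x) =
    dotp x x + 2 * h * x ord0 j + h ^+ 2.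
  rewrite /dotp (bigD1 j)//= [in RHS](bigD1 j)//= !mxE !eqxx /=.
  rewrite (eq_bigr (fun i => x ord0 i * x ord0 i)); first by ring.
  by move=> i ij; rewrite !mxE eqxx (negbTE ij) /=; ring.
have -> : cutoff n (h *: delta_mx ord0 j + x) =
    pos_part (1 - dotp x x / N ^+ 2 + k h) ^+ 2.
  by rewrite /cutoff /cutoff_arg dE -/N; congr (pos_part _ ^+ 2); rewrite /k; field; rewrite gt_eqF.
rewrite /cutoff /cutoff_slope /cutoff_arg -/N; set s := 1 - _ / _.
have := pos_part_sqr_quadratic s (k h).
have kh : `|k h| <= `|h| * ((2 * `|x ord0 j| + 1) / N ^+ 2).
  rewrite /k normrM normrN normfV (ger0_norm (sqr_ge0 N)) mulrA ler_pM2r ?invr_gt0 ?exprn_gt0//.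
  rewrite (_ : _ + _ = h * (2 * x ord0 j + h)); last ring.
  rewrite normrM ler_wpM2l// (le_trans (ler_normD _ _))// normrM ger0_norm// lerD2l.
  exact: h1.
have kh2 : k h ^+ 2 <= ((2 * `|x ord0 j| + 1) / N ^+ 2) ^+ 2 * h ^+ 2.
  rewrite -(real_normK (num_real (k h))) -(real_normK (num_real h)) mulrC -exprMn.
  by rewrite ler_sqr ?nnegrE// (le_trans _ kh).
set P := pos_part s => h3.
have -> : h * (- (4 / N ^+ 2) * x ord0 j * P) = k h * (2 * P) + 2 * P / N ^+ 2 * h ^+ 2.
  by rewrite /k; field; rewrite gt_eqF.
have P0 : 0 <= 2 * P / N ^+ 2 * h ^+ 2.
  by rewrite mulr_ge0 ?sqr_ge0// divr_ge0 ?sqr_ge0// mulr_ge0// le_max lexx orbT.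
rewrite [leRHS]mulrDl; move: h3 kh2 P0.
move: (_ ^+ 2 * h ^+ 2) (2 * P / _ * _) (k h * _) => B Q D.
rewrite !ler_norml => /andP[? ?] ? ?.
by apply/andP; split; lra.
Qed.

Lemma cutoff_arg_ge0 n x : 0 <= cutoff_arg n x.
Proof. by rewrite le_max lexx orbT. Qed.

Lemma cutoff_arg_le1 n x : cutoff_arg n x <= 1.
Proof.
rewrite ge_max ler01 andbT lerBlDr lerDl divr_ge0 ?sqr_ge0//; exact: dotp_ge0.
Qed.

Lemma continuous_cutoff_arg n : continuous (cutoff_arg n).
Proof.
have c1 : continuous (fun x : V => 1 - dotp x x / n.+1%:R ^+ 2).
  have cc (c : R) : continuous (fun _ : V => c) by exact: cst_continuous.
  move=> x; apply: (continuousB (cc 1 x)).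
  exact: (continuousM (continuous_dotp (x := x)) (cc _ x)).
move=> x; apply: (@continuous_comp _ _ _ (fun x : V => 1 - dotp x x / n.+1%:R ^+ 2) pos_part).
  exact: c1.
exact: continuous_pos_part.
Qed.

Lemma cvg_cutoff_arg x : cutoff_arg n x @[n --> \oo] --> (1 : R).
Proof.
have h : 1 - dotp x x / n.+1%:R ^+ 2 @[n --> \oo] --> (1 : R).
  rewrite -[X in _ --> X]subr0; apply: cvgB; first exact: cvg_cst.
  rewrite -(mulr0 (dotp x x)); apply: cvgM; first exact: cvg_cst.
  under eq_fun do rewrite -exprVn expr2.
  by rewrite -(mulr0 0); apply: cvgM; exact: cvg_harmonic.
rewrite -[X in _ --> X](_ : pos_part 1 = 1); last by rewrite /pos_part max_l.
apply: (cvg_comp _ _ h); exact: continuous_pos_part.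
Qed.

Section test_function.
Variables (n : nat) (i : 'I_d) (a : R).
Hypothesis a0 : 0 < a.
Local Notation N := (n.+1%:R : R).

Definition tent_test (x : V) : R := smooth_min n a (x ord0 i) * cutoff n x.

Definition tent_test_slope (j : 'I_d) (x : V) : R :=
  smooth_min n a (x ord0 i) * cutoff_slope n x j +
  cutoff n x * ((j == i)%:R * smooth_min_slope n a (x ord0 i)).

Lemma is_derive_tent_test j x :
  is_derive x (delta_mx ord0 j) tent_test (tent_test_slope j x).
Proof.
have h : is_derive x (delta_mx ord0 j) (fun x : V => smooth_min n a (x ord0 i))
    ((j == i)%:R * smooth_min_slope n a (x ord0 i)).
  apply: (@is_derive_quadratic _ _ _ _ _ _ (4 * N)) => h _.
  rewrite !mxE eqxx/= [i == j]eq_sym; case: eqVneq => _.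
    by rewrite mulr1 mul1r addrC; exact: smooth_min_quadratic.
  by rewrite mulr0 add0r mul0r mulr0 subr0 subrr normr0 mulr_ge0 ?sqr_ge0// mulr_ge0.
exact: (is_deriveM h (is_derive_cutoff n x j)).
Qed.

Lemma partial_tent_test j x : partial j tent_test x = tent_test_slope j x.
Proof. by rewrite /partial; have [_ ->] := is_derive_tent_test j x. Qed.

Lemma continuous_coord j : continuous (fun x : V => x ord0 j).
Proof. exact: coord_continuous. Qed.

Lemma continuous_smooth_min_coord : continuous (fun x : V => smooth_min n a (x ord0 i)).
Proof.
move=> x; apply: (@continuous_comp _ _ _ (fun x : V => x ord0 i) (smooth_min n a)).
  exact: continuous_coord.
exact: continuous_smooth_min.
Qed.

Lemma continuous_cutoff : continuous (cutoff n).
Proof.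
have c1 := @continuous_cutoff_arg n.
have c2 : continuous (fun x : V => cutoff_arg n x * cutoff_arg n x).
  by move=> x; exact: (continuousM (c1 x) (c1 x)).
exact: c2.
Qed.

Lemma continuous_tent_test : continuous tent_test.
Proof.
have c1 := continuous_smooth_min_coord; have c2 := continuous_cutoff.
by move=> x; exact: (continuousM (c1 x) (c2 x)).
Qed.

Lemma continuous_tent_test_slope j : continuous (tent_test_slope j).
Proof.
have cc (c : R) : continuous (fun _ : V => c) by exact: cst_continuous.
have c1 : continuous (fun x : V => cutoff_slope n x j).
  move=> x; have c1 := continuousM (cc (- (4 / n.+1%:R ^+ 2)) x) (@continuous_coord j x).
  exact: (continuousM c1 (@continuous_cutoff_arg n x)).
have c2 : continuous (fun x : V => (j == i)%:R * smooth_min_slope n a (x ord0 i)).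
  move=> x; apply: (continuousM (cc (j == i)%:R x)).
  apply: (@continuous_comp _ _ _ (fun x : V => x ord0 i) (smooth_min_slope n a)).
    exact: continuous_coord.
  exact: continuous_smooth_min_slope.
move=> x; have c3 := continuousM (@continuous_smooth_min_coord x) (c1 x).
exact: (continuousD c3 (continuousM (@continuous_cutoff x) (c2 x))).
Qed.

Lemma test_function_tent_test : test_function tent_test.
Proof.
split.
- exact: continuous_tent_test.
- by move=> j x; have [] := is_derive_tent_test j x.
- move=> j; rewrite (_ : partial j _ = tent_test_slope j); first exact: continuous_tent_test_slope.
  by apply/funext => x; exact: partial_tent_test.
exists N => x Nx; rewrite /tent_test /cutoff /cutoff_arg /pos_part max_r ?expr0n ?mulr0//.
rewrite subr_le0 ler_pdivlMr ?exprn_gt0// mul1r -enorm_sqr ler_sqr ?nnegrE ?enorm_ge0//.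
exact: ltW.
Qed.

Lemma normr_smooth_min_le s : `|smooth_min n a s| <= a + 2.
Proof.
have := smooth_min_near n s a0.
have : 0 <= Num.min `|s| a <= a by rewrite ge_min lexx orbT andbT le_min normr_ge0 ltW.
by move=> /andP[? ?]; rewrite !ler_norml => /andP[? ?]; apply/andP; split; lra.
Qed.

Lemma normr_tent_test x : `|tent_test x| <= a + 2.
Proof.
rewrite /tent_test normrM -[leRHS]mulr1 ler_pM// ?normr_smooth_min_le//.
by rewrite ger0_norm ?sqr_ge0// expr_le1 ?cutoff_arg_ge0 ?cutoff_arg_le1.
Qed.

(** On the support, [|x_j|] is at most the radius, which absorbs one of the two
    powers in the denominator. *)
Lemma normr_cutoff_slope j x : `|cutoff_slope n x j| <= 4.
Proof.
have N1 : 1 <= N by rewrite ler1n.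
have c0 := cutoff_arg_ge0 n x; have c1 := cutoff_arg_le1 n x.
have : `|x ord0 j| * cutoff_arg n x <= N.
  have [xN|xN] := leP (enorm x) N.
    rewrite -[leRHS]mulr1 ler_pM// (le_trans (coord_le_enorm x j))//.
  rewrite /cutoff_arg /pos_part max_r ?mulr0//.
  rewrite subr_le0 ler_pdivlMr ?exprn_gt0// mul1r -enorm_sqr ler_sqr ?nnegrE ?enorm_ge0//.
  exact: ltW.
move=> h; have -> : `|cutoff_slope n x j| = 4 / N ^+ 2 * (`|x ord0 j| * cutoff_arg n x).
  have k0 : 0 <= 4 / N ^+ 2 by rewrite divr_ge0 ?sqr_ge0.
  by rewrite /cutoff_slope !normrM normrN (ger0_norm k0) (ger0_norm c0) mulrA.
have N0 : 0 < N ^+ 2 by rewrite exprn_gt0.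
rewrite mulrAC (ler_pdivrMr _ _ N0).
rewrite ler_pM2l// (le_trans h)// expr2 ler_peMr//; lra.
Qed.

Lemma normr_tent_test_slope j x : `|tent_test_slope j x| <= (a + 2) * 4 + 2.
Proof.
rewrite /tent_test_slope (le_trans (ler_normD _ _))// lerD// normrM.
  by apply: ler_pM => //; [exact: normr_smooth_min_le|exact: normr_cutoff_slope].
rewrite -[leRHS]mul1r ler_pM//.
  by rewrite ger0_norm ?sqr_ge0// expr_le1 ?cutoff_arg_ge0 ?cutoff_arg_le1.
rewrite normrM -[leRHS]mul1r ler_pM// ?normr_smooth_min_slope//.
by case: eqP; rewrite ?normr1 ?normr0.
Qed.

End test_function.

End tent_test_functions.

(** * The weak divergence against a truncated coordinate *)

Section weak_divergence.
Context {R : realType} {d : nat}.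
Local Notation V := 'rV[R]_d.
Local Notation mu := (@lebesgue_rV R d).
Variables (a : R) (i : 'I_d).
Hypothesis a0 : 0 < a.

Lemma cvg_invn2 : (n.+1%:R ^+ 2)^-1 @[n --> \oo] --> (0 : R).
Proof.
under eq_fun do rewrite -exprVn expr2.
by rewrite -(mulr0 0); apply: cvgM; exact: cvg_harmonic.
Qed.

Lemma cvg_cutoff (x : V) : cutoff n x @[n --> \oo] --> (1 : R).
Proof.
rewrite -[X in _ --> X](mulr1 1) /cutoff; under eq_fun do rewrite expr2.
by apply: cvgM; exact: cvg_cutoff_arg.
Qed.

Lemma cvg_cutoff_slope (x : V) j : cutoff_slope n x j @[n --> \oo] --> (0 : R).
Proof.
rewrite (_ : (fun n => _) = (fun n => (n.+1%:R ^+ 2)^-1 * (- (4 * x ord0 j) * cutoff_arg n x))); last first.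
  by apply/funext => n; rewrite /cutoff_slope; ring.
rewrite -(mul0r (- (4 * x ord0 j) * 1)); apply: cvgM; first exact: cvg_invn2.
by apply: cvgM; [exact: cvg_cst|exact: cvg_cutoff_arg].
Qed.

Lemma measurable_cutoff_arg n : measurable_fun setT (fun x : V => cutoff_arg n x).
Proof.
have mp : measurable_fun setT (@pos_part R).
  by apply: continuous_measurable_fun; exact: continuous_pos_part.
apply: (measurableT_comp mp); apply: measurable_funB => //; apply: measurable_funM => //.
by apply: measurable_sum => j; apply: measurable_funM; exact: measurable_coord_rV.
Qed.

Lemma measurable_tent_test n : measurable_fun setT (tent_test n i a).
Proof.
apply: measurable_funM; last first.
  by apply: measurable_funX; exact: measurable_cutoff_arg.
have ms : measurable_fun setT (@smooth_min R n a).
  by apply: continuous_measurable_fun; exact: continuous_smooth_min.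
apply: (measurableT_comp ms); exact: measurable_coord_rV.
Qed.

Lemma measurable_tent_test_slope n j : measurable_fun setT (tent_test_slope n i a j).
Proof.
have ms : measurable_fun setT (@smooth_min R n a).
  by apply: continuous_measurable_fun; exact: continuous_smooth_min.
have ms' : measurable_fun setT (@smooth_min_slope R n a).
  by apply: continuous_measurable_fun; exact: continuous_smooth_min_slope.
have mi := measurable_coord_rV (T := R) i.
apply: measurable_funD; apply: measurable_funM.
- exact: (measurableT_comp ms mi).
- apply: measurable_funM; last exact: measurable_cutoff_arg.
  by apply: measurable_funM => //; exact: measurable_coord_rV.
- by apply: measurable_funX; exact: measurable_cutoff_arg.
- by apply: measurable_funM => //; exact: (measurableT_comp ms' mi).
Qed.

(** Dominated convergence on both sides of the definition of the weak
    divergence: the test functions and their gradients are bounded uniformly, and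
    the gradient of the cutoff disappears in the limit. *)
Lemma int_divergence_min (F : V -> V) g : is_divergence F g ->
  \int[mu]_x (Num.min `|x ord0 i| a * g x) =
  - \int[mu]_x (min_slope a (x ord0 i) * F x ord0 i).
Proof.
move=> [LF Lg wdiv].
have L : \int[mu]_x (tent_test n i a x * g x) @[n --> \oo] -->
    \int[mu]_x (Num.min `|x ord0 i| a * g x).
  have ig : L1 (fun x => (a + 2) * `|g x|) by apply: integrableZ; exact: (integrable_norm Lg).
  have [|||_] := int_dominated_cvg (f_ := fun n x => tent_test n i a x * g x)
    (f := fun x => Num.min `|x ord0 i| a * g x) _ _ ig _; last by [].
  - move=> n; apply: measurable_funM; first exact: measurable_tent_test.
    exact: (integrable_measurable Lg).
  - move=> x; apply: cvgM; last exact: cvg_cst.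
    rewrite -[X in _ --> X]mulr1; apply: cvgM; first exact: cvg_smooth_min.
    exact: cvg_cutoff.
  - by move=> n x; rewrite normrM ler_wpM2r// normr_tent_test.
have L' : \int[mu]_x (\sum_j (partial j (tent_test n i a) x * F x ord0 j)) @[n --> \oo] -->
    \int[mu]_x (min_slope a (x ord0 i) * F x ord0 i).
  have iF : L1 (fun x => ((a + 2) * 4 + 2) * \sum_j `|F x ord0 j|).
    by apply: integrableZ; apply: integrable_big => j; exact: (integrable_norm (LF j)).
  have [|||_] := int_dominated_cvg
    (f_ := fun n x => \sum_j (partial j (tent_test n i a) x * F x ord0 j))
    (f := fun x => min_slope a (x ord0 i) * F x ord0 i) _ _ iF _; last by [].
  - move=> n; apply: measurable_sum => j.
    apply: measurable_funM; last exact: (integrable_measurable (LF j)).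
    rewrite (_ : partial j _ = tent_test_slope n i a j).
      exact: measurable_tent_test_slope.
    by apply/funext => x; rewrite partial_tent_test.
  - move=> x; rewrite [X in _ --> X](_ : _ = \sum_j ((j == i)%:R * min_slope a (x ord0 i) * F x ord0 j)).
      have add2 : continuous (fun z : R * R => z.1 + z.2) by exact: add_continuous.
      apply: (cvg_big add2) => j _; apply: cvgM; last exact: cvg_cst.
      rewrite (_ : (fun n => _) = (fun n => tent_test_slope n i a j x)); last first.
        by apply/funext => n; rewrite partial_tent_test.
      rewrite -[(j == i)%:R * _]add0r; apply: cvgD.
        rewrite -(mulr0 (Num.min `|x ord0 i| a)); apply: cvgM; first exact: cvg_smooth_min.
        exact: cvg_cutoff_slope.
      rewrite -[(j == i)%:R * _]mul1r; apply: cvgM; first exact: cvg_cutoff.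
      by apply: cvgM; [exact: cvg_cst|exact: cvg_smooth_min_slope].
    rewrite (bigD1 i)//= eqxx mul1r big1 ?addr0// => j ji.
    by rewrite (negbTE ji) !mul0r.
  - move=> n x; rewrite mulr_sumr (le_trans (ler_norm_sum _ _ _))//.
    by apply: ler_sum => j _; rewrite normrM ler_wpM2r// partial_tent_test normr_tent_test_slope.
apply: (cvg_unique _ L) => //.
rewrite (_ : (fun n => _) = (fun n => - \int[mu]_x (\sum_j (partial j (tent_test n i a) x * F x ord0 j)))).
  exact: cvgN.
apply/funext => n; exact/wdiv/test_function_tent_test.
Qed.

End weak_divergence.

(** * Bounds on the derivative of the kernel *)

Section kernel_derivative.
Context {R : realType}.
Local Notation leb := (@lebesgue_measure R).

#[local] Instance ae_leb_filter : Filter (almost_everywhere leb).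
Proof. exact: ae_filter_ringOfSetsType. Qed.

(** What the argument uses of the kernel, under either hypothesis: [g] is a
    measurable version of [k'], negative near the origin, and [h r] is the
    essential supremum of [|k'|] over [(0, r)], which grows sublinearly. *)
Record kernel_bounds (k g h : R -> R) (kap r0 C delta : R) : Prop := {
  kb_kap : 0 < kap;
  kb_r0 : 0 < r0;
  kb_C : 0 < C;
  kb_delta : 0 <= delta < 1;
  kb_meas : measurable_fun setT g;
  kb_homo : {homo h : x y / x <= y};
  kb_ge0 : forall r, 0 <= h r;
  kb_norm : forall s, 0 < s -> `|g s| <= h s;
  kb_neg : forall s, 0 < s < r0 -> g s <= - kap;
  kb_deriv : {ae leb, forall s, 0 < s -> derivable k s 1 /\ derive1 k s = g s};
  kb_growth : forall r, 0 < r -> h r <= C * (1 + r `^ delta);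
  kb_ge : forall r, 0 < r -> kap <= h r;
  kb_kmax : forall r, kmax k r = (h r)%:E }.

(** Attraction at short range only: under (H2) with [0 < delta] the term
    [K2 * r^delta] is dominated by [K1] for small [r], and for [delta = 0] one has
    [K2 < K1]. Under (H1) the growth exponent is [0]. *)
Lemma cond_H_bounds (k : R -> R) : cond_H1 k \/ cond_H2 k ->
  exists kap r0 C delta : R, [/\ 0 < kap, 0 < r0, 0 < C, 0 <= delta < 1 &
    {ae leb, forall r, 0 < r -> [/\ derivable k r 1,
       `|derive1 k r| <= C * (1 + r `^ delta) & r < r0 -> derive1 k r <= - kap]}].
Proof.
move=> [[[K0 K00 bd] /(_ 1 ltr01)]|]; last first.
  move=> [k1 [k2 [K0 [K1 [K2 [delta [[K00 K10] K20 delta01 K12 bd]]]]]]].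
  have [delta0|delta0] := eqVneq delta 0.
    exists (K1 - K2), 1, K0, delta; split => //; first by rewrite subr_gt0 K12.
    apply: filterS bd => r H r0; have {H}[[? _ _] E ? lo up] := H r0; split => // _.
    by move: up lo; rewrite E delta0 powRr0 mulr1; lra.
  have dp : 0 < delta by rewrite lt_def delta0; case/andP: delta01.
  pose B := K1 / (2 * (K2 + 1)).
  have B0 : 0 < B by rewrite divr_gt0// mulr_gt0// ltr_wpDl.
  exists (K1 / 2), (B `^ delta^-1), K0, delta; split => //; rewrite ?divr_gt0 ?powR_gt0//.
  apply: filterS bd => r H r0; have {H}[[? _ _] E ? lo up] := H r0; split => // rB.
  have rd : r `^ delta <= B.
    have := ge0_ler_powR (ltW dp) (ltW r0 : r \in Num.nneg) (powR_ge0 B delta^-1 : _ \in Num.nneg) (ltW rB).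
    by rewrite -powRrM mulVf// powRr1 ?(ltW B0).
  have KB : K2 * r `^ delta <= K1 / 2.
    rewrite (@le_trans _ _ ((K2 + 1) * B))//.
      by apply: ler_pM => //; [exact: powR_ge0|lra].
    by rewrite /B; have : K2 + 1 != 0 by [rewrite gt_eqF// ltr_wpDl]; move=> ?; rewrite le_eqVlt; apply/orP; left; apply/eqP; field.
  by rewrite E; lra.
rewrite -lteNr oppe0; set S := ess_sup_on _ _ => S0.
have [kap kap0 Skap] : exists2 kap : R, 0 < kap & (S <= (- kap)%:E)%E.
  case: S S0 => [s| |] //.
    by rewrite lte_fin => s0; exists (- s); rewrite ?oppr_gt0// opprK.
  by move=> _; exists 1 => //; rewrite leNye.
exists kap, 1, K0, 0; split => //; first by rewrite lexx ltr01.
have /ess_supP bd2 := Skap.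
apply: filterS2 bd bd2 => r H1 H2 r0; have [? /andP[? ?]] := H1 r0; split => //.
  by rewrite powRr0 ler_norml; apply/andP; split; lra.
by move=> r1; move: H2; rewrite mem_set/= ?r0// lee_fin.
Qed.

Let leb_gt0 : (0 < leb setT)%E.
Proof.
apply: (@lt_le_trans _ _ (leb (`]0%R, 1%R[%classic : set R))).
  by rewrite lebesgue_measure_itv/= lte_fin ltr01 -EFinB subr0 lte_fin.
by apply: le_measure; rewrite ?inE.
Qed.

(** The set is a countable union of its initial parts below rational points,
    plus at most its maximum. *)
Lemma negligible_initial (E : set R) :
  (forall s, E s -> leb.-negligible (E `&` [set t | t < s])) -> leb.-negligible E.
Proof.
move=> H.
pose F (n : nat) : set R := if unpickle n is Some p then
    (if `[< exists2 s, E s & ratr p < s >] then E `&` [set t | t < ratr p] else set0)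
  else set0.
suff : leb.-negligible ((\bigcup_n F n) `|` [set s | E s /\ forall t, E t -> t <= s]).
  apply: negligibleS.
  move=> s Es; have [Ms|] := pselect (forall t, E t -> t <= s); first by right.
  move=> /existsNP[t /not_implyP[Et /negP]]; rewrite -ltNge => st; left.
  have [p] := rat_in_itvoo st; rewrite in_itv/= => /andP[sp pt].
  exists (pickle p); first exact: I.
  rewrite /F pickleK asboolT; first by split.
  by exists t.
apply: negligibleU.
  apply: negligible_bigcup => n; rewrite /F; case: unpickle => [p|]; last exact: negligible_set0.
  case: asboolP => [[s Es ps]|_]; last exact: negligible_set0.
  by apply: negligibleS (H s Es) => t [Et /= tp]; split => //=; exact: lt_trans ps.
have [[m [Em Mm]]|N] := pselect (exists m, E m /\ forall t, E t -> t <= m); last first.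
  by apply: negligibleS (negligible_set0 _) => s Es; apply: N; exists s.
exists [set m]; split => //; first exact: lebesgue_measure_set1.
by move=> s [Es Ms] /=; apply/eqP; rewrite eq_le Mm//= Ms.
Qed.

Lemma kmax_ae_le (k : R -> R) (C : R) r : (0 <= C) ->
  {ae leb, forall s, 0 < s < r -> `|derive1 k s| <= C} -> (kmax k r <= C%:E)%E.
Proof.
move=> C0 H; apply/ess_supP; apply: filterS H => s H; rewrite lee_fin indicE.
case: (boolP (s \in _)) => [|_]; last by rewrite mul0r.
by rewrite inE/= mul1r => /H.
Qed.

Lemma ae_le_kmax (k : R -> R) (C : R) r : (kmax k r <= C%:E)%E ->
  {ae leb, forall s, 0 < s < r -> `|derive1 k s| <= C}.
Proof.
move/ess_supP; apply: filterS => s + sr; rewrite lee_fin indicE mem_set// mul1r; exact.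
Qed.

(** The pointwise bound [|k'(s)| <= h s] holds for almost every [s], although
    [h s] is an essential supremum over [(0, s)] which leaves [s] out: for each
    rational [q], the points with [h s < q < |k'(s)|] form a set whose initial
    parts are null. Measurability of [g] comes from difference quotients of the
    continuous function [k]. *)
Lemma exists_kernel_bounds (k : R -> R) : locally_lipschitz k ->
  cond_H1 k \/ cond_H2 k ->
  exists (g h : R -> R) (kap r0 C delta : R), kernel_bounds k g h kap r0 C delta.
Proof.
move=> lip /cond_H_bounds[kap [r0 [C [delta [kap0 r00 C0 delta01 bd]]]]].
have CC r : 0 <= C * (1 + r `^ delta) by rewrite mulr_ge0 ?(ltW C0)// addr_ge0// powR_ge0.
have growth r : 0 < r -> (kmax k r <= (C * (1 + r `^ delta))%:E)%E.
  move=> rp; apply: kmax_ae_le => //; apply: filterS bd => s H /andP[sp sr].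
  have [_ + _] := H sp; move/le_trans; apply.
  rewrite ler_pM2l// lerD2l ge0_ler_powR//; rewrite ?(ltW sr)//.
  - by case/andP: delta01.
  - exact: ltW.
  - exact: ltW.
have kmax_le r s : r <= s -> (kmax k r <= kmax k s)%E.
  move=> rs; apply: le_ess_sup; apply: aeW => t /=; rewrite lee_fin ler_wpM2r// !indicE ler_nat.
  case: (boolP (t \in [set s | 0 < s < r])) => //; rewrite inE/= => /andP[t0 tr].
  by rewrite mem_set//= t0 (lt_le_trans tr).
have kmax_ge0 r : (0 <= kmax k r)%E.
  by apply: ess_sup_gee => //; apply: aeW => s; rewrite lee_fin mulr_ge0// indicE ler0n.
pose h r := fine (kmax k r).
have kmaxE r : kmax k r = (h r)%:E.
  rewrite /h fineK// ge0_fin_numE//.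
  apply: le_lt_trans (kmax_le _ (Num.max r 1) _) _; first by rewrite le_max lexx.
  apply: le_lt_trans (growth _ _) _; last exact: ltry.
  by rewrite lt_max ltr01 orbT.
have h_homo : {homo h : x y / x <= y}.
  by move=> x y xy; rewrite -lee_fin -!kmaxE kmax_le.
have h_ge r : 0 < r -> kap <= h r.
  move=> rp; rewrite leNgt; apply/negP => hk.
  have H : (kmax k r <= (h r)%:E)%E by rewrite kmaxE.
  have /ae_le_kmax H' := H.
  have : leb.-negligible `]0, (Num.min r r0)[%classic.
    have [N [mN N0 sub]] := filterI bd H'.
    exists N; split => // s /=; rewrite in_itv/= lt_min => /andP[s0 /andP[sr sr0]].
    apply: sub => /= -[/(_ s0)[_ _ /(_ sr0) k1] H2].
    have := H2 (introT andP (conj s0 sr)).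
    have := ler_norm (- derive1 k s); rewrite normrN; lra.
  move=> [N [mN N0 sub]].
  have m0 : 0 < Num.min r r0 by rewrite lt_min rp.
  have : (leb (`]0%R, (Num.min r r0)[%classic : set R) <= leb N)%E.
    by apply: le_measure; rewrite ?inE.
  by rewrite N0 lebesgue_measure_itv/= lte_fin m0 -EFinB subr0 lee_fin leNgt m0.
have h_norm : {ae leb, forall s, 0 < s -> `|derive1 k s| <= h s}.
  pose E (q : R) := [set s : R | 0 < s /\ h s < q < `|derive1 k s|].
  pose F (n : nat) : set R := if unpickle n is Some p then E (ratr (p : rat)) else set0.
  suff : leb.-negligible (\bigcup_n F n).
    apply: negligibleS.
    move=> s /= /not_implyP[s0 /negP]; rewrite -ltNge => hs.
    have [p] := rat_in_itvoo hs; rewrite in_itv/= => sp.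
    exists (pickle p); first exact: I.
    by rewrite /F pickleK; split.
  apply: negligible_bigcup => n; rewrite /F; case: unpickle => [p|]; last exact: negligible_set0.
  apply: negligible_initial => s [s0 /andP[hs _]].
  have H : (kmax k s <= (h s)%:E)%E by rewrite kmaxE.
  have /ae_le_kmax := H.
  apply: negligibleS => t [[t0 /andP[_ tk]] /= ts]; apply/not_implyP; split.
    by rewrite t0.
  by apply/negP; rewrite -ltNge (lt_trans hs).
have [N [mN N0 Nsub]] := filterI bd h_norm.
pose k0 (s : R) := k (Num.max s 0).
have ck0 : continuous k0.
  move=> s; have [L L0 HL] : exists2 L : R, 0 < L & forall x y, 0 <= x <= `|s| + 1 ->
      0 <= y <= `|s| + 1 -> `|k x - k y| <= L * `|x - y|.
    have [L0 [_ HL0]] := lip (`|s| + 1).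
    exists (Num.max L0 0 + 1) => [|x y xs ys].
      by rewrite ltr_wpDl// le_max lexx orbT.
    apply: (HL0 _ _ (x, y)) => /=; last by split; rewrite /= in_itv.
    by rewrite ltr_pwDr// le_max lexx.
  apply/cvgrPdist_le => e e0; near=> t.
  have st : `|s - t| <= 1.
    near: t; apply/nbhs_normP; exists 1 => //= u /=; exact: ltW.
  have st' : `|s - t| <= e / L.
    near: t; apply/nbhs_normP; exists (e / L) => /=; first by rewrite divr_gt0.
    by move=> u /=; exact: ltW.
  have mst : `|Num.max s 0 - Num.max t 0| <= `|s - t|.
    rewrite /Num.max; case: ltP => ?; case: ltP => ?; rewrite ?subrr ?normr0 ?subr0 ?sub0r//.
      by rewrite normrN !ler_normr !ger0_norm//; apply/orP; right; lra.
    by rewrite ger0_norm// ler_normr; apply/orP; left; lra.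
  apply: (@le_trans _ _ (L * (e / L))); last by rewrite mulrC divfK// gt_eqF.
  apply: (@le_trans _ _ (L * `|s - t|)); last by rewrite ler_pM2l.
  apply: le_trans (HL _ _ _ _) _; last by rewrite ler_pM2l.
    rewrite le_max lexx orbT ge_max /=; apply/andP; split; last by rewrite addr_ge0.
    by rewrite (le_trans (ler_norm s))// lerDl.
  rewrite le_max lexx orbT ge_max /=; apply/andP; split; last by rewrite addr_ge0.
  have := ler_norm s; have := ler_norm (t - s); rewrite distrC; lra.
pose D (n : nat) (s : R) := n.+1%:R * (k0 (s + n.+1%:R^-1) - k0 s).
pose N' := N `|` `]-oo, 0]%classic.
have mN' : measurable N' by exact: measurableU.
pose g s := if s \in N' then - kap else derive1 k s.
have good s : s \notin N' -> [/\ 0 < s, derivable k s 1, `|derive1 k s| <= h s &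
    s < r0 -> derive1 k s <= - kap].
  rewrite notin_setE => /not_orP[sN /negP]; rewrite /= in_itv/= -ltNge => s0.
  have [/(_ s0)[? _ ?] /(_ s0) ?] := contrapT (fun nH => sN (Nsub s nH)).
  by split.
exists g, h, kap, r0, C, delta; split => //.
- apply: (measurable_fun_cvg (h := fun n s => if s \in N' then - kap else D n s)) => //.
    move=> n; apply: measurable_fun_ifT => //.
      by apply: (measurable_fun_bool true); rewrite setTI preimage_mem_true.
    apply: measurable_funM => //; apply: measurable_funB.
      have mk0 := continuous_measurable_fun ck0.
      by apply: (measurableT_comp mk0); exact: measurable_funD.
    exact: continuous_measurable_fun.
  move=> s _; rewrite /g; case: (boolP (s \in N')) => [_|sN]; first exact: cvg_cst.
  have [s0 ds _ _] := good s sN.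
  have cv : h^-1 *: ((k \o shift s) (h *: 1) - k s) @[h --> 0^'] --> derive1 k s.
    by rewrite derive1E; exact: ds.
  have : D n s @[n --> \oo] --> derive1 k s.
    have E n : D n s = (n.+1%:R^-1)^-1 *: ((k \o shift s) (n.+1%:R^-1 *: (1 : R)) - k s).
      rewrite /D /k0 invrK /GRing.scale/= mulr1 [s + _]addrC !max_l ?(ltW s0)//.
      by rewrite addr_ge0 ?(ltW s0).
    rewrite (funext E); have /cvgr_dnbhsP/(_ (fun n => n.+1%:R^-1)) := cv.
    apply; split; last exact: cvg_harmonic.
    by move=> n; rewrite invr_eq0.
  by [].
- by move=> r; rewrite -lee_fin -kmaxE.
- move=> s s0; rewrite /g; case: (boolP (s \in N')) => [_|/good[]//].
  by rewrite normrN gtr0_norm// h_ge.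
- move=> s /andP[s0 sr]; rewrite /g; case: (boolP (s \in N')) => [_//|/good[_ _ _]]; exact.
- exists N; split => // s /=; apply: contra_notP => sN s0.
  have sN' : s \notin N'.
    rewrite notin_setE => -[//|]; rewrite /= in_itv/= leNgt s0//.
  by rewrite /g (negbTE sN'); have [] := good s sN'.
- by move=> r rp; rewrite -lee_fin -kmaxE growth.
Unshelve. all: by end_near. Qed.

End kernel_derivative.

(** * The gradient of the kernel *)

Section radial_gradient.
Context {R : realType} {d : nat}.
Local Notation V := 'rV[R]_d.
Local Notation leb := (@lebesgue_measure R).
Local Notation mu := (@lebesgue_rV R d).

Lemma is_derive_line (f : V -> R) (x v : V) (F : R -> R) (df : R) :
  (forall h, f (h *: v + x) = F h) -> is_derive (0 : R) 1 F df ->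
  is_derive x v f df.
Proof.
move=> fF [dF DF].
have E : (fun h => h^-1 *: ((f \o shift x) (h *: v) - f x)) =
         (fun h => h^-1 *: ((F \o shift (0 : R)) (h *: 1) - F 0)).
  apply/funext => h; rewrite /= addr0 -!fF scale0r add0r.
  by rewrite /GRing.scale/= mulr1.
by split; [rewrite /derivable E; exact: dF|rewrite /derive E; exact: DF].
Qed.

(** [partial i (radial k)] for a function [k] whose derivative is [g] *)
Definition radial_kernel (g : R -> R) (i : 'I_d) (z : V) : R :=
  g (enorm z) * (z ord0 i / enorm z).

(** Chain rule along the line through [z] in the [i]-th direction, on which the
    squared norm is a quadratic polynomial. *)
Lemma partial_radial (k : R -> R) (i : 'I_d) (z : V) : z != 0 ->
  derivable k (enorm z) 1 ->
  partial i (radial k) z = radial_kernel (derive1 k) i z.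
Proof.
move=> z0 dk; have ez := enorm_gt0 z0.
suff [_ H] : is_derive z (delta_mx ord0 i) (radial k) (radial_kernel (derive1 k) i z).
  exact: H.
pose q (h : R) := dotp z z + 2 * h * z ord0 i + h ^+ 2.
have dE h : dotp (h *: delta_mx ord0 i + z) (h *: delta_mx ord0 i + z) = q h.
  rewrite /q /dotp (bigD1 i)//= [in RHS](bigD1 i)//= !mxE !eqxx /=.
  rewrite (eq_bigr (fun j => z ord0 j * z ord0 j)); first by ring.
  by move=> j ij; rewrite !mxE eqxx (negbTE ij) /=; ring.
have q0 : q 0 = enorm z ^+ 2 by rewrite /q enorm_sqr; ring.
have dq : is_derive (0 : R) 1 q (2 * z ord0 i).
  apply: (@is_derive_quadratic _ _ _ _ _ _ 1) => h _.
  rewrite /q [h *: 1]mulr1 addr0 mul1r.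
  rewrite (_ : _ - _ = h ^+ 2); first by rewrite ger0_norm ?sqr_ge0.
  by ring.
have ds : is_derive (q 0) 1 (@Num.sqrt R) (2 * enorm z)^-1.
  have := @is_derive1_sqrt R (q 0).
  by rewrite q0 sqrtr_sqr ger0_norm ?enorm_ge0//; apply; rewrite exprn_gt0.
have dsq := is_derive1_comp ds dq.
have dk' : is_derive ((Num.sqrt \o q) 0) 1 k (derive1 k (enorm z)).
  rewrite /= q0 sqrtr_sqr ger0_norm ?enorm_ge0// derive1E.
  exact: derivableP.
have := is_derive1_comp dk' dsq.
set D := (X in is_derive _ _ _ X).
rewrite (_ : D = radial_kernel (derive1 k) i z); last first.
  by rewrite /D /radial_kernel; field; rewrite gt_eqF.
by apply: is_derive_line => h; rewrite /radial /enorm dE.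
Qed.

Lemma negligible_rV0 : (0 < d)%N -> mu.-negligible [set 0].
Proof.
move=> d0; have mA : forall i : 'I_d, measurable [set 0 : R] by move=> i; exact: measurable_set1.
have E : [set 0 : V] = [set x : V | forall i, [set 0 : R] (x ord0 i)].
  apply/seteqP; split => [x -> i|x H]; first by rewrite /= mxE.
  by apply/rowP => i; rewrite mxE; exact: H.
exists [set x : V | forall i, [set 0 : R] (x ord0 i)]; split; last by rewrite E.
  rewrite (_ : mkset _ = \bigcap_(i in [set: 'I_d]) [set x : V | [set 0 : R] (x ord0 i)]); last first.
    by apply/seteqP; split => [x + i _|x + i]; exact.
  apply: fin_bigcap_measurable => // i _; rewrite -[X in measurable X]setTI.
  exact: (measurable_coord_rV i).
rewrite (lebesgue_rV_box mA) (bigD1 (Ordinal d0))//=.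
by rewrite lebesgue_measure_set1 mul0e.
Qed.

Lemma ae_partial_radial (k g h : R -> R) (kap r0 C delta : R) (i : 'I_d) :
  kernel_bounds k g h kap r0 C delta ->
  {ae mu, forall z, radial_kernel g i z = partial i (radial k) z}.
Proof.
move=> kb; have d0 : (0 < d)%N by case: (i) => m /(leq_trans _); apply.
have H : {ae mu, forall z : V, z <> 0}.
  by apply: negligibleS (negligible_rV0 d0) => z /= /contrapT.
have aeF : Filter (almost_everywhere mu) by exact: ae_filter_ringOfSetsType.
have H2 := ae_enorm (n := d) (kb_deriv kb).
apply: filterS2 H H2 => z /eqP z0 /(_ z0)[dk E].
by rewrite partial_radial// /radial_kernel E.
Qed.

Lemma measurable_radial_kernel (g : R -> R) (i : 'I_d) d' (T : measurableType d') (w : T -> V) :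
  measurable_fun setT g ->
  (forall j, measurable_fun setT (fun t => w t ord0 j)) ->
  measurable_fun setT (fun t => radial_kernel g i (w t)).
Proof.
move=> mg mw; have me := measurable_enorm mw.
apply: measurable_funM; first exact: (measurableT_comp mg me).
apply: measurable_funM => //.
rewrite (_ : (fun t => _) = (fun t => enorm (w t) `^ (-1))); last first.
  by apply/funext => t; rewrite powR_inv1 ?enorm_ge0.
exact: (measurableT_comp (measurable_powR (-1)) me).
Qed.

(** Replacing the gradient of the kernel by a measurable version does not
    change the convolution. *)
Lemma velocityE (k g h : R -> R) (kap r0 C delta : R) (f : V -> R) x i :
  kernel_bounds k g h kap r0 C delta -> measurable_fun setT f ->
  velocity k f x ord0 i = \int[mu]_y (radial_kernel g i (x - y) * f y).
Proof.
move=> kb mf; rewrite /velocity mxE; apply: int_ae_eq.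
  apply: measurable_funM => //; apply: measurable_radial_kernel; first exact: kb_meas kb.
  by move=> j; under eq_fun do rewrite !mxE; apply: measurable_funB => //; exact: measurable_coord_rV.
have n1 : (-1 : R) != 0 by rewrite oppr_eq0 oner_eq0.
have := negligible_rV_affine x n1 (ae_partial_radial i kb).
apply: filterS => y; rewrite scaleN1r addrC => ->; by [].
Qed.

End radial_gradient.

(** * The aggregation drift *)

Section drift.
Context {R : realType} {d : nat}.
Local Notation V := 'rV[R]_d.
Local Notation mu := (@lebesgue_rV R d).
Local Notation mm := (mu \x mu)%E.
Variables (k g h : R -> R) (kap r0 C delta : R).
Hypothesis kb : kernel_bounds k g h kap r0 C delta.
Hypothesis d0 : (0 < d)%N.

(** The velocity at [x] generated by a unit mass at [y] is at most
    [reach x + reach y]. *)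
Definition reach (x : V) : R := h (2 * enorm x).

Lemma reach_ge0 x : 0 <= reach x.
Proof. exact: kb_ge0 kb _. Qed.

Lemma reachN x : reach (- x) = reach x.
Proof. by rewrite /reach enormN. Qed.

Lemma measurable_reach : measurable_fun setT reach.
Proof.
have mh : measurable_fun setT h by apply: nondecreasing_measurable => //; exact: kb_homo kb.
apply: (measurableT_comp mh); apply: measurable_funM => //.
by apply: measurable_enorm => i; exact: measurable_coord_rV.
Qed.

Lemma radial_kernel0 (i : 'I_d) : radial_kernel g i 0 = 0.
Proof. by rewrite /radial_kernel mxE mul0r mulr0. Qed.

Lemma radial_kernelN (i : 'I_d) (z : V) : radial_kernel g i (- z) = - radial_kernel g i z.
Proof. by rewrite /radial_kernel enormN mxE mulNr mulrN. Qed.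

(** [|x - y| <= 2 max(|x|, |y|)] *)
Lemma normr_radial_kernel_le (i : 'I_d) (x y : V) :
  `|radial_kernel g i (x - y)| <= reach x + reach y.
Proof.
have [->|z0] := eqVneq (x - y) 0.
  by rewrite radial_kernel0 normr0 addr_ge0 ?reach_ge0.
have ez := enorm_gt0 z0.
rewrite /radial_kernel normrM (@le_trans _ _ (`|g (enorm (x - y))| * 1))//.
  rewrite ler_wpM2l// normrM normfV (gtr0_norm ez) ler_pdivrMr// mul1r.
  exact: coord_le_enorm.
rewrite mulr1 (le_trans (kb_norm kb ez))//.
have := enorm_triangle x (- y); rewrite enormN => tri.
have [xy|xy] := leP (enorm x) (enorm y).
  apply: (@le_trans _ _ (reach y)); last by rewrite lerDr reach_ge0.
  by apply: (kb_homo kb); lra.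
apply: (@le_trans _ _ (reach x)); last by rewrite lerDl reach_ge0.
by apply: (kb_homo kb); lra.
Qed.

Variable f : V -> R.
Hypothesis f_ge0 : forall x, 0 <= f x.
Hypothesis f_even : forall x, f (- x) = f x.
Hypothesis Lf : L1 f.
Hypothesis Lhf : L1 (fun x => reach x * f x).

Local Notation M := (\int[mu]_x f x).
Local Notation H := (\int[mu]_x (reach x * f x)).

Let mf : measurable_fun setT f. Proof. exact: integrable_measurable Lf. Qed.

Let W (z : V * V) : R := (reach z.1 * f z.1) * f z.2 + f z.1 * (reach z.2 * f z.2).

Let LW : mm.-integrable setT (EFin \o W).
Proof.
exact: (integrable_add (integrable_tensor (m1 := mu) (m2 := mu) Lhf Lf)
  (integrable_tensor (m1 := mu) (m2 := mu) Lf Lhf)).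
Qed.

Let m1 i : measurable_fun setT (fun z : V * V => z.1 ord0 i).
Proof. exact: (measurableT_comp (measurable_coord_rV i) measurable_fst). Qed.

Let m2 i : measurable_fun setT (fun z : V * V => z.2 ord0 i).
Proof. exact: (measurableT_comp (measurable_coord_rV i) measurable_snd). Qed.

Let mf1 : measurable_fun setT (fun z : V * V => f z.1).
Proof. exact: (measurableT_comp mf measurable_fst). Qed.

Let mf2 : measurable_fun setT (fun z : V * V => f z.2).
Proof. exact: (measurableT_comp mf measurable_snd). Qed.

Let dominated (c : R) (Q : V * V -> R) : measurable_fun setT Q ->
  (forall z, `|Q z| <= c * (reach z.1 + reach z.2)) ->
  mm.-integrable setT (EFin \o (fun z => Q z * (f z.1 * f z.2))).
Proof.
move=> mQ Qle; apply: integrable_le (integrableZ c LW) _.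
  by apply: measurable_funM => //; exact: measurable_funM.
move=> z; rewrite normrM (ger0_norm (mulr_ge0 (f_ge0 _) (f_ge0 _))).
apply: (@le_trans _ _ (c * (reach z.1 + reach z.2) * (f z.1 * f z.2))).
  by rewrite ler_wpM2r// mulr_ge0.
by rewrite /W le_eqVlt; apply/orP; left; apply/eqP; ring.
Qed.

Let int_W : \int[mm]_z W z = 2 * M * H.
Proof.
have i1 := integrable_tensor (m1 := mu) (m2 := mu) Lhf Lf.
have i2 := integrable_tensor (m1 := mu) (m2 := mu) Lf Lhf.
rewrite RintegralD// -(Rintegral_prod1 i1) -(Rintegral_prod1 i2)/=.
under eq_Rintegral do rewrite RintegralZl//.
under [X in _ + X]eq_Rintegral do rewrite RintegralZl//.
rewrite !RintegralZr//; ring.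
Qed.

(** The contribution of the aggregation term to the time derivative of the
    integral of [min(|x_i|, a)]. *)
Definition drift (a : R) (i : 'I_d) : R :=
  \int[mu]_x (min_slope a (x ord0 i) * flux k f x ord0 i).

Let D (a : R) (i : 'I_d) (z : V * V) : R :=
  min_slope a (z.1 ord0 i) * radial_kernel g i (z.1 - z.2).

Let mD a i : measurable_fun setT (D a i).
Proof.
apply: measurable_funM; first exact: (measurableT_comp (measurable_min_slope a) (m1 i)).
apply: measurable_radial_kernel; first exact: kb_meas kb.
by move=> j; under eq_fun do rewrite !mxE; exact: measurable_funB.
Qed.

Let normr_D_le a i z : 0 < a -> `|D a i z| <= 1 * (reach z.1 + reach z.2).
Proof.
move=> a0; rewrite /D normrM ler_pM ?normr_min_slope_le1//.
exact: normr_radial_kernel_le.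
Qed.

Let driftE a i : 0 < a ->
  drift a i = \int[mm]_z (D a i z * (f z.1 * f z.2)).
Proof.
move=> a0; rewrite -Rintegral_prod1; last first.
  by apply: (dominated (c := 1)) => // z; exact: normr_D_le.
apply: eq_Rintegral => x _; rewrite /flux mxE (velocityE x i kb mf).
rewrite mulrA -RintegralZl//.
  by apply: eq_Rintegral => y _; rewrite /D /=; ring.
rewrite (_ : (fun y => _) = (fun y => radial_kernel g i (x - y) * f y))//.
apply: integrable_le (integrable_add (integrableZ (reach x) Lf) Lhf) _.
  apply: measurable_funM => //; apply: measurable_radial_kernel; first exact: kb_meas kb.
  by move=> j; under eq_fun do rewrite !mxE; apply: measurable_funB => //; exact: measurable_coord_rV.
move=> y; rewrite normrM (ger0_norm (f_ge0 y)) -mulrDl ler_wpM2r//.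
exact: normr_radial_kernel_le.
Qed.

Lemma normr_drift_le a i : 0 < a -> `|drift a i| <= 2 * M * H.
Proof.
move=> a0; rewrite driftE// -int_W.
have iD : mm.-integrable setT (EFin \o (fun z => D a i z * (f z.1 * f z.2))).
  by apply: (dominated (c := 1)) => // z; exact: normr_D_le.
apply: int_norm_le => //; first exact: integrable_measurable iD.
move=> z; rewrite normrM (ger0_norm (mulr_ge0 (f_ge0 _) (f_ge0 _))).
apply: (@le_trans _ _ (1 * (reach z.1 + reach z.2) * (f z.1 * f z.2))).
  by rewrite ler_wpM2r ?normr_D_le// mulr_ge0.
by rewrite /W le_eqVlt; apply/orP; left; apply/eqP; ring.
Qed.

Let int_swap (c : R) (Q : V * V -> R) : measurable_fun setT Q ->
  (forall z, `|Q z| <= c * (reach z.1 + reach z.2)) ->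
  \int[mm]_z (Q (z.2, z.1) * (f z.1 * f z.2)) = \int[mm]_z (Q z * (f z.1 * f z.2)).
Proof.
move=> mQ Qle; have iQ := dominated mQ Qle.
have mQ' : measurable_fun setT (fun z : V * V => Q (z.2, z.1)).
  by apply: (measurableT_comp mQ); apply/measurable_fun_pairP; split;
    [exact: measurable_snd|exact: measurable_fst].
have iQ' := dominated (c := c) mQ' (fun z => _).
rewrite -Rintegral_prod1; last by apply: iQ' => z; rewrite addrC; exact: (Qle (z.2, z.1)).
rewrite -(Rintegral_prod2 iQ).
by apply: eq_Rintegral => x _; apply: eq_Rintegral => y _ /=; ring.
Qed.

Let int_opp (c : R) (Q : V * V -> R) : measurable_fun setT Q ->
  (forall z, `|Q z| <= c * (reach z.1 + reach z.2)) ->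
  \int[mm]_z (Q (z.1, - z.2) * (f z.1 * f z.2)) = \int[mm]_z (Q z * (f z.1 * f z.2)).
Proof.
move=> mQ Qle; have iQ := dominated mQ Qle.
have mQ' : measurable_fun setT (fun z : V * V => Q (z.1, - z.2)).
  apply: (measurableT_comp mQ); apply/measurable_fun_pairP; split.
    exact: measurable_fst.
  apply: measurable_fun_rV => i; under eq_fun do rewrite mxE.
  exact: measurableT_comp.
have iQ' := dominated (c := c) mQ' (fun z => _).
rewrite -Rintegral_prod1; last first.
  by apply: iQ' => z; have := Qle (z.1, - z.2); rewrite /= reachN.
rewrite -(Rintegral_prod1 iQ).
apply: eq_Rintegral => x _ /=.
rewrite -(Rintegral_rV_opp (f := fun y => Q (x, y) * (f x * f y))).
  by apply: eq_Rintegral => y _; rewrite f_even.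
apply: measurable_funM; first exact: (measurable_fun_pair2 (f := Q)).
exact: measurable_funM.
Qed.

(** The pair interaction summed over the exchange of the two points and the
    reflection of one of them: integration against an even function does not
    distinguish these four configurations. *)
Let sym (a : R) (z : V * V) : R :=
  (\sum_i D a i z + \sum_i D a i (z.2, z.1)) +
  (\sum_i D a i (z.1, - z.2) + \sum_i D a i (z.2, - z.1)).

Let Q (a : R) (z : V * V) := \sum_i D a i z.

Let normr_Q a z : 0 < a -> `|Q a z| <= d%:R * (reach z.1 + reach z.2).
Proof.
move=> a0; rewrite /Q (le_trans (ler_norm_sum _ _ _))//.
apply: (@le_trans _ _ (\sum_(i < d) (1 * (reach z.1 + reach z.2)))).
  by apply: ler_sum => i _; exact: normr_D_le.
by rewrite sumr_const card_ord mul1r mulr_natl.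
Qed.

Let mQ a : measurable_fun setT (Q a).
Proof. by apply: measurable_sum => i; exact: mD. Qed.

Let normr_sym a z : 0 < a -> `|sym a z| <= 4 * d%:R * (reach z.1 + reach z.2).
Proof.
move=> a0; have := normr_Q z a0; have := normr_Q (z.2, z.1) a0.
have := normr_Q (z.1, - z.2) a0; have := normr_Q (z.2, - z.1) a0.
rewrite /= !reachN /sym -!/(Q a _) !ler_norml.
by move=> /andP[? ?] /andP[? ?] /andP[? ?] /andP[? ?]; apply/andP; split; lra.
Qed.

Let mswap (P : V * V -> R) : measurable_fun setT P ->
  measurable_fun setT (fun z : V * V => P (z.2, z.1)).
Proof.
by move=> mP; apply: (measurableT_comp mP); apply/measurable_fun_pairP; split;
  [exact: measurable_snd|exact: measurable_fst].
Qed.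

Let mopp (P : V * V -> R) : measurable_fun setT P ->
  measurable_fun setT (fun z : V * V => P (z.1, - z.2)).
Proof.
move=> mP; apply: (measurableT_comp mP); apply/measurable_fun_pairP; split.
  exact: measurable_fst.
apply: measurable_fun_rV => i; under eq_fun do rewrite mxE.
exact: measurableT_comp.
Qed.

Let sum_drift a : 0 < a ->
  mm.-integrable setT (EFin \o (fun z => sym a z * (f z.1 * f z.2))) /\
  4 * \sum_i drift a i = \int[mm]_z (sym a z * (f z.1 * f z.2)).
Proof.
move=> a0.
have n1 z := normr_Q z a0.
have n2 z : `|Q a (z.2, z.1)| <= d%:R * (reach z.1 + reach z.2).
  by rewrite addrC; exact: n1.
have n3 z : `|Q a (z.1, - z.2)| <= d%:R * (reach z.1 + reach z.2).
  by have := n1 (z.1, - z.2); rewrite /= reachN.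
have n4 z : `|Q a (z.2, - z.1)| <= d%:R * (reach z.1 + reach z.2).
  by rewrite addrC; exact: (n3 (z.2, z.1)).
have mq1 := mQ a; have mq2 := mswap mq1; have mq3 := mopp mq1; have mq4 := mswap mq3.
have i1 := dominated mq1 n1; have i2 := dominated mq2 n2.
have i3 := dominated mq3 n3; have i4 := dominated mq4 n4.
have symE : (fun z => sym a z * (f z.1 * f z.2)) = (fun z =>
    (Q a z * (f z.1 * f z.2) + Q a (z.2, z.1) * (f z.1 * f z.2)) +
    (Q a (z.1, - z.2) * (f z.1 * f z.2) + Q a (z.2, - z.1) * (f z.1 * f z.2))).
  by apply/funext => z; rewrite /sym /Q; ring.
have i12 := integrable_add i1 i2; have i34 := integrable_add i3 i4.
rewrite symE; split; first exact: integrable_add.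
rewrite RintegralD// RintegralD// RintegralD//.
have -> : \int[mm]_z (Q a (z.2, - z.1) * (f z.1 * f z.2)) =
    \int[mm]_z (Q a (z.1, - z.2) * (f z.1 * f z.2)) := int_swap mq3 n3.
rewrite (int_opp mq1 n1) (int_swap mq1 n1).
have -> : \sum_i drift a i = \int[mm]_z (Q a z * (f z.1 * f z.2)).
  rewrite (eq_bigr (fun i => \int[mm]_z (D a i z * (f z.1 * f z.2)))); last first.
    by move=> i _; exact: driftE.
  rewrite -int_sum; last first.
    by move=> i; apply: (dominated (c := 1)) => // z; exact: normr_D_le.
  by apply: eq_Rintegral => z _; rewrite /Q mulr_suml.
by ring.
Qed.

(** Chosen so that two points of the cube of half-width [base_scale] are at
    distance less than [r0], the range where the kernel attracts. *)
Definition base_scale : R := r0 / (4 * d%:R).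

Definition outside (rho : R) (x : V) : R := [exists i, rho <= `|x ord0 i|]%:R.

Lemma base_scale_gt0 : 0 < base_scale.
Proof. by rewrite divr_gt0 ?(kb_r0 kb)// mulr_gt0 ?ltr0n. Qed.

Lemma outside01 rho x : 0 <= outside rho x <= 1.
Proof. by rewrite /outside ler0n lern1 leq_b1. Qed.

Lemma measurable_outside rho : measurable_fun setT (outside rho).
Proof.
rewrite (_ : outside rho = (fun x => if [exists i, rho <= `|x ord0 i|] then 1 else 0)); last first.
  by apply/funext => x; rewrite /outside; case: ifP.
apply: measurable_fun_ifT => //; apply: (measurable_fun_bool true).
rewrite setTI (_ : _ @^-1` _ = \bigcup_(i in [set: 'I_d]) [set x : V | rho <= `|x ord0 i|]); last first.
  apply/seteqP; split => [x /= /existsP[i xi]|x [i _ /= xi]]; first by exists i.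
  by apply/existsP; exists i.
apply: fin_bigcup_measurable => // i _.
have mn : measurable_fun setT (fun x : V => `|x ord0 i|).
  exact: (measurableT_comp (@normr_measurable R setT) (measurable_coord_rV i)).
rewrite (_ : mkset _ = setT `&` (fun x : V => `|x ord0 i|) @^-1` `[rho, +oo[%classic); last first.
  by apply/seteqP; split => x /=; rewrite in_itv/= andbT // => -[].
by apply: mn => //; exact: measurable_itv.
Qed.

Lemma enorm_inside x : outside base_scale x = 0 -> enorm x <= r0 / 4.
Proof.
rewrite /outside => /eqP; rewrite pnatr_eq0 eqb0 => /existsPn H.
rewrite (le_trans (enorm_le_sum x))// (@le_trans _ _ (\sum_(i < d) base_scale))//.
  by apply: ler_sum => i _; apply: ltW; rewrite ltNge; exact: H.
rewrite sumr_const card_ord /base_scale -mulr_natr le_eqVlt; apply/orP; left; apply/eqP.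
by field; rewrite pnatr_eq0 -lt0n.
Qed.

(** If the field [c] points away from the origin, the attractive radial force
    works against it; dividing by any [s >= |z|] instead of [|z|] weakens the
    bound. *)
Let radial_sum (c : 'I_d -> R) (z : V) (s : R) : 0 < s -> enorm z <= s ->
  0 <= \sum_i c i * z ord0 i -> (0 < enorm z -> g (enorm z) <= - kap) ->
  \sum_i c i * radial_kernel g i z <= - kap * ((\sum_i c i * z ord0 i) / s).
Proof.
move=> s0 zs A0 gz; have [->|z0] := eqVneq z 0.
  rewrite !big1 ?mul0r ?mulr0// => i _; first by rewrite mxE mulr0.
  by rewrite radial_kernel0 mulr0.
have ez := enorm_gt0 z0.
rewrite (eq_bigr (fun i => (g (enorm z) / enorm z) * (c i * z ord0 i))); last first.
  by move=> i _; rewrite /radial_kernel; ring.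
rewrite -mulr_sumr; set A := \sum_i _ in A0 *.
rewrite [leRHS](_ : _ = (- kap / s) * A); last by ring.
rewrite ler_wpM2r// (@le_trans _ _ (- kap / enorm z))//.
  by rewrite ler_pM2r ?invr_gt0// gz.
by rewrite !mulNr lerN2 ler_pM2l ?(kb_kap kb)// lef_pV2 ?posrE.
Qed.

Lemma sgr_mul_le (u v : R) : Num.sg u * v <= `|v|.
Proof.
rewrite (le_trans (ler_norm _))// normrM normr_sg.
by case: (u != 0); rewrite ?mul1r ?mul0r.
Qed.

(** Inside the small cube the slopes are the signs of the coordinates, and the
    symmetrized interaction is the sum of the forces along [x - y] and along
    [x + y], both attractive, working against [sg x - sg y] and [sg x + sg y]. The
    two works add up to [2 (|x|_1 + |y|_1)], which is at least twice
    [|x| + |y|]: this is where evenness is used, since either one alone may vanish.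
    The indicator of the origin covers the pair [(0, 0)], the only one without
    interaction. *)
Let sym_le a x y : base_scale <= a ->
  sym a (x, y) <= - (2 * kap * ((1 - outside base_scale x) * (1 - outside base_scale y)))
    + 4 * d%:R * ((outside base_scale x + outside base_scale y) * (reach x + reach y))
    + 2 * kap * (x == 0)%:R.
Proof.
move=> rho_a; have a0 := lt_le_trans base_scale_gt0 rho_a.
have kap0 := kb_kap kb.
have rr : 0 <= reach x + reach y by rewrite addr_ge0 ?reach_ge0.
have z0 : 0 <= 2 * kap * (x == 0)%:R by rewrite mulr_ge0 ?ler0n// mulr_ge0// ltW.
have big_case : 1 <= outside base_scale x + outside base_scale y ->
    (1 - outside base_scale x) * (1 - outside base_scale y) = 0 ->
    sym a (x, y) <= - (2 * kap * ((1 - outside base_scale x) * (1 - outside base_scale y)))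
    + 4 * d%:R * ((outside base_scale x + outside base_scale y) * (reach x + reach y))
    + 2 * kap * (x == 0)%:R.
  move=> o1 ->; rewrite mulr0 oppr0 add0r.
  apply: (@le_trans _ _ (4 * d%:R * (reach x + reach y))).
    by rewrite (le_trans (ler_norm _))//; exact: normr_sym.
  rewrite -[leLHS]addr0 lerD// ler_wpM2l ?mulr_ge0//.
  by rewrite -[leLHS]mul1r ler_wpM2r.
have [ox|ox] := boolP [exists i, base_scale <= `|x ord0 i|].
  apply: big_case; rewrite {1}/outside ox/=; last by rewrite subrr mul0r.
  by rewrite lerDl; case/andP: (outside01 base_scale y).
have [oy|oy] := boolP [exists i, base_scale <= `|y ord0 i|].
  apply: big_case; rewrite {2}/outside oy/=; last by rewrite subrr mulr0.
  by rewrite lerDr; case/andP: (outside01 base_scale x).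
have ox0 : outside base_scale x = 0 by rewrite /outside (negbTE ox).
have oy0 : outside base_scale y = 0 by rewrite /outside (negbTE oy).
rewrite ox0 oy0 addr0 mul0r mulr0 addr0 subr0 !mulr1.
have ex := enorm_inside ox0; have ey := enorm_inside oy0.
have r00 := kb_r0 kb.
have slope (z : V) i : ~~ [exists i, base_scale <= `|z ord0 i|] ->
    min_slope a (z ord0 i) = Num.sg (z ord0 i).
  move=> /existsPn/(_ i); rewrite -ltNge => zi.
  by rewrite min_slopeE// (ltW (lt_le_trans zi rho_a)).
have [xy0|xy0] := eqVneq (enorm x + enorm y) 0.
  have x0 : x = 0 by apply: enorm_eq0; have := enorm_ge0 x; have := enorm_ge0 y; lra.
  have y0 : y = 0 by apply: enorm_eq0; have := enorm_ge0 x; have := enorm_ge0 y; lra.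
  have E (c : 'I_d -> R) : \sum_i c i * radial_kernel g i 0 = 0.
    by rewrite big1// => i _; rewrite radial_kernel0 mulr0.
  by rewrite x0 y0 eqxx mulr1 addNr /sym /D /= !oppr0 !addr0 !E !addr0 lexx.
have s0 : 0 < enorm x + enorm y by rewrite lt_def xy0 addr_ge0 ?enorm_ge0.
apply: (@le_trans _ _ (- (2 * kap))); last by rewrite lerDl.
have symE : sym a (x, y) =
    \sum_i (Num.sg (x ord0 i) - Num.sg (y ord0 i)) * radial_kernel g i (x - y) +
    \sum_i (Num.sg (x ord0 i) + Num.sg (y ord0 i)) * radial_kernel g i (x + y).
  rewrite /sym -!big_split/=; apply: eq_bigr => i _.
  rewrite /D/= !opprK -(opprB x y) radial_kernelN [y + x]addrC !slope//; ring.
have bound (z : V) : enorm z <= enorm x + enorm y -> 0 < enorm z -> g (enorm z) <= - kap.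
  by move=> zs ez; apply: (kb_neg kb); rewrite ez /=; lra.
have tri1 := enorm_triangle x (- y); rewrite enormN in tri1.
have tri2 := enorm_triangle x y.
have A1 : 0 <= \sum_i (Num.sg (x ord0 i) - Num.sg (y ord0 i)) * (x - y) ord0 i.
  apply: sumr_ge0 => i _; rewrite !mxE.
  have := sgr_mul_le (x ord0 i) (y ord0 i); have := sgr_mul_le (y ord0 i) (x ord0 i).
  by rewrite mulrBl !mulrBr -!normrEsg; lra.
have A2 : 0 <= \sum_i (Num.sg (x ord0 i) + Num.sg (y ord0 i)) * (x + y) ord0 i.
  apply: sumr_ge0 => i _; rewrite !mxE.
  have := sgr_mul_le (x ord0 i) (- y ord0 i); have := sgr_mul_le (y ord0 i) (- x ord0 i).
  by rewrite !normrN !mulrN mulrDl !mulrDr -!normrEsg; lra.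
have S1 := radial_sum s0 tri1 A1 (bound _ tri1).
have S2 := radial_sum s0 tri2 A2 (bound _ tri2).
have A12 : 2 * (enorm x + enorm y) <=
   \sum_i (Num.sg (x ord0 i) - Num.sg (y ord0 i)) * (x - y) ord0 i +
   \sum_i (Num.sg (x ord0 i) + Num.sg (y ord0 i)) * (x + y) ord0 i.
  rewrite -big_split/=.
  rewrite (eq_bigr (fun i => 2 * `|x ord0 i| + 2 * `|y ord0 i|)); last first.
    by move=> i _; rewrite !mxE !normrEsg; ring.
  rewrite big_split/= -!mulr_sumr mulrDr.
  by rewrite lerD// ler_pM2l// enorm_le_sum.
rewrite symE (le_trans (lerD S1 S2))// -mulrDr -mulrDl mulNr lerN2 mulrC ler_pM2l//.
by rewrite ler_pdivlMr.
Qed.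

Local Notation O := (\int[mu]_x (outside base_scale x * f x)).
Local Notation Z := (\int[mu]_x (outside base_scale x * (reach x * f x))).

Lemma integrable_outside rho (p : V -> R) : L1 p -> L1 (fun x => outside rho x * p x).
Proof.
move=> Lp; apply: (integrable_bdMl (C := 1)) => //; first exact: measurable_outside.
by move=> x; have /andP[oge ole] := outside01 rho x; rewrite ger0_norm.
Qed.

Lemma int_reach_le : H <= h r0 * M + Z.
Proof.
have Lz := integrable_outside base_scale Lhf.
rewrite -RintegralZl// -RintegralD//; last exact: integrableZ.
apply: int_le => //; first by apply: integrable_add => //; exact: integrableZ.
move=> x; have [ox|ox] := boolP [exists i, base_scale <= `|x ord0 i|].
  by rewrite {1}/outside ox mul1r lerDr mulr_ge0// (kb_ge0 kb).
have ox0 : outside base_scale x = 0 by rewrite /outside (negbTE ox).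
rewrite ox0 mul0r addr0 ler_wpM2r//; apply: (kb_homo kb).
by have := enorm_inside ox0; have := kb_r0 kb; lra.
Qed.

Let int_tensor (p q : V -> R) : L1 p -> L1 q ->
  \int[mm]_z (p z.1 * q z.2) = \int[mu]_x p x * \int[mu]_x q x.
Proof.
move=> Lp Lq; rewrite -(Rintegral_prod1 (integrable_tensor (m1 := mu) (m2 := mu) Lp Lq))/=.
by under eq_Rintegral do rewrite RintegralZl//; rewrite RintegralZr.
Qed.

(** Integration of the pointwise bound: [(M - O)^2] is the mass of pairs inside
    the cube, and the other pairs contribute at most the reach. *)
Lemma sum_drift_le a : base_scale <= a ->
  \sum_i drift a i <= - (kap / 2) * (M - O) ^+ 2 + 2 * d%:R * (M * (2 * Z + h r0 * O)).
Proof.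
move=> rho_a; have a0 := lt_le_trans base_scale_gt0 rho_a.
have [isym E4] := sum_drift a0.
pose origin (x : V) : R := if enorm x <= 0 then 1 else 0.
have Lo := integrable_outside base_scale Lf.
have Lz := integrable_outside base_scale Lhf.
have Li : L1 (fun x : V => f x - outside base_scale x * f x) by exact: integrable_sub.
have L0 : L1 (fun x => origin x * f x).
  apply: (integrable_bdMl (C := 1)) => //.
    apply: measurable_fun_ifT => //; apply: measurable_fun_ler => //.
    by apply: measurable_enorm => i; exact: measurable_coord_rV.
  by move=> x; rewrite /origin; case: ifP; rewrite ?normr1 ?normr0.
have int0 : \int[mu]_x (origin x * f x) = 0.
  rewrite (int_ae_eq (f := fun=> 0)); last first.
  - have nz : {ae mu, forall z : V, z <> 0}.
      by apply: negligibleS (negligible_rV0 d0) => z /= /contrapT.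
    have aeF : Filter (almost_everywhere mu) by exact: ae_filter_ringOfSetsType.
    apply: filterS nz => x /eqP x0.
    by rewrite /origin leNgt enorm_gt0// mul0r.
  - exact: measurable_cst.
  by rewrite /Rintegral integral0.
have t1 := integrable_tensor (m1 := mu) (m2 := mu) Li Li.
have t2 := integrable_tensor (m1 := mu) (m2 := mu) Lz Lf.
have t3 := integrable_tensor (m1 := mu) (m2 := mu) Lo Lhf.
have t4 := integrable_tensor (m1 := mu) (m2 := mu) Lhf Lo.
have t5 := integrable_tensor (m1 := mu) (m2 := mu) Lf Lz.
have t6 := integrable_tensor (m1 := mu) (m2 := mu) L0 Lf.
have t25 := integrable_add (integrable_add t2 t3) (integrable_add t4 t5).
have s1 := integrableZ (- (2 * kap)) t1.
have s2 := integrableZ (4 * d%:R) t25.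
have s3 := integrableZ (2 * kap) t6.
have s12 := integrable_add s1 s2.
have s := integrable_add s12 s3.
have : 4 * \sum_i drift a i <= - (2 * kap) * ((M - O) * (M - O)) +
    4 * d%:R * ((Z * M + O * H) + (H * O + M * Z)) + 2 * kap * (0 * M).
  have <- : \int[mm]_z (- (2 * kap) * ((f z.1 - outside base_scale z.1 * f z.1) *
        (f z.2 - outside base_scale z.2 * f z.2)) +
      4 * d%:R * ((outside base_scale z.1 * (reach z.1 * f z.1) * f z.2 +
          outside base_scale z.1 * f z.1 * (reach z.2 * f z.2)) +
        (reach z.1 * f z.1 * (outside base_scale z.2 * f z.2) +
          f z.1 * (outside base_scale z.2 * (reach z.2 * f z.2)))) +
      2 * kap * (origin z.1 * f z.1 * f z.2)) =
      - (2 * kap) * ((M - O) * (M - O)) +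
      4 * d%:R * ((Z * M + O * H) + (H * O + M * Z)) + 2 * kap * (0 * M).
    rewrite (RintegralD measurableT s12 s3) (RintegralD measurableT s1 s2).
    rewrite (RintegralZl _ measurableT t1) (RintegralZl _ measurableT t25) (RintegralZl _ measurableT t6).
    rewrite (RintegralD measurableT (integrable_add t2 t3) (integrable_add t4 t5)).
    rewrite (RintegralD measurableT t2 t3) (RintegralD measurableT t4 t5).
    rewrite (int_tensor Li Li) (int_tensor Lz Lf) (int_tensor Lo Lhf) (int_tensor Lhf Lo).
    by rewrite (int_tensor Lf Lz) (int_tensor L0 Lf) int0 RintegralB.
  rewrite E4.
  apply: int_le => // -[x y] /=.
  have := sym_le x y rho_a.
  have -> : (x == 0)%:R = origin x.
    rewrite /origin; have [->|x0] := eqVneq x 0; first by rewrite enorm0 lexx.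
    by rewrite leNgt enorm_gt0.
  move=> /(ler_wpM2r (mulr_ge0 (f_ge0 x) (f_ge0 y)))/le_trans; apply.
  by rewrite le_eqVlt; apply/orP; left; apply/eqP; ring.
have O0 : 0 <= O.
  by apply: Rintegral_ge0 => x _; rewrite mulr_ge0.
have := int_reach_le => HZ.
have OM : O <= M.
  apply: int_le => // x; have /andP[? ole] := outside01 base_scale x.
  by rewrite -[leRHS]mul1r ler_wpM2r.
have Z0 : 0 <= Z.
  by apply: Rintegral_ge0 => x _; rewrite !mulr_ge0 ?reach_ge0.
have dd : 0 < d%:R :> R by rewrite ltr0n.
have OH : O * H <= M * Z + h r0 * (O * M).
  rewrite (@le_trans _ _ (O * (h r0 * M + Z)))// ?ler_wpM2l//.
  rewrite mulrDr addrC mulrCA lerD// ler_wpM2r//.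
have := ler_wpM2l (ltW dd) OH.
nra.
Qed.

End drift.

(** * Evolution of the truncated moments *)

Section moments.
Context {R : realType} {d : nat}.
Local Notation V := 'rV[R]_d.
Local Notation mu := (@lebesgue_rV R d).
Variables (nu alpha : R) (k : R -> R) (u0 : V -> R) (T : R) (u : R -> V -> R).
Hypothesis alpha01 : 0 < alpha < 1.
Hypothesis sol : solution nu alpha k u0 T u.

Definition moment (a : R) (i : 'I_d) (f : V -> R) : R :=
  \int[mu]_x (Num.min `|x ord0 i| a * f x).

Lemma min_normr_bound (a s : R) : 0 < a -> `|Num.min `|s| a| <= a.
Proof.
by move=> a0; rewrite ger0_norm ?le_min ?normr_ge0 ?(ltW a0)// ge_min lexx orbT.
Qed.

Lemma measurable_min_coord (a : R) (i : 'I_d) :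
  measurable_fun setT (fun x : V => Num.min `|x ord0 i| a).
Proof.
apply: measurable_minr => //.
exact: (measurableT_comp (@normr_measurable R setT) (measurable_coord_rV i)).
Qed.

Lemma integrable_moment a i (f : V -> R) : 0 < a -> L1 f ->
  L1 (fun x => Num.min `|x ord0 i| a * f x).
Proof.
move=> a0 Lf; apply: (integrable_bdMl (C := a)) => //; first exact: measurable_min_coord.
by move=> x; exact: min_normr_bound.
Qed.

Lemma normr_momentB_le a i (f g : V -> R) : 0 < a -> L1 f -> L1 g ->
  `|moment a i f - moment a i g| <= a * L1dist f g.
Proof.
move=> a0 Lf Lg; have Lfg := integrable_sub Lf Lg.
rewrite /moment -RintegralB//; try exact: integrable_moment.
rewrite /L1dist -RintegralZl//; last exact: (integrable_norm Lfg).
apply: int_norm_le.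
- by apply: measurable_funB; apply: integrable_measurable (integrable_moment i a0 _).
- by apply: integrableZ; exact: (integrable_norm Lfg).
by move=> x; rewrite -mulrBr normrM ler_wpM2r// min_normr_bound.
Qed.

(** A bounded function may be integrated against the equation. *)
Lemma is_derive_moment a i t : 0 < a -> 0 < t < T ->
  is_derive t 1 (fun t => moment a i (u t))
    (nu * \int[mu]_x (frac_min alpha a (x ord0 i) * u t x) + drift k (u t) a i).
Proof.
move=> a0 tT; have /andP[t0 tT'] := tT.
have tT0 : 0 <= t < T by rewrite ltW.
have Lu := sol_L1 sol tT0.
have [dtu [lap [div [[Ldtu dlim] fl dv eqn]]]] := sol_equation sol tT.
have [Llap _] := fl; have [_ Ldiv _] := dv.
have -> : nu * \int[mu]_x (frac_min alpha a (x ord0 i) * u t x) + drift k (u t) a i =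
    moment a i dtu.
  have e1 := int_fraclap_min alpha01 i Lu fl a0.
  have e2 := int_divergence_min i a0 dv.
  have : moment a i dtu + nu * moment a i lap + moment a i div = 0.
    have i1 := integrable_moment i a0 Ldtu; have i2 := integrable_moment i a0 Llap.
    have i3 := integrable_moment i a0 Ldiv.
    rewrite /moment -RintegralZl// -RintegralD//; last exact: integrableZ.
    rewrite -RintegralD//; last by apply: integrable_add => //; exact: integrableZ.
    rewrite (int_ae_eq (f := fun=> 0)); last first.
    - have aeF : Filter (almost_everywhere mu) by exact: ae_filter_ringOfSetsType.
      apply: filterS eqn => x E.
      transitivity (Num.min `|x ord0 i| a * (dtu x + nu * lap x + div x)).
        by rewrite E mulr0.
      by ring.
    - exact: measurable_cst.
    by rewrite /Rintegral integral0.
  by rewrite /drift {2 3}/moment e1 e2; lra.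
suff cv : h^-1 *: (((fun t => moment a i (u t)) \o shift t) (h *: 1) - moment a i (u t)) @[h --> 0^']
    --> moment a i dtu.
  by split; [apply/cvg_ex; exists (moment a i dtu)|exact: cvg_lim cv].
apply/cvgrPdist_le => e e0; near=> h.
have h0 : h != 0 by near: h; exact: nbhs_dnbhs_neq.
have hT : 0 <= t + h < T.
  have h1 : `|h| <= Num.min t ((T - t) / 2).
    near: h; apply: nbhs_dnbhs; apply/nbhs_normP.
    exists (Num.min t ((T - t) / 2)) => /=; first by rewrite lt_min t0 divr_gt0// subr_gt0.
    by move=> y /=; rewrite sub0r normrN => /ltW.
  move: h1; rewrite le_min ler_norml => /andP[/andP[? ?]]; rewrite ler_norml => /andP[? ?].
  by apply/andP; split; lra.
have Luh := sol_L1 sol hT.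
rewrite /= [h *: 1]mulr1 [h + t]addrC.
have -> : h^-1 *: (moment a i (u (t + h)) - moment a i (u t)) =
    moment a i (fun x => h^-1 * (u (t + h) x - u t x)).
  rewrite /moment /GRing.scale/= -RintegralB//; try exact: integrable_moment.
  rewrite -RintegralZl//; last by apply: integrable_sub; exact: integrable_moment.
  by apply: eq_Rintegral => x _; ring.
rewrite distrC.
have Ld : L1 (fun x => h^-1 * (u (t + h) x - u t x)).
  by apply: integrableZ; exact: integrable_sub.
apply: le_trans (normr_momentB_le i a0 Ld Ldtu) _.
have : `|0 - L1dist (fun x => h^-1 * (u (t + h) x - u t x)) dtu| <= e / a.
  by near: h; move/cvgrPdist_le : dlim; apply; rewrite divr_gt0.
rewrite sub0r normrN => /(le_trans (ler_norm _)).
by rewrite ler_pdivlMr// mulrC.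
Unshelve. all: by end_near. Qed.

Lemma continuous_moment a i s : 0 < a -> 0 < s < T ->
  {within `[0, s], continuous (fun t => moment a i (u t))}.
Proof.
move=> a0 /andP[s0 sT]; have T0 := lt_trans s0 sT.
have cont t : 0 < t < T -> {for t, continuous (fun t => moment a i (u t))}.
  move=> tT; apply/differentiable_continuous/derivable1_diffP.
  by have [] := is_derive_moment i a0 tT.
apply/(continuous_within_itvP _ s0); split.
- move=> t; rewrite in_itv/= => /andP[t0 ts]; apply: cont.
  by rewrite t0 (lt_trans ts).
- have := sol_continuous sol (introT andP (conj (lexx 0) T0)) => /cvgrPdist_le H.
  have L0 := sol_L1 sol (introT andP (conj (lexx 0) T0)).
  apply/cvgrPdist_le => e e0; have := H (e / a) (divr_gt0 e0 a0).
  rewrite near_withinE => H'.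
  near=> t.
  have t0 : 0 < t by near: t; exact: nbhs_right_gt.
  have tT : t < T by near: t; exact: nbhs_right_lt.
  have Lt := sol_L1 sol (introT andP (conj (ltW t0) tT)).
  rewrite distrC; apply: le_trans (normr_momentB_le i a0 Lt L0) _.
  have : `|0 - L1dist (u t) (u 0)| <= e / a.
    have : t \in `[0, T[ -> `|0 - L1dist (u t) (u 0)| <= e / a.
      by near: t; apply: cvg_within; exact: H'.
    by apply; rewrite in_itv/= (ltW t0).
  rewrite sub0r normrN => /(le_trans (ler_norm _)).
  by rewrite ler_pdivlMr// mulrC.
- by apply: cvg_at_left_filter; apply: cont; rewrite s0.
Unshelve. all: by end_near. Qed.

End moments.

(** * Differential inequalities *)

Section differential_inequalities.
Context {R : realType}.

Lemma derivable_within_prefix (w dw : R -> R) (s t : R) : 0 < t <= s ->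
  {within `[0, s], continuous w} ->
  (forall r, 0 < r <= s -> is_derive r 1 w (dw r)) ->
  {within `[0, t], continuous w}.
Proof.
move=> /andP[t0 ts]; have s0 := lt_le_trans t0 ts.
move=> /(continuous_within_itvP _ s0)[_ w0 _] dwE.
have cont r : 0 < r <= s -> {for r, continuous w}.
  by move=> /dwE[dr _]; apply/differentiable_continuous/derivable1_diffP.
apply/(continuous_within_itvP _ t0); split => //.
  move=> r; rewrite in_itv/= => /andP[r0 rt]; apply: cont.
  by rewrite r0 (le_trans (ltW rt)).
by apply: cvg_at_left_filter; apply: cont; rewrite t0.
Qed.

Lemma le_of_derive_le (w dw : R -> R) (K s t : R) : 0 <= t <= s ->
  {within `[0, s], continuous w} ->
  (forall r, 0 < r <= s -> is_derive r 1 w (dw r)) ->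
  (forall r, 0 < r < t -> dw r <= K) -> w t <= w 0 + K * t.
Proof.
move=> /andP[t0 ts] cw dwE dwK; move: t0; rewrite le_eqVlt => /predU1P[<-|t0].
  by rewrite mulr0 addr0.
have [r|c] := @MVT R w dw 0 t t0 _ (derivable_within_prefix (introT andP (conj t0 ts)) cw dwE).
  rewrite in_itv/= => /andP[r0 rt]; apply: dwE.
  by rewrite r0 (le_trans (ltW rt)).
rewrite in_itv/= subr0 => ct /eqP; rewrite subr_eq addrC => /eqP ->.
by rewrite lerD2l ler_pM2r// dwK.
Qed.

Lemma ge_of_derive_ge (w dw : R -> R) (K s t : R) : 0 <= t <= s ->
  {within `[0, s], continuous w} ->
  (forall r, 0 < r <= s -> is_derive r 1 w (dw r)) ->
  (forall r, 0 < r < t -> K <= dw r) -> w 0 + K * t <= w t.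
Proof.
move=> /andP[t0 ts] cw dwE dwK; move: t0; rewrite le_eqVlt => /predU1P[<-|t0].
  by rewrite mulr0 addr0.
have [r|c] := @MVT R w dw 0 t t0 _ (derivable_within_prefix (introT andP (conj t0 ts)) cw dwE).
  rewrite in_itv/= => /andP[r0 rt]; apply: dwE.
  by rewrite r0 (le_trans (ltW rt)).
rewrite in_itv/= subr0 => ct /eqP; rewrite subr_eq addrC => /eqP ->.
by rewrite lerD2l ler_pM2r// dwK.
Qed.

(** The first time at which [w] would reach [B] cannot exist, since [w]
    decreases up to that time. *)
Lemma barrier (w dw : R -> R) (B theta s : R) : 0 < s -> 0 < theta ->
  {within `[0, s], continuous w} ->
  (forall r, 0 < r <= s -> is_derive r 1 w (dw r)) ->
  w 0 < B -> (forall r, 0 < r < s -> w r <= B -> dw r <= - theta) ->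
  w s <= w 0 - theta * s.
Proof.
move=> s0 th0 cw dwE w0B dec.
suff H t : 0 < t < s -> w t <= B.
  rewrite -mulNr; apply: (le_of_derive_le _ cw dwE) => [|r rs].
    by rewrite (ltW s0) lexx.
  by apply: dec => //; exact: H.
move=> /andP[t0 ts]; rewrite leNgt; apply/negP => wtB.
pose A := [set r : R | 0 <= r <= t /\ B <= w r].
have At : A t by split; [rewrite (ltW t0) lexx|exact: ltW].
have lbA : lbound A 0 by move=> r [/andP[]].
have hlb : has_lbound A by exists 0.
have hinf : has_inf A by split; [exists t|].
pose c := inf A.
have ct : c <= t by exact: ge_inf.
have before r : 0 <= r -> r < c -> w r < B.
  move=> r0 rc; rewrite ltNge; apply/negP => wr.
  have : c <= r.
    by apply: ge_inf => //; split => //; rewrite r0 (le_trans (ltW rc)).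
  by rewrite leNgt rc.
have cont r : 0 < r <= s -> {for r, continuous w}.
  by move=> /dwE[dr _]; apply/differentiable_continuous/derivable1_diffP.
have c0 : 0 < c.
  have /(continuous_within_itvP _ s0)[_ + _] := cw.
  move=> /cvgrPdist_lt/(_ (B - w 0)); rewrite subr_gt0 => /(_ w0B).
  move=> [e /= e0 He]; apply: (@lt_le_trans _ _ e) => //.
  apply: lb_le_inf; first by exists t.
  move=> r [/andP[r0 rt] Br]; rewrite leNgt; apply/negP => re.
  move: r0; rewrite le_eqVlt => /predU1P[r0|r0]; first by move: Br; rewrite -r0 leNgt w0B.
  have := He r; rewrite /= sub0r normrN gtr0_norm// => /(_ re r0).
  by rewrite ltr_norml => /andP[+ _]; move: Br; lra.
have cs : 0 < c <= s by rewrite c0 (le_trans ct)// ltW.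
have wc : B <= w c.
  rewrite leNgt; apply/negP => wcB.
  have /cvgrPdist_lt/(_ (B - w c)) := cont c cs; rewrite subr_gt0 => /(_ wcB).
  move=> [e /= e0 He].
  have [a [Aa1 Aa2] ac] := inf_adherent e0 hinf.
  have ca : c <= a by apply: ge_inf.
  have := He a; rewrite /= ler0_norm ?subr_le0// opprB ltrBlDr addrC => /(_ ac).
  by rewrite ltr_norml => /andP[+ _]; move: Aa2; lra.
have : w c <= w 0 + (- theta) * c.
  apply: (le_of_derive_le _ cw dwE) => [|r /andP[r0 rc]].
    by rewrite (ltW c0); case/andP: cs.
  apply: dec; first by rewrite r0 (lt_le_trans rc)//; case/andP: cs.
  by apply: ltW; apply: before => //; exact: ltW.
have : 0 < theta * c by rewrite mulr_gt0.
by rewrite mulNr; lra.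
Qed.

End differential_inequalities.

(** * Geometric scales *)

Section scales.
Context {R : realType} {d : nat}.
Local Notation V := 'rV[R]_d.
Local Notation mu := (@lebesgue_rV R d).
Variables (k g h : R -> R) (kap r0 C delta : R).
Hypothesis kb : kernel_bounds k g h kap r0 C delta.
Hypothesis d0 : (0 < d)%N.

(** The factor [d] makes a cube of half-width [scale j] lie in the ball of
    radius [scale j.+1]; the factor [4] makes the supports of the tent functions
    below disjoint. *)
Definition ratio : R := 4 * d%:R.

Definition scale (j : nat) : R := @base_scale R d r0 * ratio ^+ j.

(** Normalized so that [scale_weight j * scale j] is a bound for the reach on
    the cube of half-width [scale j.+1]. *)
Definition scale_weight (j : nat) : R := h (2 * scale j.+2) / scale j.

Definition total_moment (a : R) (f : V -> R) : R := \sum_i moment a i f.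

Lemma ratio_ge4 : 4 <= ratio.
Proof. by rewrite /ratio ler_peMr// ler1n. Qed.

Let ratio_gt0 : 0 < ratio. Proof. by rewrite (lt_le_trans _ ratio_ge4). Qed.

Lemma scale0 : scale 0 = @base_scale R d r0.
Proof. by rewrite /scale expr0 mulr1. Qed.

Lemma scaleS j : scale j.+1 = ratio * scale j.
Proof. by rewrite /scale exprS mulrCA. Qed.

Lemma scale_gt0 j : 0 < scale j.
Proof. by rewrite mulr_gt0 ?(base_scale_gt0 kb d0)// exprn_gt0. Qed.

Lemma scale_le j l : (j <= l)%N -> scale j <= scale l.
Proof.
move=> jl; rewrite ler_pM2l ?(base_scale_gt0 kb d0)// ler_weXn2l//.
by rewrite (le_trans _ ratio_ge4)// ler1n.
Qed.

Lemma scale_weight_ge0 j : 0 <= scale_weight j.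
Proof. by rewrite divr_ge0 ?(kb_ge0 kb)// ltW ?scale_gt0. Qed.

Lemma scale_large (X : R) : exists J, forall j, (J <= j)%N -> X <= scale j.
Proof.
have [N XN] : exists N : nat, X / @base_scale R d r0 <= N%:R.
  by exists (Num.truncn (X / @base_scale R d r0)).+1; exact/ltW/truncnS_gt.
exists N => j Nj; apply: le_trans (scale_le Nj).
rewrite /scale mulrC -ler_pdivrMr ?(base_scale_gt0 kb d0)// (le_trans XN)//.
elim: N {XN Nj} => [|n IH]; first by rewrite expr0.
rewrite exprS -natr1 (@le_trans _ _ (2 * ratio ^+ n))//; last first.
  rewrite ler_pM2r ?exprn_gt0//; have := ratio_ge4; lra.
have : 1 <= ratio ^+ n by rewrite exprn_ege1//; have := ratio_ge4; lra.
by lra.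
Qed.

(** [h] grows like a power less than one of the scale, so the weights decay
    geometrically. *)
Lemma scale_weight_summable : exists2 C1 : R, 0 < C1 &
  forall n, \sum_(j < n) scale_weight j <= C1.
Proof.
have /andP[dge0 dlt1] := kb_delta kb.
pose q := ratio `^ delta / ratio.
have q0 : 0 <= q by rewrite divr_ge0 ?powR_ge0// ltW.
have ratio1 : 1 < ratio by have := ratio_ge4; lra.
have q1 : q < 1.
  rewrite ltr_pdivrMr// mul1r -[ltRHS](powRr1 (ltW ratio_gt0)).
  rewrite /powR !gt_eqF// ltr_expR ltr_pM2r// ln_gt0//.
pose K := (2 * scale 2) `^ delta.
have K0 : 0 <= K by exact: powR_ge0.
pose A := C * (1 + K) / scale 0.
have A0 : 0 < A by rewrite divr_gt0 ?scale_gt0// mulr_gt0 ?(kb_C kb)// ltr_pwDl.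
have wle j : scale_weight j <= A * q ^+ j.
  have h1 := kb_growth kb (mulr_gt0 (ltr0Sn _ 1) (scale_gt0 j.+2)).
  rewrite /scale_weight ler_pdivrMr ?scale_gt0// (le_trans h1)//.
  have E1 : (2 * scale j.+2) `^ delta = K * (ratio `^ delta) ^+ j.
    rewrite (_ : 2 * scale j.+2 = 2 * scale 2 * ratio ^+ j); last first.
      by rewrite /scale !exprS expr0; ring.
    rewrite powRM ?exprn_ge0 ?(ltW ratio_gt0)//; last by rewrite mulr_ge0 ?(ltW (scale_gt0 _)).
    rewrite -/K -(powR_mulrn _ (ltW ratio_gt0)) -(powR_mulrn _ (powR_ge0 ratio delta)).
    by rewrite powRAC.
  have E2 : A * q ^+ j * scale j = C * ((1 + K) * (ratio `^ delta) ^+ j).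
    rewrite /A /q /scale expr0 mulr1 expr_div_n; field.
    by rewrite !gt_eqF ?exprn_gt0 ?(base_scale_gt0 kb d0).
  rewrite E1 E2 ler_pM2l ?(kb_C kb)// mulrDl mul1r lerD2r.
  by rewrite exprn_ege1// -[leLHS](powRr0 ratio) ler_powR// ltW.
exists (A / (1 - q)); first by rewrite divr_gt0// subr_gt0.
move=> n; apply: (@le_trans _ _ (\sum_(j < n) A * q ^+ j)).
  by apply: ler_sum => j _; exact: wle.
rewrite -mulr_sumr ler_pM2l// -[leRHS]mul1r ler_pdivlMr ?subr_gt0//.
have : (1 - q) * \sum_(j < n) q ^+ j = 1 - q ^+ n.
  by have := subrX1 q n; rewrite !mulrBl !mul1r; lra.
rewrite mulrC => ->; rewrite gerBl exprn_ge0//.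
Qed.

Variable f : V -> R.
Hypothesis f_ge0 : forall x, 0 <= f x.
Hypothesis Lf : L1 f.
Hypothesis Lhf : L1 (fun x => reach h x * f x).

Let sum_min (a : R) (x : V) : R := \sum_i Num.min `|x ord0 i| a.

Let sum_min_ge0 a x : 0 < a -> 0 <= sum_min a x.
Proof. by move=> a0; apply: sumr_ge0 => i _; rewrite le_min normr_ge0 ltW. Qed.

Lemma total_moment_ge0 a : 0 < a -> 0 <= total_moment a f.
Proof.
move=> a0; apply: sumr_ge0 => i _; apply: Rintegral_ge0 => x _.
by rewrite mulr_ge0// le_min normr_ge0 ltW.
Qed.

Let integrable_sum_min a : 0 < a -> L1 (fun x => sum_min a x * f x).
Proof.
move=> a0; rewrite (_ : (fun x => _) = (fun x : V => \sum_i (Num.min `|x ord0 i| a * f x))).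
  by apply: integrable_big => i; exact: integrable_moment.
by apply/funext => x; rewrite /sum_min mulr_suml.
Qed.

Let total_momentE a : 0 < a -> total_moment a f = \int[mu]_x (sum_min a x * f x).
Proof.
move=> a0; rewrite /total_moment /moment -int_sum => [|i]; last exact: integrable_moment.
by apply: eq_Rintegral => x _; rewrite /sum_min mulr_suml.
Qed.

Let outside_le_sum_min a (x : V) : 0 < a -> a * outside a x <= sum_min a x.
Proof.
move=> a0; rewrite /outside; have [/existsP[i xi]|_] := boolP [exists i : 'I_d, a <= `|x ord0 i|]; last first.
  by rewrite mulr0 sum_min_ge0.
rewrite mulr1 /sum_min (bigD1 i)//= min_r// lerDl.
by apply: sumr_ge0 => j _; rewrite le_min normr_ge0 ltW.
Qed.

Lemma outside_mass_le a : 0 < a ->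
  a * \int[mu]_x (outside a x * f x) <= total_moment a f.
Proof.
move=> a0; have iO := integrable_outside a Lf.
rewrite total_momentE// -RintegralZl//.
apply: int_le; [exact: (integrableZ a iO)|exact: integrable_sum_min|].
by move=> x; rewrite mulrA ler_wpM2r// outside_le_sum_min.
Qed.

(** On the shell between two consecutive cubes, the reach is controlled by the
    outer scale and the truncated coordinates are not all small. *)
Let shell_bound j (x : V) : (outside (scale j) x - outside (scale j.+1) x) * reach h x <=
  scale_weight j * sum_min (scale j) x.
Proof.
have w0 := scale_weight_ge0 j; have s0 := scale_gt0 j.
have rx : 0 <= reach h x by exact: kb_ge0 kb _.
have S0 := sum_min_ge0 x s0.
have [sx|sx] := boolP [exists i : 'I_d, scale j.+1 <= `|x ord0 i|].
  apply: (@le_trans _ _ 0); last exact: mulr_ge0.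
  rewrite mulr_le0_ge0// subr_le0.
  rewrite {2}/outside sx; by case/andP: (outside01 (scale j) x).
rewrite {2}/outside (negbTE sx) subr0.
apply: (@le_trans _ _ (outside (scale j) x * h (2 * scale j.+2))).
  rewrite ler_wpM2l//; apply: (kb_homo kb); rewrite ler_pM2l//.
  rewrite (le_trans (enorm_le_sum x))// scaleS.
  apply: (@le_trans _ _ (\sum_(i < d) scale j.+1)).
    apply: ler_sum => i _; apply: ltW; rewrite ltNge.
    by move/existsPn : sx; apply.
  rewrite sumr_const card_ord -mulr_natl ler_wpM2r ?(ltW (scale_gt0 _))//.
  by rewrite /ratio ler_peMl// ler1n.
rewrite /scale_weight mulrAC -mulrA mulrC ler_wpM2l ?(kb_ge0 kb)//.
by rewrite ler_pdivlMr// mulrC outside_le_sum_min.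
Qed.

Let telescope N (x : V) : (outside (scale 0) x - outside (scale N) x) * reach h x <=
  \sum_(j < N) scale_weight j * sum_min (scale j) x.
Proof.
elim: N => [|N IH]; first by rewrite subrr mul0r big_ord0.
rewrite big_ord_recr/= (le_trans _ (lerD IH (shell_bound N x)))//.
by rewrite -mulrDl addrA subrK.
Qed.

(** The weighted sum of truncated moments is a majorant of the reach outside
    the first cube: sum the shells and let their number grow. *)
Lemma outside_reach_le (B : R) :
  (forall N, \sum_(j < N) scale_weight j * total_moment (scale j) f <= B) ->
  \int[mu]_x (outside (scale 0) x * (reach h x * f x)) <= B.
Proof.
move=> HB.
have mr : measurable_fun setT (fun x : V => reach h x * f x) by exact: integrable_measurable Lhf.
have r_ge0 (x : V) : 0 <= reach h x * f x by rewrite mulr_ge0// (kb_ge0 kb).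
pose F N x := (outside (scale 0) x - outside (scale N) x) * (reach h x * f x).
have iF N : L1 (F N).
  rewrite (_ : F N = fun x => outside (scale 0) x * (reach h x * f x) -
    outside (scale N) x * (reach h x * f x)).
    by apply: integrable_sub; exact: integrable_outside.
  by apply/funext => x; rewrite /F mulrBl.
have cv : \int[mu]_x F N x @[N --> \oo] -->
    \int[mu]_x (outside (scale 0) x * (reach h x * f x)).
  have [|||_] := int_dominated_cvg (f_ := F)
    (f := fun x => outside (scale 0) x * (reach h x * f x)) _ _ Lhf _; last by [].
  - by move=> N; exact: integrable_measurable (iF N).
  - move=> x; apply: cvg_near_cst.
    have [J HJ] := scale_large (enorm x + 1).
    exists J => // N JN; rewrite /F.
    suff -> : outside (scale N) x = 0 by rewrite subr0.
    rewrite /outside (introF existsP)//; case=> i.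
    rewrite leNgt => /negP; apply; apply: le_lt_trans (coord_le_enorm x i) _.
    by rewrite (lt_le_trans _ (HJ N JN))// ltrDl.
  - move=> N x; rewrite /F normrM (ger0_norm (r_ge0 x)) -[leRHS]mul1r ler_wpM2r//.
    have /andP[? ?] := outside01 (scale 0) x; have /andP[? ?] := outside01 (scale N) x.
    by rewrite ler_norml; apply/andP; split; lra.
rewrite -(cvg_lim _ cv)//; apply: limr_le; first by apply: cvgP cv.
apply: nearW => N /=; apply: le_trans (HB N).
rewrite (eq_bigr (fun j : 'I_N => \int[mu]_x (scale_weight j * (sum_min (scale j) x * f x)))); last first.
  move=> j _; rewrite total_momentE ?scale_gt0// RintegralZl//.
  exact: integrable_sum_min (scale_gt0 _).
have iS (j : 'I_N) : L1 (fun x => scale_weight j * (sum_min (scale j) x * f x)).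
  by apply: integrableZ; exact: integrable_sum_min (scale_gt0 _).
rewrite -int_sum//; apply: (int_le (iF N) (integrable_big _ iS)) => x; rewrite /F mulrA.
rewrite (eq_bigr (fun j : 'I_N => scale_weight j * sum_min (scale j) x * f x)); last first.
  by move=> j _; rewrite mulrA.
by rewrite -mulr_suml ler_wpM2r// telescope.
Qed.

End scales.

(** * A priori estimates *)

Section solution_estimates.
Context {R : realType} {d : nat}.
Local Notation V := 'rV[R]_d.
Local Notation mu := (@lebesgue_rV R d).
Variables (nu alpha : R) (k g h : R -> R) (kap r0 C delta : R).
Hypothesis nu0 : 0 < nu.
Hypothesis alpha01 : 0 < alpha < 1.
Hypothesis kb : kernel_bounds k g h kap r0 C delta.
Variables (u0 : V -> R) (T : R) (u : R -> V -> R).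
Hypothesis u0_ge0 : forall x, 0 <= u0 x.
Hypothesis Lu0 : L1 u0.
Hypothesis Lxu0 : L1 (fun x => enorm x * u0 x).
Hypothesis sol : solution nu alpha k u0 T u.

Local Notation M := (\int[mu]_x u0 x).
Local Notation M1 := (\int[mu]_x (enorm x * u0 x)).
Local Notation beta := (1 - alpha).

(** The weight in the velocity bound of a solution is exactly the reach. *)
Lemma sol_reach s : 0 <= s < T -> exists2 Cs : R, 0 <= Cs & forall t, 0 <= t <= s ->
  L1 (fun x => reach h x * u t x) /\ \int[mu]_x (reach h x * u t x) <= Cs.
Proof.
move=> /andP[s0 sT]; have [Cs HC] := sol_velocity sol (introT andP (conj s0 sT)).
have step t : 0 <= t <= s ->
    L1 (fun x => reach h x * u t x) /\ \int[mu]_x (reach h x * u t x) <= Cs.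
  move=> ts; have tT : 0 <= t < T.
    by case/andP: ts => -> ts; exact: le_lt_trans sT.
  have ge0 x : 0 <= reach h x * u t x by rewrite mulr_ge0 ?(kb_ge0 kb)// (sol_ge0 sol).
  have := HC t ts.
  under eq_integral do rewrite (kb_kmax kb) -EFinM.
  move=> HCt; have L : L1 (fun x => reach h x * u t x).
    apply/integrableP; split.
      apply/measurable_EFinP/measurable_funM; first exact: measurable_reach kb.
      exact: integrable_measurable (sol_L1 sol tT).
    apply: le_lt_trans (ltry Cs); apply: le_trans HCt.
    rewrite le_eqVlt; apply/orP; left; apply/eqP; apply: eq_integral => x _ /=.
    by rewrite ger0_norm.
  by split => //; move: HCt; rewrite int_fin.
exists Cs => //; have [_] := step 0 (introT andP (conj (lexx 0) s0)).
apply: le_trans; apply: Rintegral_ge0 => x _.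
rewrite mulr_ge0 ?(kb_ge0 kb)// (sol_ge0 sol)// lexx (le_lt_trans s0)//.
Qed.

Lemma moment_init_le a i : 0 < a -> moment a i u0 <= M1.
Proof.
move=> a0; apply: int_le => //; first exact: integrable_moment.
by move=> x; rewrite ler_wpM2r// ge_min coord_le_enorm.
Qed.

Lemma int_frac_min_le a i t : 0 < a -> 0 <= t < T ->
  `|\int[mu]_x (frac_min alpha a (x ord0 i) * u t x)| <= frac_const alpha * a `^ beta * M.
Proof.
move=> a0 tT; have Lt := sol_L1 sol tT.
rewrite -(sol_mass sol tT) -RintegralZl//.
apply: int_norm_le.
- apply: measurable_funM; last exact: integrable_measurable Lt.
  by apply: (measurableT_comp (measurable_frac_min alpha a)); exact: measurable_coord_rV.
- exact: integrableZ.
by move=> x; rewrite normrM (ger0_norm (sol_ge0 sol x tT)) ler_wpM2r ?(sol_ge0 sol)// normr_frac_min_le.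
Qed.

Lemma mass_ge0 : 0 <= M.
Proof. exact: Rintegral_ge0. Qed.

Lemma sol_drift_le a i t Cs : 0 < a -> 0 <= t < T ->
  L1 (fun x => reach h x * u t x) -> \int[mu]_x (reach h x * u t x) <= Cs ->
  `|drift k (u t) a i| <= 2 * M * Cs.
Proof.
move=> a0 tT Lr Hr.
apply: (le_trans (normr_drift_le kb (fun x => sol_ge0 sol x tT) (sol_L1 sol tT) Lr i a0)).
by rewrite (sol_mass sol tT) ler_wpM2l// mulr_ge0// mass_ge0.
Qed.

(** A moment truncated at [a] grows at a rate of order [a^(1 - alpha)], although
    the moment of order one itself may be infinite at positive times. *)
Lemma moment_growth a i s t Cs : 0 < a -> 0 < s < T -> 0 <= t <= s ->
  (forall r, 0 <= r <= s -> L1 (fun x => reach h x * u r x) /\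
     \int[mu]_x (reach h x * u r x) <= Cs) ->
  moment a i (u t) <=
  M1 + s * (nu * (frac_const alpha * a `^ beta * M) + 2 * M * Cs).
Proof.
move=> a0 /andP[s0 sT] /andP[t0 ts] HC.
have cw := continuous_moment (i := i) alpha01 sol a0 (introT andP (conj s0 sT)).
have dw r : 0 < r <= s -> is_derive r 1 (fun t => moment a i (u t))
    (nu * \int[mu]_x (frac_min alpha a (x ord0 i) * u r x) + drift k (u r) a i).
  move=> /andP[rp rs]; have rT : 0 < r < T by rewrite rp (le_lt_trans rs).
  exact: (is_derive_moment alpha01 sol i a0 rT).
have C0 : 0 <= Cs.
  have [_] := HC 0 (introT andP (conj (lexx 0) (ltW s0))).
  apply: le_trans; apply: Rintegral_ge0 => x _.
  by rewrite mulr_ge0 ?(kb_ge0 kb)// (sol_ge0 sol)// lexx (lt_trans s0).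
pose K := nu * (frac_const alpha * a `^ beta * M) + 2 * M * Cs.
have K0 : 0 <= K.
  have c0 := ltW (frac_const_gt0 alpha01).
  have M0 := mass_ge0; apply: addr_ge0; first apply: mulr_ge0; rewrite ?(ltW nu0)//.
    by apply: mulr_ge0 => //; apply: mulr_ge0 => //; exact: powR_ge0.
  by apply: mulr_ge0 => //; exact: mulr_ge0.
apply: (@le_trans _ _ (moment a i (u 0) + K * t)).
  apply: (le_of_derive_le (introT andP (conj t0 ts)) cw dw) => r /andP[r0' rt].
  have rs : 0 <= r <= s by rewrite (ltW r0') (le_trans (ltW rt)).
  have rT : 0 <= r < T by rewrite (ltW r0') (le_lt_trans _ sT)//; case/andP: rs.
  have [Lr Hr] := HC r rs.
  rewrite lerD//; last by rewrite (le_trans (ler_norm _))// sol_drift_le.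
  by rewrite ler_pM2l// (le_trans (ler_norm _))// int_frac_min_le.
rewrite (sol_init sol) lerD ?moment_init_le// mulrC ler_wpM2r//.
Qed.

End solution_estimates.

(** * Collapse when the weighted dissipation is summable *)

(** Summability, stated with partial sums only. *)
Lemma small_tail {R : realType} (e : nat -> R) (Bd eps : R) :
  (forall j, 0 <= e j) -> (forall n, \sum_(j < n) e j <= Bd) -> 0 < eps ->
  exists n, forall N, \sum_(j < N) e j <= \sum_(j < n.+1) e j + eps.
Proof.
move=> e0 eB eps0; pose S := range (fun n => \sum_(j < n) e j).
have mono m l : (m <= l)%N -> \sum_(j < m) e j <= \sum_(j < l) e j.
  move=> /subnK <-; elim: (l - m)%N => [|p IH]; first by rewrite add0n.
  by rewrite addSn big_ord_recr/= (le_trans IH)// lerDl.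
have Sub : has_ubound S by exists Bd => _ [n _ <-].
have hs : has_sup S by split => //; exists (\sum_(j < 0) e j); exists 0%N.
have [_ [n _ <-] Hn] := sup_adherent eps0 hs.
exists n => N; have : \sum_(j < N) e j <= sup S.
  by apply: ub_le_sup => //; exists N.
have := mono n n.+1 (leqnSn n); lra.
Qed.

Section summable_case.
Context {R : realType} {d : nat}.
Local Notation V := 'rV[R]_d.
Local Notation mu := (@lebesgue_rV R d).
Variables (nu alpha : R) (k g h : R -> R) (kap r0 C delta : R).
Hypothesis d0 : (0 < d)%N.
Hypothesis nu0 : 0 < nu.
Hypothesis alpha01 : 0 < alpha < 1.
Hypothesis kb : kernel_bounds k g h kap r0 C delta.

Local Notation beta := (1 - alpha).
Local Notation rho j := (@scale R d r0 j).
Local Notation c j := (@scale_weight R d h r0 j).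

Let total_rate (u : R -> V -> R) (a t : R) : R :=
  \sum_i (nu * \int[mu]_x (frac_min alpha a (x ord0 i) * u t x) + drift k (u t) a i).

Let is_derive_total (u0 : V -> R) T u n t : solution nu alpha k u0 T u -> 0 < t < T ->
  is_derive t 1 (fun t => \sum_(j < n) c j * total_moment (rho j) (u t))
    (\sum_(j < n) c j * total_rate u (rho j) t).
Proof.
move=> sol tT.
have H (j : 'I_n) : is_derive t 1 (fun t => c j * total_moment (rho j) (u t)) (c j * total_rate u (rho j) t).
  apply: is_deriveZ.
  rewrite (_ : (fun t => total_moment _ _) = \sum_i (fun t => moment (rho j) i (u t))); last first.
    by apply/funext => r; rewrite fct_sumE.
  apply: is_derive_sum => i.
  exact: (is_derive_moment alpha01 sol i (scale_gt0 kb d0 j) tT).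
rewrite (_ : (fun t => _) = \sum_(j < n) (fun t => c j * total_moment (rho j) (u t))); last first.
  by apply/funext => r; rewrite fct_sumE.
exact: is_derive_sum.
Qed.

Let continuous_total (u0 : V -> R) T u n s : solution nu alpha k u0 T u -> 0 < s < T ->
  {within `[0, s], continuous (fun t => \sum_(j < n) c j * total_moment (rho j) (u t))}.
Proof.
move=> sol sT.
have add2 : continuous (fun z : R * R => z.1 + z.2) by exact: add_continuous.
apply: (continuous_big add2) => j _.
have h1 : {within `[0, s], continuous (fun t => total_moment (rho j) (u t))}.
  apply: (continuous_big add2) => i _.
  exact: (continuous_moment (i := i) alpha01 sol (scale_gt0 kb d0 j) sT).
have h2 : {within `[0, s], continuous (fun _ : R => c j)} by exact: cst_continuous.
by move=> t; exact: (continuousM (h2 t) (h1 t)).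
Qed.

(** The functional [w], the sum of [c j] times the moments truncated at [rho j],
    controls both the mass outside the first cube and its reach. While
    [w <= eta M], the drift decreases [w] at a rate of order [M^2], whereas the
    dissipation increases it at a rate of order [M], by summability of
    [c j * rho j ^ (1 - alpha)]; for large mass the drift wins, the bound on [w]
    propagates, and [w] would become negative at time [s = eta / (theta M)]. Only
    finitely many scales enter [w], so that it can be differentiated; the
    remaining ones are controlled by the growth of moments. *)
Lemma blowup_of_summable :
  (exists C2 : R, forall n, \sum_(j < n) c j * rho j `^ beta <= C2) ->
  exists Mlarge M1small : R, [/\ 0 < Mlarge, 0 < M1small &
    forall u0 : V -> R, (forall x, 0 <= u0 x) -> L1 u0 ->
      L1 (fun x => enorm x * u0 x) ->
      Mlarge <= \int[mu]_x u0 x ->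
      \int[mu]_x (enorm x * u0 x) <= M1small ->
      exists2 T : R, 0 < T & forall u, ~ solution nu alpha k u0 T u].
Proof.
move=> [C2 HC2]; have [C1 C10 HC1] := scale_weight_summable kb d0.
have kap0 := kb_kap kb.
have dpos : 0 < d%:R :> R by rewrite ltr0n.
pose gam := frac_const alpha; have gam0 : 0 < gam by exact: frac_const_gt0 alpha01.
have rho0 j : 0 < rho j by exact: scale_gt0 kb d0 j.
have c_ge0 j : 0 <= c j by exact: scale_weight_ge0 kb d0 j.
have C20 : 0 <= C2 by have := HC2 0%N; rewrite big_ord0.
have kc0 : kap <= c 0 * rho 0.
  rewrite /scale_weight divfK ?gt_eqF//; apply: (kb_ge kb).
  by rewrite mulr_gt0.
have c00 : 0 < c 0.
  by rewrite lt_def c_ge0 andbT; apply/eqP => c00; move: kc0; rewrite c00 mul0r leNgt kap0.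
have hr0 : 0 <= h r0 by exact: kb_ge0 kb _.
(* [D * eta * M^2] bounds the contribution to the derivative of [w] of the
   pairs that are not in the first cube. *)
pose D := C1 * (2 * d%:R) * (4 + h r0 / kap).
have D0 : 0 < D by rewrite !mulr_gt0// ltr_pwDl// divr_ge0// ltW.
(* The first bound keeps half of the mass in the first cube; the second one makes
   the other pairs cost at most half of the attraction [4 * theta * M^2]. *)
pose eta := Num.min (kap / 2) (c 0 * kap / (16 * D)).
have eta0 : 0 < eta by rewrite lt_min !divr_gt0// mulr_gt0.
have eta1 : eta <= kap / 2 by rewrite ge_min lexx.
have eta2 : D * eta <= c 0 * kap / 16.
  rewrite mulrC -ler_pdivlMr// (_ : _ / 16 / D = c 0 * kap / (16 * D)); last by field; rewrite gt_eqF.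
  by rewrite ge_min lexx orbT.
pose theta := c 0 * kap / 32.
have theta0 : 0 < theta by rewrite divr_gt0// mulr_gt0.
pose E := nu * (d%:R * gam * C2).
have E0 : 0 <= E.
  by rewrite /E; apply: mulr_ge0; [exact: ltW|rewrite mulr_ge0// mulr_ge0// ltW].
(* The dissipation is at most [E * M], hence at most [theta * M^2] once
   [E / theta <= M]. *)
pose Mlarge := E / theta + 1.
have Mlarge0 : 0 < Mlarge by rewrite ltr_wpDl// divr_ge0// ltW.
pose M1small := eta * Mlarge / (4 * C1 * d%:R).
exists Mlarge, M1small; split => //; first by rewrite divr_gt0 ?mulr_gt0.
move=> u0 u0_ge0 Lu0 Lxu0 HM HM1.
set M := \int[mu]_x u0 x in HM; set M1 := \int[mu]_x (enorm x * u0 x) in HM1.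
have M0 : 0 < M by exact: lt_le_trans HM.
have M10 : 0 <= M1 by apply: Rintegral_ge0 => x _; rewrite mulr_ge0 ?enorm_ge0.
pose s := eta / (theta * M).
have s0 : 0 < s by rewrite divr_gt0// mulr_gt0.
exists (2 * s); first by rewrite mulr_gt0.
move=> u sol; have sT : s < 2 * s by lra.
have sT' : 0 <= s < 2 * s by rewrite (ltW s0).
have sT'' : 0 < s < 2 * s by rewrite s0.
have [Cs Cs0 HCs] := sol_reach kb sol sT'.
pose A0 := d%:R * (M1 + s * (2 * M * Cs)).
pose A1 := d%:R * (s * (nu * (gam * M))).
have s_ge0 := ltW s0; have M_ge0 := ltW M0; have nu_ge0 := ltW nu0; have gam_ge0 := ltW gam0.
have A00 : 0 <= A0.
  rewrite /A0; apply: mulr_ge0 => //; apply: addr_ge0 => //.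
  by do 3 apply: mulr_ge0 => //.
have A10 : 0 <= A1 by rewrite /A1; do 4 apply: mulr_ge0 => //.
have TM_le j t : 0 <= t <= s -> total_moment (rho j) (u t) <= A0 + A1 * rho j `^ beta.
  move=> ts; apply: (@le_trans _ _ (\sum_(i < d)
      (M1 + s * (nu * (gam * rho j `^ beta * M) + 2 * M * Cs)))).
    apply: ler_sum => i _.
    exact: (moment_growth nu0 alpha01 kb u0_ge0 Lu0 Lxu0 sol i (rho0 j) sT'' ts HCs).
  rewrite sumr_const card_ord -mulr_natl /A0 /A1 le_eqVlt; apply/orP; left; apply/eqP.
  by ring.
(* [e j] bounds the [j]-th term of the functional up to time [s]. *)
pose e j := c j * (A0 + A1 * rho j `^ beta).
have e_ge0 j : 0 <= e j.
  by rewrite mulr_ge0// addr_ge0// mulr_ge0// powR_ge0.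
have e_le n : \sum_(j < n) e j <= C1 * A0 + A1 * C2.
  rewrite (eq_bigr (fun j : 'I_n => c j * A0 + A1 * (c j * rho j `^ beta))); last first.
    by move=> j _; rewrite /e; ring.
  rewrite big_split/= -mulr_suml -mulr_sumr; apply: lerD.
    exact: ler_wpM2r A00 _ _ (HC1 n).
  exact: ler_wpM2l A10 _ _ (HC2 n).
have etaM0 : 0 < eta * M by rewrite mulr_gt0.
have [n Hn] := small_tail e_ge0 e_le etaM0.
pose w t := \sum_(j < n.+1) c j * total_moment (rho j) (u t).
have tT t : 0 <= t <= s -> 0 <= t < 2 * s.
  by move=> /andP[-> ts]; exact: le_lt_trans sT.
have u_ge0 t : 0 <= t <= s -> forall x, 0 <= u t x.
  by move=> /tT h1 x; exact: (sol_ge0 sol x h1).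
have TM_ge0 j t : 0 <= t <= s -> 0 <= total_moment (rho j) (u t).
  by move=> ts; apply: total_moment_ge0 => //; exact: u_ge0.
have all_le N t : 0 <= t <= s ->
    \sum_(j < N) c j * total_moment (rho j) (u t) <= w t + eta * M.
  move=> ts; rewrite /w; have [Nn|nN] := leqP N n.+1.
    apply: (@le_trans _ _ (\sum_(j < n.+1) c j * total_moment (rho j) (u t))).
      rewrite -(subnK Nn); elim: (n.+1 - N)%N => [|p IH]; first by rewrite add0n.
      by rewrite addSn big_ord_recr/= (le_trans IH)// lerDl mulr_ge0// TM_ge0.
    by rewrite lerDl ltW.
  have split_sum (F : nat -> R) : \sum_(j < N) F j = \sum_(j < n.+1) F j + \sum_(n.+1 <= j < N) F j.
    by rewrite -!(big_mkord xpredT F) (@big_cat_nat _ _ _ n.+1)// ltnW.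
  rewrite (split_sum (fun j => c j * total_moment (rho j) (u t))) lerD2l.
  have := Hn N; rewrite (split_sum e) lerD2l; apply: le_trans.
  by apply: ler_sum_nat => j _; rewrite ler_wpM2l// TM_le.
have w0 : w 0 < eta * M.
  have w0' : w 0 <= C1 * (d%:R * M1).
    rewrite /w; apply: (@le_trans _ _ (\sum_(j < n.+1) c j * (d%:R * M1))).
      apply: ler_sum => j _; rewrite ler_wpM2l// (sol_init sol) /total_moment.
      apply: (@le_trans _ _ (\sum_(i < d) M1)); last by rewrite sumr_const card_ord mulr_natl.
      by apply: ler_sum => i _; exact: moment_init_le.
    by rewrite -mulr_suml ler_wpM2r// mulr_ge0// ltW.
  apply: (le_lt_trans w0').
  apply: (@le_lt_trans _ _ (eta * Mlarge / 4)).
    apply: (@le_trans _ _ (C1 * (d%:R * M1small))); first by rewrite !ler_pM2l.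
    by rewrite /M1small le_eqVlt; apply/orP; left; apply/eqP; field; rewrite !gt_eqF.
  have : eta * Mlarge <= eta * M by rewrite ler_pM2l.
  have : 0 < eta * Mlarge by rewrite mulr_gt0.
  lra.
have dec r : 0 < r < s -> w r <= eta * M ->
    \sum_(j < n.+1) c j * total_rate u (rho j) r <= - (theta * M ^+ 2).
  move=> /andP[rp rs] wr; have rs' : 0 <= r <= s by rewrite !ltW.
  have rT := tT _ rs'; have [Lr Hr] := HCs r rs'.
  have Lur := sol_L1 sol rT; have mass := sol_mass sol rT.
  set O := \int[mu]_x (outside (@base_scale R d r0) x * u r x).
  set Z := \int[mu]_x (outside (@base_scale R d r0) x * (reach h x * u r x)).
  have HZ : Z <= 2 * eta * M.
    rewrite /Z -(@scale0 R d r0); apply: (outside_reach_le kb d0 (u_ge0 _ rs') Lur Lr) => N.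
    by apply: (le_trans (all_le N r rs')); lra.
  have O_ge0 : 0 <= O.
    by apply: Rintegral_ge0 => x _; rewrite mulr_ge0 ?u_ge0.
  have HO : kap * O <= eta * M.
    apply: (@le_trans _ _ (c 0 * rho 0 * O)); first by rewrite ler_wpM2r.
    apply: (@le_trans _ _ (c 0 * total_moment (rho 0) (u r))).
      rewrite -mulrA ler_pM2l// /O -(@scale0 R d r0).
      exact: (outside_mass_le (u_ge0 _ rs') Lur (rho0 0%N)).
    apply: le_trans wr; rewrite /w big_ord_recl/= lerDl.
    by apply: sumr_ge0 => j _; rewrite mulr_ge0// TM_ge0.
  pose G := - (kap / 2) * (M - O) ^+ 2 + 2 * d%:R * (M * (2 * Z + h r0 * O)).
  have rate j : total_rate u (rho j) r <= nu * (d%:R * gam * M) * rho j `^ beta + G.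
    rewrite /total_rate big_split/=; apply: lerD.
      rewrite -mulr_sumr -mulrA ler_pM2l//.
      apply: (@le_trans _ _ (\sum_(i < d) gam * rho j `^ beta * M)).
        apply: ler_sum => i _; rewrite (le_trans (ler_norm _))//.
        exact: (int_frac_min_le alpha01 sol i (rho0 j) rT).
      by rewrite sumr_const card_ord -mulr_natl le_eqVlt; apply/orP; left; apply/eqP; ring.
    have rho_j : @base_scale R d r0 <= rho j by rewrite -(@scale0 R d r0) (scale_le kb d0).
    have := sum_drift_le kb d0 (u_ge0 _ rs') (fun x => sol_even sol x rT) Lur Lr rho_j.
    by rewrite mass -/M -/O -/Z.
  have OM : O <= M / 2.
    rewrite -(ler_pM2l kap0) (le_trans HO)// mulrA mulrAC ler_pM2r//.
  have hO : h r0 * O <= h r0 / kap * (eta * M).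
    by rewrite -mulrA ler_wpM2l// ler_pdivlMl.
  have G2 : M * (2 * Z + h r0 * O) <= M * ((4 + h r0 / kap) * (eta * M)).
    by rewrite ler_pM2l//; lra.
  have G1 : M ^+ 2 / 4 <= (M - O) ^+ 2.
    rewrite (_ : M ^+ 2 / 4 = (M / 2) ^+ 2); last by field.
    have half : M / 2 <= M - O by rewrite lerBrDr [leRHS]splitr lerD2l.
    by rewrite ler_sqr ?nnegrE// ?(le_trans _ half)// divr_ge0// ltW.
  apply: (@le_trans _ _ (\sum_(j < n.+1) (nu * (d%:R * gam * M) * (c j * rho j `^ beta) + c j * G))).
    apply: ler_sum => j _; apply: le_trans (ler_wpM2l (c_ge0 j) (rate j)) _.
    by rewrite le_eqVlt; apply/orP; left; apply/eqP; ring.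
  rewrite big_split/= -mulr_sumr -mulr_suml.
  set S := \sum_(j < n.+1) c j.
  have S1 : S <= C1 by exact: HC1.
  have S0 : c 0 <= S.
    by rewrite /S big_ord_recl/= lerDl; apply: sumr_ge0 => j _.
  have t1 : nu * (d%:R * gam * M) * \sum_(j < n.+1) c j * rho j `^ beta <= theta * M ^+ 2.
    apply: (@le_trans _ _ (E * M)).
      rewrite (_ : E * M = nu * (d%:R * gam * M) * C2); last by rewrite /E; ring.
      rewrite ler_wpM2l//; apply: mulr_ge0 => //; do 2 apply: mulr_ge0 => //.
    rewrite expr2 mulrA ler_pM2r// -ler_pdivrMl// mulrC (le_trans _ HM)//.
    by rewrite /Mlarge lerDl.
  have h0k : 0 <= 4 + h r0 / kap by rewrite addr_ge0// divr_ge0// ltW.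
  have e_ge : 0 <= eta by exact: ltW.
  have Q_ge0 : 0 <= 2 * d%:R * (M * ((4 + h r0 / kap) * (eta * M))).
    by do 3 apply: mulr_ge0 => //; exact: mulr_ge0.
  have t2 : S * G <= c 0 * (- (kap / 2) * (M ^+ 2 / 4)) + C1 * (2 * d%:R * (M * ((4 + h r0 / kap) * (eta * M)))).
    rewrite /G mulrDr; apply: lerD.
      rewrite !mulNr !mulrN lerN2; apply: ler_pM => //.
        by apply: mulr_ge0; [rewrite divr_ge0// ltW|rewrite divr_ge0// sqr_ge0].
      by rewrite ler_pM2l// divr_gt0.
    apply: (@le_trans _ _ (S * (2 * d%:R * (M * ((4 + h r0 / kap) * (eta * M)))))).
      rewrite ler_wpM2l ?(le_trans _ S0)//.
      by rewrite ler_wpM2l// mulr_ge0.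
    exact: ler_wpM2r Q_ge0 _ _ S1.
  have t3 : C1 * (2 * d%:R * (M * ((4 + h r0 / kap) * (eta * M)))) = D * eta * M ^+ 2.
    by rewrite /D; ring.
  have t4 : D * eta * M ^+ 2 <= c 0 * kap / 16 * M ^+ 2 by rewrite ler_wpM2r ?sqr_ge0.
  have t5 : c 0 * (- (kap / 2) * (M ^+ 2 / 4)) = - (4 * theta * M ^+ 2) by rewrite /theta; field.
  have t6 : c 0 * kap / 16 * M ^+ 2 = 2 * theta * M ^+ 2 by rewrite /theta; field.
  rewrite t3 t5 in t2; rewrite t6 in t4.
  lra.
have dwE r : 0 < r <= s -> is_derive r 1 w (\sum_(j < n.+1) c j * total_rate u (rho j) r).
  move=> /andP[rp rs]; apply: (is_derive_total n.+1 sol).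
  by rewrite rp (le_lt_trans rs).
have thM : 0 < theta * M ^+ 2 by rewrite mulr_gt0// exprn_gt0.
have := barrier s0 thM (continuous_total (n := n.+1) sol sT'') dwE w0 dec.
have ws : 0 <= w s.
  by apply: sumr_ge0 => j _; rewrite mulr_ge0// TM_ge0// lexx (ltW s0).
have : theta * M ^+ 2 * s = eta * M.
  by rewrite /s; field; rewrite !gt_eqF.
by move=> -> /(le_trans ws); rewrite leNgt subr_lt0 w0.
Qed.

End summable_case.

(** * Tent functions and the fractional Laplacian *)

Section tents.
Context {R : realType}.
Variable alpha : R.
Hypothesis alpha01 : 0 < alpha < 1.
Local Notation beta := (1 - alpha).
Local Notation gam := (frac_const alpha).

Let beta01 : 0 < beta < 1.
Proof. by case/andP: alpha01 => ? ?; apply/andP; split; lra. Qed.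

Lemma powR_subadditive (p x y : R) : 0 < p <= 1 -> 0 <= x -> 0 <= y ->
  (x + y) `^ p <= x `^ p + y `^ p.
Proof.
move=> /andP[p0 p1] x0 y0; have := addr_ge0 x0 y0; rewrite le_eqVlt => /predU1P[<-|s0].
  by rewrite powR0 ?gt_eqF// addr_ge0// powR_ge0.
have key z : 0 <= z -> z <= x + y -> z / (x + y) * (x + y) `^ p <= z `^ p.
  move=> z0 zs; rewrite -[in leRHS](divfK (lt0r_neq0 s0) z) powRM ?divr_ge0// ?(ltW s0)//.
  rewrite ler_wpM2r ?powR_ge0//.
  have := z0; rewrite le_eqVlt => /predU1P[<-|z0'].
    by rewrite mul0r powR_ge0.
  apply: ger1_powR => //.
  by rewrite divr_gt0//= ler_pdivrMr// mul1r.
have := lerD (key x x0 _) (key y y0 _); rewrite -!mulrDl divff ?gt_eqF// mul1r.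
by apply; rewrite ?lerDl ?lerDr.
Qed.

(** Subadditivity of [x -> x^beta] applied to [|s + a| <= |s| + |a|] and
    [|a| <= |s| + |s + a|]. *)
Lemma normr_powR_addl (a s : R) : `| `|s + a| `^ beta - `|a| `^ beta | <= `|s| `^ beta.
Proof.
have /andP[b0 b1] := beta01.
have b01 : 0 < beta <= 1 by rewrite b0 ltW.
have mono x y : 0 <= x -> x <= y -> x `^ beta <= y `^ beta.
  move=> x0 xy; apply: ge0_ler_powR; rewrite ?nnegrE//; first exact: ltW.
  exact: le_trans xy.
have h1 : `|s + a| `^ beta <= `|s| `^ beta + `|a| `^ beta.
  apply: le_trans (powR_subadditive b01 (normr_ge0 _) (normr_ge0 _)).
  by apply: mono => //; exact: ler_normD.
have h2 : `|a| `^ beta <= `|s| `^ beta + `|s + a| `^ beta.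
  apply: le_trans (powR_subadditive b01 (normr_ge0 _) (normr_ge0 _)).
  apply: mono => //; rewrite -{1}(addKr s a) (le_trans (ler_normD _ _))// normrN//.
by rewrite ler_norml; apply/andP; split; lra.
Qed.

Lemma frac_min_near0 (a s : R) : 0 < a ->
  gam * a `^ beta - 2 * gam * `|s| `^ beta <= frac_min alpha a s <=
  gam * a `^ beta + 2 * gam * `|s| `^ beta.
Proof.
move=> a0; have g0 := frac_const_gt0 alpha01.
have := normr_powR_addl a s; have := normr_powR_addl (- a) s.
rewrite normrN (gtr0_norm a0) !ler_norml => /andP[h1 h2] /andP[h3 h4].
rewrite /frac_min; set p := `|s| `^ _ in h1 h2 h3 h4 *.
have p0 : 0 <= p by exact: powR_ge0.
apply/andP; split; rewrite [2 * _ * _]mulrAC [2 * _ * gam]mulrC -?mulrBr -?mulrDr ler_pM2l//; lra.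
Qed.

Lemma frac_minZ (r a s : R) : 0 < r ->
  frac_min alpha (a * r) s = r `^ beta * frac_min alpha a (s / r).
Proof.
move=> r0; have E x : `|x| `^ beta = r `^ beta * `|x / r| `^ beta.
  rewrite -powRM ?(ltW r0)//; congr (_ `^ _).
  by rewrite normrM normfV (gtr0_norm r0) mulrC divfK ?gt_eqF.
rewrite /frac_min (E (s + _)) (E (s - _)) (E s) mulrDl mulrBl mulfK ?gt_eqF//.
by ring.
Qed.

(** A combination of truncations supported in [r < |s| < 4 r]: the coefficients are
    determined by vanishing of the slope at the origin and of the value at
    infinity. *)
Definition tent (r s : R) : R :=
  3 * Num.min `|s| (2 * r) - 2 * Num.min `|s| r - Num.min `|s| (4 * r).

Definition frac_tent (r s : R) : R :=
  3 * frac_min alpha (2 * r) s - 2 * frac_min alpha r s - frac_min alpha (4 * r) s.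

Lemma tent_bounds (r s : R) : 0 < r -> 0 <= tent r s <= 2 * r.
Proof.
move=> r0; rewrite /tent; have := normr_ge0 s.
by case: (leP `|s| (2 * r)); case: (leP `|s| r); case: (leP `|s| (4 * r)) => *;
  apply/andP; split; lra.
Qed.

Lemma tent_small (r s : R) : 0 < r -> `|s| <= r -> tent r s = 0.
Proof.
by move=> r0 sr; rewrite /tent !min_l; lra.
Qed.

Lemma tent_large (r s : R) : 0 < r -> 4 * r <= `|s| -> tent r s = 0.
Proof.
by move=> r0 sr; rewrite /tent !min_r; lra.
Qed.

(** At the origin [frac_tent r] is a positive multiple of
    [r^beta (y - 1) (2 - y)] with [y = 2^beta] in [(1, 2)]: the jumps carry mass
    from the origin to the tent. By scaling and continuity it stays positive on
    [|s| <= eta r], and elsewhere it is bounded while [min(|s|, r) / r] is bounded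
    from below. *)
Lemma frac_tent_ge : exists2 m : R, 0 < m & exists2 K : R, 0 <= K &
  forall r s, 0 < r -> r `^ beta * (m - K * (Num.min `|s| r / r)) <= frac_tent r s.
Proof.
have /andP[b0 b1] := beta01; have g0 := frac_const_gt0 alpha01.
pose y : R := 2 `^ beta.
have y1 : 1 < y.
  by rewrite -(powRr0 2) /y /powR pnatr_eq0/= ltr_expR ltr_pM2r// ln_gt0// ltr1n.
have y2 : y < 2.
  by rewrite -[ltRHS](@powRr1 _ 2)// /y /powR pnatr_eq0/= ltr_expR ltr_pM2r// ln_gt0// ltr1n.
have y4 : 4 `^ beta = y ^+ 2.
  by rewrite expr2 -powRM// -natrM.
pose m := gam * ((y - 1) * (2 - y)) / 2.
have m0 : 0 < m.
  apply: divr_gt0 => //; apply: mulr_gt0 => //.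
  by apply: mulr_gt0; rewrite subr_gt0.
have four_gt0 : 0 < 4 :> R by exact: ltr0Sn.

pose G := gam * (3 * y + 2 + y ^+ 2).
have unit_near s : 2 * m - 12 * gam * `|s| `^ beta <= frac_tent 1 s.
  have /andP[h1 _] := frac_min_near0 s (ltr0Sn R 1).
  have /andP[_ h2] := frac_min_near0 s (@ltr01 R).
  have /andP[_ h3] := frac_min_near0 s four_gt0.
  move: h1 h2 h3; rewrite /frac_tent !mulr1 powR1 y4 -/y => h1 h2 h3.
  rewrite (_ : 2 * m = gam * (3 * y - 2 - y ^+ 2)); last by rewrite /m; field.
  set q := gam * `|s| `^ beta.
  have qE z : z * gam * `|s| `^ beta = z * q by rewrite -mulrA.
  move: h1 h2 h3; rewrite !qE !mulrBr.
  set fy := gam * y; set f2 := frac_min _ _ _; set f1 := frac_min _ _ _.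
  set f4 := frac_min _ _ _; set fyy := gam * y ^+ 2.
  rewrite (_ : gam * (3 * y) = 3 * fy); last by rewrite /fy; ring.
  by lra.
have unit_norm s : - G <= frac_tent 1 s.
  have := normr_frac_min_le alpha01 s (ltr0Sn R 1).
  have := normr_frac_min_le alpha01 s (@ltr01 R).
  have := normr_frac_min_le alpha01 s four_gt0.
  rewrite !ler_norml powR1 y4 -/y /frac_tent !mulr1.
  move=> /andP[h1 h2] /andP[h3 h4] /andP[h5 h6].
  have -> : G = 3 * (gam * y) + 2 * gam + gam * y ^+ 2 by rewrite /G; ring.
  by lra.
have G0 : 0 <= G.
  rewrite /G; apply: mulr_ge0; first exact: ltW.
  by have := sqr_ge0 y; lra.
(* The radius at which continuity at the origin has used up half of [2 * m]. *)
pose eta := (m / (12 * gam)) `^ beta^-1.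
have eta0 : 0 < eta by rewrite powR_gt0// divr_gt0// mulr_gt0.
have etaE : 12 * gam * eta `^ beta = m.
  have q0 : 0 < 12 * gam by rewrite mulr_gt0.
  rewrite -powRrM mulVf ?gt_eqF// powRr1; last by rewrite divr_ge0// ltW.
  by rewrite mulrC divfK// gt_eqF.
pose z := Num.min eta 1.
have z0 : 0 < z by rewrite lt_min eta0 ltr01.
exists m => //; exists ((m + G) / z); first by rewrite divr_ge0 ?addr_ge0// ltW.
move=> r s r0.
have -> : frac_tent r s = r `^ beta * frac_tent 1 (s / r).
  have e1 := frac_minZ 1 s r0; rewrite mul1r in e1.
  rewrite /frac_tent !mulr1 (frac_minZ 2 s r0) (frac_minZ 4 s r0) e1.
  by ring.
rewrite ler_pM2l ?powR_gt0//.
have sE : Num.min `|s| r / r = Num.min `|s / r| 1.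
  rewrite normrM normfV (gtr0_norm r0) minr_pMl; last by rewrite invr_ge0 ltW.
  by rewrite divff// gt_eqF.
rewrite sE; set t := s / r.
have t0 : 0 <= Num.min `|t| 1 by rewrite le_min normr_ge0 ler01.
have [te|et] := leP `|t| eta.
  apply: (@le_trans _ _ m).
    by rewrite lerBlDr lerDl mulr_ge0// divr_ge0 ?addr_ge0// ltW.
  apply: le_trans (unit_near t).
  have te' : `|t| `^ beta <= eta `^ beta.
    by apply: ge0_ler_powR; rewrite ?nnegrE// ltW.
  have q0 : 0 <= 12 * gam by rewrite mulr_ge0// ltW.
  have := ler_wpM2l q0 te'; rewrite etaE; lra.
apply: le_trans (unit_norm t).
have zt : z <= Num.min `|t| 1.
  by rewrite /z le_min !ge_min lexx orbT (ltW et).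
have q0 : 0 <= (m + G) / z by rewrite divr_ge0 ?addr_ge0// ltW.
have := ler_wpM2l q0 zt; rewrite divfK ?gt_eqF//; lra.
Qed.

End tents.

(** * Escape of mass when the weighted dissipation diverges *)

Section divergent_case.
Context {R : realType} {d : nat}.
Local Notation V := 'rV[R]_d.
Local Notation mu := (@lebesgue_rV R d).
Variables (nu alpha : R) (k g h : R -> R) (kap r0 C delta : R).
Hypothesis d0 : (0 < d)%N.
Hypothesis nu0 : 0 < nu.
Hypothesis alpha01 : 0 < alpha < 1.
Hypothesis kb : kernel_bounds k g h kap r0 C delta.

Local Notation beta := (1 - alpha).
Local Notation rho j := (@scale R d r0 j).
Local Notation c j := (@scale_weight R d h r0 j).

Definition tent_moment (r : R) (i : 'I_d) (f : V -> R) : R :=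
  3 * moment (2 * r) i f - 2 * moment r i f - moment (4 * r) i f.

Lemma tent_momentE r i (f : V -> R) : 0 < r -> L1 f ->
  L1 (fun x => tent r (x ord0 i) * f x) /\
  tent_moment r i f = \int[mu]_x (tent r (x ord0 i) * f x).
Proof.
move=> r_gt0 Lf.
have L2 : L1 (fun x => 3 * (Num.min `|x ord0 i| (2 * r) * f x)).
  by apply: integrableZ; apply: integrable_moment => //; rewrite mulr_gt0.
have L1' : L1 (fun x => 2 * (Num.min `|x ord0 i| r * f x)).
  by apply: integrableZ; apply: integrable_moment.
have L4 : L1 (fun x => Num.min `|x ord0 i| (4 * r) * f x).
  by apply: integrable_moment => //; rewrite mulr_gt0.
have tentE : (fun x : V => tent r (x ord0 i) * f x) = fun x =>
    3 * (Num.min `|x ord0 i| (2 * r) * f x) - 2 * (Num.min `|x ord0 i| r * f x)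
    - Num.min `|x ord0 i| (4 * r) * f x.
  by apply/funext => x; rewrite /tent; ring.
have L21 := integrable_sub L2 L1'.
rewrite tentE; split; first exact: integrable_sub L4.
rewrite RintegralB// RintegralB// !RintegralZl//; apply: integrable_moment => //.
by rewrite mulr_gt0.
Qed.

(** At most one tent is nonzero at a given point, because the scales increase by
    a factor of at least four. *)
Lemma tent_weight_sum_le n i (x : V) :
  \sum_(j < n) h (2 * rho j.+2) / (2 * rho j.+2) * tent (rho j.+2) (x ord0 i) <=
  reach h x.
Proof.
have s0 j : 0 < rho j by exact: scale_gt0 kb d0 j.
elim: n => [|n IH]; first by rewrite big_ord0; exact: kb_ge0 kb _.
rewrite big_ord_recr/=; have [xs|sx] := leP `|x ord0 i| (rho n.+2).
  by rewrite tent_small// mulr0 addr0.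
rewrite big1 ?add0r => [|j _]; last first.
  rewrite tent_large ?mulr0// (le_trans _ (ltW sx))//.
  apply: (@le_trans _ _ (rho j.+3)).
    by rewrite [leRHS]scaleS ler_pM2r// ratio_ge4.
  by apply: (scale_le kb d0); rewrite !ltnS.
have /andP[t0 t1] := tent_bounds (x ord0 i) (s0 n.+2).
have q0 : 0 < 2 * rho n.+2 by rewrite mulr_gt0.
apply: (@le_trans _ _ (h (2 * rho n.+2))).
  rewrite -[leRHS](divfK (lt0r_neq0 q0)) ler_wpM2l//.
  by rewrite divr_ge0 ?(kb_ge0 kb)// ltW.
apply: (kb_homo kb); rewrite ler_pM2l// (le_trans (ltW sx))//.
exact: coord_le_enorm.
Qed.

Let powR_large p (Y : R) : 0 < p -> 0 <= Y ->
  forall r, Y `^ p^-1 <= r -> Y <= r `^ p.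
Proof.
move=> p0 Y0 r Yr; rewrite -{1}(powRr1 Y0) -(mulVf (lt0r_neq0 p0)) powRrM.
apply: ge0_ler_powR => //; rewrite ?nnegrE ?powR_ge0//; first exact: ltW.
exact: le_trans (powR_ge0 _ _) Yr.
Qed.

Section escape.
Variables (u0 : V -> R) (T : R) (u : R -> V -> R) (s Cs : R).
Hypothesis u0_ge0 : forall x, 0 <= u0 x.
Hypothesis Lu0 : L1 u0.
Hypothesis Lxu0 : L1 (fun x => enorm x * u0 x).
Hypothesis sol : solution nu alpha k u0 T u.
Hypothesis M_gt0 : 0 < \int[mu]_x u0 x.
Hypothesis sT : 0 < s < T.
Hypothesis Cs_ge0 : 0 <= Cs.
Hypothesis HCs : forall t, 0 <= t <= s ->
  L1 (fun x => reach h x * u t x) /\ \int[mu]_x (reach h x * u t x) <= Cs.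

Local Notation M := (\int[mu]_x u0 x).
Local Notation M1 := (\int[mu]_x (enorm x * u0 x)).

Let int_frac_tentE r i t : 0 < r -> 0 <= t < T ->
  L1 (fun x => frac_tent alpha r (x ord0 i) * u t x) /\
  \int[mu]_x (frac_tent alpha r (x ord0 i) * u t x) =
  3 * \int[mu]_x (frac_min alpha (2 * r) (x ord0 i) * u t x)
  - 2 * \int[mu]_x (frac_min alpha r (x ord0 i) * u t x)
  - \int[mu]_x (frac_min alpha (4 * r) (x ord0 i) * u t x).
Proof.
move=> r_gt0 tT; have Lt := sol_L1 sol tT.
have LF a : 0 < a -> L1 (fun x => frac_min alpha a (x ord0 i) * u t x).
  move=> a0; apply: (integrable_bdMl (C := frac_const alpha * a `^ beta)) => //.
    by apply: (measurableT_comp (measurable_frac_min alpha a)); exact: measurable_coord_rV.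
  by move=> x; exact: normr_frac_min_le.
have r2 : 0 < 2 * r by rewrite mulr_gt0.
have r4 : 0 < 4 * r by rewrite mulr_gt0.
have F1 := LF _ r_gt0; have F2 := LF _ r2; have F4 := LF _ r4.
have E : (fun x : V => frac_tent alpha r (x ord0 i) * u t x) = fun x =>
    3 * (frac_min alpha (2 * r) (x ord0 i) * u t x)
    - 2 * (frac_min alpha r (x ord0 i) * u t x)
    - frac_min alpha (4 * r) (x ord0 i) * u t x.
  by apply/funext => x; rewrite /frac_tent; ring.
have Z2 := integrableZ 3 F2; have Z1 := integrableZ 2 F1.
have L21 := integrable_sub Z2 Z1.
rewrite E; split; first exact: integrable_sub F4.
by rewrite RintegralB// RintegralB// !RintegralZl.
Qed.

(** The jumps send mass of order [r^(-alpha)] to distance [r] in bounded time: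
    most of the mass is still at distance much less than [r], where the
    fractional Laplacian of the tent is of order [r^beta], and the drift is
    bounded independently of [r]. *)
Lemma tent_moment_ge i : exists2 b : R, 0 < b & exists X : R,
  forall r, 0 < r -> X <= r -> b * r `^ beta <= tent_moment r i (u s).
Proof.
have /andP[s0 s1] := sT; have /andP[a0 a1] := alpha01.
have b0 : 0 < beta by rewrite subr_gt0.
have [m m0 [K K0 HK]] := frac_tent_ge alpha01.
have g0 := frac_const_gt0 alpha01.
have s_ge0 := ltW s0; have M_ge0 := ltW M_gt0; have nu_ge0 := ltW nu0.
have g_ge0 := ltW g0; have mM0 : 0 < m * M by exact: mulr_gt0.
have M1_ge0 : 0 <= M1 by apply: Rintegral_ge0 => x _; rewrite mulr_ge0 ?enorm_ge0.
pose A0 := M1 + s * (2 * M * Cs).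
pose A1 := s * (nu * (frac_const alpha * M)).
have A0_ge0 : 0 <= A0.
  by rewrite /A0; apply: addr_ge0 => //; do 3 apply: mulr_ge0 => //.
have A1_ge0 : 0 <= A1 by rewrite /A1; do 3 apply: mulr_ge0 => //.
(* For large [r] half of the leading term [nu * m * M * r^beta] absorbs the initial
   moment ([Y0]), its growth up to time [s] ([Y1]) and the drift ([Y2]). *)
pose Y0 := 8 * K * A0 / (m * M).
pose Y1 := 8 * K * A1 / (m * M).
pose Y2 := 48 * Cs / (nu * m).
have Y1_ge0 : 0 <= Y1.
  by rewrite /Y1; apply: divr_ge0; [apply: mulr_ge0 => //; exact: mulr_ge0|exact: ltW].
have Y2_ge0 : 0 <= Y2.
  by rewrite /Y2; apply: divr_ge0; [exact: mulr_ge0|rewrite mulr_ge0// ltW].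
have h0 : 0 < nu * (m * M / 2) by rewrite mulr_gt0// divr_gt0.
exists (nu * (m * M / 2) * s); first exact: mulr_gt0.
exists (Num.max Y0 (Num.max (Y1 `^ alpha^-1) (Y2 `^ beta^-1))) => r r_gt0.
rewrite !ge_max => /and3P[rY0 rY1 rY2].
have := powR_large a0 Y1_ge0 rY1; have := powR_large b0 Y2_ge0 rY2.
move: rY0; rewrite /Y0 /Y1 /Y2 !ler_pdivrMr ?(mulr_gt0 nu0 m0)// => HY0 HY2 HY1.
set p := r `^ beta in HY2 *; set q := r `^ alpha in HY1.
have p0 : 0 < p by exact: powR_gt0.
have pq : p * q = r.
  by rewrite /p /q -powRD ?subrK ?powRr1 ?(ltW r_gt0)//; apply/implyP => _; rewrite gt_eqF.
have r2 : 0 < 2 * r by rewrite mulr_gt0.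
have r4 : 0 < 4 * r by rewrite mulr_gt0.
pose D t := 3 * drift k (u t) (2 * r) i - 2 * drift k (u t) r i - drift k (u t) (4 * r) i.
have dB t : 0 < t <= s -> is_derive t 1 (fun t => tent_moment r i (u t))
    (nu * \int[mu]_x (frac_tent alpha r (x ord0 i) * u t x) + D t).
  move=> /andP[t0 ts]; have tT : 0 < t < T by rewrite t0 (le_lt_trans ts).
  have tT' : 0 <= t < T by case/andP: tT => /ltW ->.
  have [_ ->] := int_frac_tentE i r_gt0 tT'.
  have i2 := is_derive_moment alpha01 sol i r2 tT.
  have i1 := is_derive_moment alpha01 sol i r_gt0 tT.
  have i4 := is_derive_moment alpha01 sol i r4 tT.
  have sc z (f : R -> R) df : is_derive t 1 f df -> is_derive t 1 (fun t => z * f t) (z * df).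
    by move=> fE; exact: is_deriveZ.
  have j2 := sc 3 _ _ i2; have j1 := sc 2 _ _ i1.
  rewrite (_ : (fun t => tent_moment r i (u t)) =
    (fun t => 3 * moment (2 * r) i (u t)) - (fun t => 2 * moment r i (u t)) -
    (fun t => moment (4 * r) i (u t))); last by apply/funext.
  have j3 := is_deriveB (is_deriveB j2 j1) i4.
  apply: (is_derive_eq j3).
  rewrite /D; move: (\int[mu]_x (_ * _)) (\int[mu]_x (_ * _)) (\int[mu]_x (_ * _)).
  move: (drift _ _ _ _) (drift _ _ _ _) (drift _ _ _ _) => *; ring.
have cB : {within `[0, s], continuous (fun t => tent_moment r i (u t))}.
  have c2 := continuous_moment (i := i) alpha01 sol r2 sT.
  have c1 := continuous_moment (i := i) alpha01 sol r_gt0 sT.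
  have c4 := continuous_moment (i := i) alpha01 sol r4 sT.
  have cst (z : R) : {within `[0, s], continuous (fun _ : R => z)} by exact: cst_continuous.
  move=> t; have d2 := continuousM (cst 3 t) (c2 t); have d1 := continuousM (cst 2 t) (c1 t).
  exact: (continuousB (continuousB d2 d1) (c4 t)).
have rate t : 0 < t < s -> nu * (m * M / 2) * p <=
    nu * \int[mu]_x (frac_tent alpha r (x ord0 i) * u t x) + D t.
  move=> /andP[t0 ts]; have ts' : 0 <= t <= s by rewrite !ltW.
  have tT : 0 <= t < T by rewrite (ltW t0) (lt_trans ts).
  have [Lr Hr] := HCs ts'; have Lt := sol_L1 sol tT.
  have HD : - (12 * M * Cs) <= D t.
    have d1 := sol_drift_le kb u0_ge0 sol i r_gt0 tT Lr Hr.
    have d2 := sol_drift_le kb u0_ge0 sol i r2 tT Lr Hr.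
    have d4 := sol_drift_le kb u0_ge0 sol i r4 tT Lr Hr.
    move: d1 d2 d4; rewrite !ler_norml /D => /andP[? ?] /andP[? ?] /andP[? ?].
    rewrite (_ : 12 * M * Cs = 6 * (2 * M * Cs)); last by ring.
    lra.
  have Hm : moment r i (u t) <= A0 + A1 * p.
    apply: (le_trans (moment_growth nu0 alpha01 kb u0_ge0 Lu0 Lxu0 sol i r_gt0 sT ts' HCs)).
    by rewrite /A0 /A1 -/p le_eqVlt; apply/orP; left; apply/eqP; ring.
  have HI : p * (m * M - K * (moment r i (u t) / r)) <=
      \int[mu]_x (frac_tent alpha r (x ord0 i) * u t x).
    have Lm : L1 (fun x => K / r * (Num.min `|x ord0 i| r * u t x)).
      by apply: integrableZ; exact: integrable_moment.
    have LM := integrableZ m Lt; have Lmm := integrable_sub LM Lm.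
    rewrite (_ : p * _ = \int[mu]_x (p * (m * u t x - K / r * (Num.min `|x ord0 i| r * u t x)))).
      apply: int_le; [exact: integrableZ|by have [] := int_frac_tentE i r_gt0 tT|].
      move=> x; have := ler_wpM2r (sol_ge0 sol x tT) (HK r (x ord0 i) r_gt0).
      apply: le_trans; rewrite -/p le_eqVlt; apply/orP; left; apply/eqP.
      by field; rewrite gt_eqF.
    rewrite RintegralZl// RintegralB// !RintegralZl//; last exact: integrable_moment.
    by rewrite (sol_mass sol tT) -/(moment r i (u t)) mulrA mulrAC.
  have n1 : K * (A0 + A1 * p) <= m * M / 4 * r.
    rewrite mulrDr (_ : m * M / 4 * r = m * M / 8 * r + m * M / 8 * (p * q)); last by rewrite pq; field.
    apply: lerD; first by lra.
    have := ler_wpM2l (ltW p0) HY1; lra.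
  have n2 : K * (moment r i (u t) / r) <= m * M / 4.
    rewrite mulrA ler_pdivrMr// (le_trans _ n1)// ler_wpM2l//.
  have n3 : p * (m * M * (3 / 4)) <= \int[mu]_x (frac_tent alpha r (x ord0 i) * u t x).
    by apply: le_trans HI; rewrite ler_pM2l//; lra.
  have n4 : nu * (p * (m * M * (3 / 4))) <=
      nu * \int[mu]_x (frac_tent alpha r (x ord0 i) * u t x) by rewrite ler_pM2l.
  have n5 : 12 * M * Cs <= nu * (p * (m * M / 4)).
    have := ler_wpM2l M_ge0 HY2.
    rewrite (_ : nu * (p * (m * M / 4)) = M * (p * (nu * m)) / 4); last by field.
    lra.
  rewrite (_ : nu * (m * M / 2) * p = nu * (p * (m * M * (3 / 4))) - nu * (p * (m * M / 4))); last by field.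
  lra.
have B0 : 0 <= tent_moment r i (u 0).
  rewrite (sol_init sol); have [_ ->] := tent_momentE i r_gt0 Lu0.
  apply: Rintegral_ge0 => x _; rewrite mulr_ge0//.
  by case/andP: (tent_bounds (x ord0 i) r_gt0).
have ss : 0 <= s <= s by rewrite s_ge0 lexx.
apply: le_trans (ge_of_derive_ge ss cB dB rate).
by rewrite [leLHS]mulrAC lerDr.
Qed.

End escape.

Let sum_le_tail (a e : nat -> R) J n : (forall j, 0 <= a j) -> (forall j, 0 <= e j) ->
  (forall j, (J <= j)%N -> a j <= e j) ->
  \sum_(j < n) a j <= \sum_(j < J) a j + \sum_(j < n) e j.
Proof.
move=> a_ge0 e_ge0 ae; elim: n => [|n IH].
  by rewrite !big_ord0 addr0; apply: sumr_ge0.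
have [Jn|nJ] := leqP J n.
  by rewrite big_ord_recr [in leRHS]big_ord_recr/= addrA lerD// ae.
apply: (@le_trans _ _ (\sum_(j < J) a j)).
  rewrite -(subnK nJ); elim: (J - n.+1)%N => [|p IHp]; first by rewrite add0n.
  by rewrite addSn [leRHS]big_ord_recr/= (le_trans IHp)// lerDl.
by rewrite lerDl sumr_ge0.
Qed.

(** The mass sent to distance [rho j] has reach [h (2 * rho j)], so finiteness
    of the integral of the reach bounds the sum of [c j * rho j ^ beta]. *)
Lemma summable_of_solution (u0 : V -> R) T u :
  (forall x, 0 <= u0 x) -> L1 u0 -> L1 (fun x => enorm x * u0 x) ->
  0 < \int[mu]_x u0 x -> 0 < T -> solution nu alpha k u0 T u ->
  exists C2 : R, forall n, \sum_(j < n) c j * rho j `^ beta <= C2.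
Proof.
move=> u0_ge0 Lu0 Lxu0 M_gt0 T0 sol.
pose s := T / 2; have sT : 0 < s < T by rewrite /s; lra.
have sT' : 0 <= s < T by case/andP: sT => /ltW ->.
have /andP[s0 s1] := sT.
have [Cs Cs_ge0 HCs] := sol_reach kb sol sT'.
pose i : 'I_d := Ordinal d0.
have [b b0 [X HX]] := tent_moment_ge u0_ge0 Lu0 Lxu0 sol M_gt0 sT Cs_ge0 HCs i.
have rho0 j : 0 < rho j by exact: scale_gt0 kb d0 j.
have [J HJ] := scale_large kb d0 X.
have ratio0 : 0 < @ratio R d by rewrite (lt_le_trans _ (ratio_ge4 d0)).
pose K := 2 * @ratio R d ^+ 2 / b.
have K0 : 0 <= K by rewrite divr_ge0 ?mulr_ge0 ?sqr_ge0// ltW.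
pose w j := h (2 * rho j.+2) / (2 * rho j.+2).
have w0 j : 0 <= w j by rewrite divr_ge0 ?(kb_ge0 kb)// mulr_ge0// ltW.
have ss : 0 <= s <= s by rewrite (ltW s0) lexx.
have Ls := sol_L1 sol sT'; have us x : 0 <= u s x by exact: (sol_ge0 sol x sT').
have tm_ge0 j : 0 <= tent_moment (rho j) i (u s).
  have [_ ->] := tent_momentE i (rho0 j) Ls.
  apply: Rintegral_ge0 => x _; rewrite mulr_ge0//.
  by case/andP: (tent_bounds (x ord0 i) (rho0 j)).
have c_ge0 j : 0 <= c j by exact: scale_weight_ge0 kb d0 j.
pose e j := K * (w j * tent_moment (rho j.+2) i (u s)).
have ae j : (J <= j)%N -> c j * rho j `^ beta <= e j.
  move=> Jj; have J2 : (J <= j.+2)%N by rewrite (leq_trans Jj)// -addn2 leq_addr.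
  have := HX _ (rho0 j.+2) (HJ _ J2).
  have mono : rho j `^ beta <= rho j.+2 `^ beta.
    apply: ge0_ler_powR; rewrite ?nnegrE ?(ltW (rho0 _))//.
      by case/andP: alpha01 => _ ?; rewrite subr_ge0 ltW.
    by apply: (scale_le kb d0); rewrite -addn2 leq_addr.
  move=> H; apply: (@le_trans _ _ (c j * rho j.+2 `^ beta)); first exact: ler_wpM2l.
  rewrite (_ : e j = c j * (tent_moment (rho j.+2) i (u s) / b)); last first.
    rewrite /e /K /w /scale_weight !scaleS; field.
    by rewrite !gt_eqF.
  by apply: ler_wpM2l => //; rewrite ler_pdivlMr// mulrC.
have e_ge0 j : 0 <= e j by apply: mulr_ge0 => //; exact: mulr_ge0.
have a_ge0 j : 0 <= c j * rho j `^ beta by rewrite mulr_ge0// powR_ge0.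
exists (\sum_(j < J) c j * rho j `^ beta + K * Cs) => n.
apply: (le_trans (sum_le_tail n a_ge0 e_ge0 ae)); rewrite lerD2l.
rewrite -mulr_sumr ler_wpM2l//.
have [Lr Hr] := HCs s ss; apply: le_trans Hr.
have tm j := tent_momentE i (rho0 j) Ls.
rewrite (eq_bigr (fun j : 'I_n => \int[mu]_x (w j * (tent (rho j.+2) (x ord0 i) * u s x)))); last first.
  by move=> j _; have [L ->] := tm j.+2; rewrite RintegralZl.
have iS (j : 'I_n) : L1 (fun x => w j * (tent (rho j.+2) (x ord0 i) * u s x)).
  by apply: integrableZ; have [] := tm j.+2.
rewrite -int_sum//; apply: (int_le (integrable_big _ iS) Lr) => x.
rewrite (eq_bigr (fun j : 'I_n => w j * tent (rho j.+2) (x ord0 i) * u s x)); last first.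
  by move=> j _; rewrite mulrA.
by rewrite -mulr_suml ler_wpM2r// tent_weight_sum_le.
Qed.

End divergent_case.

(** * Finite-time blow-up *)

Unset Implicit Arguments.
Set Strict Implicit.
Set Printing Implicit Defensive.

Theorem theorem2p2 (R : realType) (d : nat) (nu alpha : R) (k : R -> R) :
  (0 < d)%N -> 0 < nu -> 0 < alpha < 1 ->
  locally_lipschitz k -> cond_H1 k \/ cond_H2 k ->
  exists Mlarge M1small : R, [/\ 0 < Mlarge, 0 < M1small &
    forall u0 : 'rV[R]_d -> R,
      (forall x, 0 <= u0 x) ->
      L1 u0 ->
      ~ {ae lebesgue_rV d, forall x, u0 x = 0} ->
      (forall x, u0 (- x) = u0 x) ->
      L1 (fun x => enorm x * u0 x) ->
      Mlarge <= \int[lebesgue_rV d]_x u0 x ->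
      \int[lebesgue_rV d]_x (enorm x * u0 x) <= M1small ->
      exists2 T : R, 0 < T &
        forall u : R -> 'rV[R]_d -> R, ~ solution nu alpha k u0 T u].
Proof.
move=> d0 nu0 alpha01 lip hyp.
have [g [h [kap [r0 [C [delta kb]]]]]] := exists_kernel_bounds lip hyp.
have [summable|divergent] := pselect (exists C2 : R, forall n,
    \sum_(j < n) @scale_weight R d h r0 j * @scale R d r0 j `^ (1 - alpha) <= C2).
  have [Ml [Ms [Ml0 Ms0 H]]] := blowup_of_summable d0 nu0 alpha01 kb summable.
  exists Ml, Ms; split => // u0 u0_ge0 Lu0 _ _ Lxu0.
  exact: H.
exists 1, 1; split => // u0 u0_ge0 Lu0 _ _ Lxu0 HM _.
exists 1 => // u sol; apply: divergent.
have M0 : 0 < \int[lebesgue_rV d]_x u0 x by exact: lt_le_trans HM.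
exact: (summable_of_solution d0 nu0 alpha01 kb u0_ge0 Lu0 Lxu0 M0 ltr01 sol).
Qed.
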